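(* Let $d\ge 2$, let the scale sequence $\{S_j\}$ and the weight functions $\{b_j\}$ satisfy the conditions listed in the context, and let $f$ be a zero-mean, finite-variance, isotropic random field on $\mathbb{S}^d$ whose angular power spectrum satisfies $C_\ell=\ell^{-\alpha}g(\ell)$ for $\ell\ge1$, where $\alpha>2$ and $g:\mathbb{R}^+\to\mathbb{R}^+$ is a smooth function such that (i) $g_1\le g(u)\le g_2$ for all $u$, for some constants $g_2\ge g_1>0$; (ii) for some $\beta\in[0,1)$ and every $r\in\mathbb{N}$, $g^{(r)}(u)=\frac{d^r g(u)}{du^r}=O(u^{-(1-\beta)r})$ as $u\to\infty$. For $x\in\mathbb{S}^d$ let $\beta_j(x)=\int_{\mathbb{S}^d}f(y)\,\Psi_j(x,y)\,dy$, with $\Psi_j(x,y)=\sum_{\ell\ge0}b_j(\ell)Z_{\ell;d}(\langle x,y\rangle)$. Then for every $N\in\mathbb{N}$ there exists a constant $C_N>0$ (depending on $\alpha$, $d$ and $g(\cdot)$, and not depending on $x,y,j$) such that, for all sufficiently large $j$ and all $x,y\in\mathbb{S}^d$ with $\theta:=\arccos\langle x,y\rangle>0$, $$\mathrm{Corr}(\beta_j(x),\beta_j(y))\le C_N\,\max\left\{\frac{1}{\bigl(S_{j-1}^{(1-\beta)}\theta\bigr)^{2N}},\ \frac{1}{\bigl((S_j-S_{j-1})\theta\bigr)^{2N}}\right\}.$$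
   Context: Kernel. For $d\ge2$ put $\eta_d=(d-1)/2$ and $\omega_d=\frac{2\pi^{(d+1)/2}}{\Gamma((d+1)/2)}$. For $\ell\ge0$ and $t\in[-1,1]$, $Z_{\ell;d}(t)=\frac{\ell+\eta_d}{\eta_d\,\omega_d}\,G_\ell^{(\eta_d)}(t)$, where $G_\ell^{(\eta_d)}$ is the Gegenbauer polynomial of degree $\ell$ and parameter $\eta_d$. If $\{Y_{\ell,m}\}_{m=1,\dots,N_{\ell;d}}$ is an orthonormal basis of the space of spherical harmonics of degree $\ell$ on $\mathbb{S}^d$ (of dimension $N_{\ell;d}$), then $Z_{\ell;d}(\langle x,y\rangle)=\sum_{m}\overline{Y}_{\ell,m}(x)Y_{\ell,m}(y)$. Scale sequence. $\{S_j\}_{j\ge0}$ is a strictly increasing sequence of real numbers with $S_0=1$ and $S_j-S_{j-1}\le S_{j+1}-S_j$ for all $j\ge 1$. Weight functions. $\{b_j\}_{j\ge0}$ is a sequence of real-valued $C^\infty$ functions on $[0,\infty)$ such that (conditions involving $S_{j-1}$ being read for $j\ge1$): 1. for every $n\in\mathbb{N}$ there is a constant $K(n)$, not depending on $j$, such that for all $j$ and all $u$, $|D^{(n)}b_j(u)|\le K(n)\,(S_j-S_{j-1})^{-n}$, where $D^{(n)}$ denotes the $n$-th derivative; 2. $b_j$ has compact support contained in $\Lambda_j=[S_{j-1},S_{j+1}]$, with $b_j(S_{j-1})=b_j(S_{j+1})=0$ and $b_j(S_j)=1$; 3. (partition of unity) $\sum_{j\ge0}b_j^2(u)=1$ for all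 $u\ge1$. The sequences $\{S_j\}$ and $\{b_j\}$ are fixed throughout. Random field. A zero-mean, finite-variance isotropic random field $f$ on $\mathbb{S}^d$ has the spectral representation $f(x)=\sum_{\ell\ge0}\sum_{m=1}^{N_{\ell;d}}a_{\ell,m}Y_{\ell,m}(x)$ in $L^2(\Omega\times\mathbb{S}^d)$, with zero-mean random coefficients satisfying $\mathbb{E}[a_{\ell,m}\overline{a}_{\ell',m'}]=\delta_\ell^{\ell'}\delta_m^{m'}C_\ell$; the sequence $\{C_\ell\}$ is the angular power spectrum of $f$. $\mathrm{Corr}(X,Y)=\mathrm{Cov}(X,Y)/\sqrt{\mathrm{Var}(X)\mathrm{Var}(Y)}$ is the usual correlation coefficient. *)

(* Defs.v *)
From HB Require Import structures.
From mathcomp Require Import all_boot all_order all_algebra.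
From mathcomp Require Import complex.
From mathcomp Require Import all_classical all_reals all_analysis.
From mathcomp Require Import measurable_realfun.
From mathcomp.multinomials Require mpoly.
Import (canonicals, coercions) mpoly.

Set Implicit Arguments.
Unset Strict Implicit.
Unset Printing Implicit Defensive.

Import Order.TTheory GRing.Theory Num.Theory numFieldNormedType.Exports.

Local Open Scope classical_set_scope.
Local Open Scope ring_scope.
Local Open Scope complex_scope.

(* R^n is n.-tuple R, which carries the product sigma-algebra; S^d is a subset
   of d.+1.-tuple R. *)

Section LebesgueTuple.
Context {R : realType}.

Definition cons_pair n (p : R * n.-tuple R) : n.+1.-tuple R :=
  [the n.+1.-tuple R of p.1 :: p.2].

Definition uncons n (x : n.+1.-tuple R) : R * n.-tuple R :=
  (thead x, [tuple of behead x]).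

Lemma measurable_cons_pair n :
  measurable_fun [set: R * n.-tuple R] (@cons_pair n).
Proof. exact: measurable_cons. Qed.

Lemma measurable_uncons n : measurable_fun [set: n.+1.-tuple R] (@uncons n).
Proof.
apply/measurable_fun_pair; first exact: measurable_tnth.
exact: measurable_behead.
Qed.

Lemma cons_pairK n : cancel (@cons_pair n) (@uncons n).
Proof. by case=> a x; congr pair; apply/val_inj. Qed.

Section Cons.
Variables (n : nat) (mu : {sigma_finite_measure set n.-tuple R -> \bar R}).

Definition lebesgue_cons (A : set (n.+1.-tuple R)) : \bar R :=
  pushforward (lebesgue_measure \x mu)%E (@cons_pair n) A.

Let lebesgue_cons_measure :=
  [the {measure set n.+1.-tuple R -> \bar R} of
   measure_function_pushforward__canonical__measure_function_Measure
     (lebesgue_measure \x mu)%E (@measurable_cons_pair n)].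

Let lebesgue_cons0 : lebesgue_cons set0 = 0%E.
Proof. exact: (measure0 lebesgue_cons_measure). Qed.

Let lebesgue_cons_ge0 A : (0 <= lebesgue_cons A)%E.
Proof. exact: (measure_ge0 lebesgue_cons_measure). Qed.

Let lebesgue_cons_sigma_additive : semi_sigma_additive lebesgue_cons.
Proof. exact: (@measure_semi_sigma_additive _ _ _ lebesgue_cons_measure). Qed.

HB.instance Definition _ := isMeasure.Build _ _ _ lebesgue_cons
  lebesgue_cons0 lebesgue_cons_ge0 lebesgue_cons_sigma_additive.

Let lebesgue_cons_sigma_finite : sigma_finite setT lebesgue_cons.
Proof.
have /sigma_finiteP[F [FT ndF Foo]] := sigma_finiteT (@lebesgue_measure R).
have /sigma_finiteP[G [GT ndG Goo]] := sigma_finiteT mu.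
exists (fun k => @uncons n @^-1` (F k `*` G k)).
  rewrite -preimage_bigcup (_ : \bigcup_k _ = setT) ?preimage_setT//.
  rewrite -subTset => -[a x] _.
  have [i _ Fia] : (\bigcup_k F k) a by rewrite -FT.
  have [j _ Gjx] : (\bigcup_k G k) x by rewrite -GT.
  exists (maxn i j) => //; split=> /=.
    by move: a Fia; exact/subsetPset/ndF/leq_maxl.
  by move: x Gjx; exact/subsetPset/ndG/leq_maxr.
move=> k; have [mF Fk] := Foo k; have [mG Gk] := Goo k; split.
  rewrite -[X in measurable X]setTI; apply: measurable_uncons => //.
  exact: measurableX.
rewrite /lebesgue_cons /pushforward (_ : _ @^-1` _ = F k `*` G k); last first.
  by apply/funext => p; exact: (congr1 (F k `*` G k) (cons_pairK p)).
by rewrite product_measure1E// lte_mul_pinfty// ge0_fin_numE.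
Qed.

HB.instance Definition _ := Measure_isSigmaFinite.Build _ _ _ lebesgue_cons
  lebesgue_cons_sigma_finite.

End Cons.

Fixpoint lebesgue_tuple n : {sigma_finite_measure set n.-tuple R -> \bar R} :=
  match n with
  | 0 => \d_([tuple] : 0.-tuple R)
  | n'.+1 => lebesgue_cons (lebesgue_tuple n')
  end.

End LebesgueTuple.

Section Sphere.
Context {R : realType}.

Definition dotp n (x y : n.-tuple R) : R := \sum_(i < n) tnth x i * tnth y i.

Definition normt n (x : n.-tuple R) : R := Num.sqrt (dotp x x).

Definition sphere d : set (d.+1.-tuple R) := [set x | normt x = 1].
Arguments sphere : clear implicits.

Definition normalize n (x : n.-tuple R) : n.-tuple R :=
  [tuple (normt x)^-1 * tnth x i | i < n].

Definition punctured_ball n : set (n.-tuple R) := [set x | 0 < normt x <= 1].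
Arguments punctured_ball : clear implicits.

Lemma measurable_dotp n :
  measurable_fun [set: n.-tuple R] (fun x => dotp x x).
Proof.
by apply: measurable_sum => i; apply: measurable_funM; exact: measurable_tnth.
Qed.

Lemma measurable_normt n : measurable_fun [set: n.-tuple R] (@normt n).
Proof.
apply: (@measurableT_comp _ _ _ _ _ _ (@Num.sqrt R)); last first.
  exact: measurable_dotp.
by apply: continuous_measurable_fun; exact: sqrt_continuous.
Qed.

Lemma measurable_normalize n : measurable_fun [set: n.-tuple R] (@normalize n).
Proof.
apply/measurable_fun_tnthP => i.
rewrite (_ : _ \o _ = fun x => (normt x)^-1 * tnth x i); last first.
  by apply/funext => x /=; rewrite tnth_mktuple.
apply: measurable_funM; last exact: measurable_tnth.
rewrite (_ : (fun x => _) = (fun r => r `^ (-1)) \o @normt n); last first.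
  by apply/funext => x /=; rewrite powR_inv1// sqrtr_ge0.
by apply: measurableT_comp; [exact: measurable_powR|exact: measurable_normt].
Qed.

Lemma measurable_punctured_ball n : measurable (punctured_ball n).
Proof.
have -> : punctured_ball n = @normt n @^-1` [set` `]0, 1]].
  by apply/seteqP; split=> x /=; rewrite in_itv.
by rewrite -[X in measurable X]setTI; exact: measurable_normt.
Qed.

Section SurfaceMeasure.
Variable d : nat.

(* (d+1) times the volume of the cone {r x | 0 < r <= 1, x in A, |x| = 1};
   the result is a measure on R^(d+1) concentrated on the sphere. *)
Definition surface_measure (A : set (d.+1.-tuple R)) : \bar R :=
  ((d.+1%:R)%:E *
   lebesgue_tuple d.+1 (punctured_ball d.+1 `&` @normalize d.+1 @^-1` A))%E.

Let surface_measure0 : surface_measure set0 = 0%E.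
Proof. by rewrite /surface_measure preimage_set0 setI0 measure0 mule0. Qed.

Let surface_measure_ge0 A : (0 <= surface_measure A)%E.
Proof. by rewrite /surface_measure mule_ge0// lee_fin. Qed.

Let surface_measure_sigma_additive : semi_sigma_additive surface_measure.
Proof.
move=> F mF tF mUF; rewrite /surface_measure.
under eq_fun do rewrite -ge0_sume_distrr//.
apply: cvgeZl => //.
rewrite preimage_bigcup setI_bigcupr.
have mG i : measurable (punctured_ball d.+1 `&` @normalize d.+1 @^-1` F i).
  apply: measurableI; first exact: measurable_punctured_ball.
  by rewrite -[X in measurable X]setTI; exact: measurable_normalize.
apply: measure_semi_sigma_additive => //.
  apply/trivIsetP => i j _ _ ij; rewrite setIACA setIid -(preimage_setI (@normalize d.+1)).
  by move/trivIsetP : tF => /(_ _ _ _ _ ij) ->//; rewrite preimage_set0 setI0.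
exact: bigcup_measurable.
Qed.

HB.instance Definition _ := isMeasure.Build _ _ _ surface_measure
  surface_measure0 surface_measure_ge0 surface_measure_sigma_additive.

End SurfaceMeasure.

End Sphere.
Arguments sphere {R} d _.
Arguments punctured_ball {R} n _.
Arguments surface_measure {R} d _.

Section ZonalKernel.
Context {R : realType}.

Definition Gamma (s : R) : R :=
  \int[lebesgue_measure]_(t in `]0, +oo[) (t `^ (s - 1) * expR (- t)).

Definition eta d : R := (d%:R - 1) / 2.

Definition omega d : R :=
  2 * pi `^ ((d%:R + 1) / 2) / Gamma ((d%:R + 1) / 2).

(* l G_l = 2 (l + lambda - 1) X G_(l-1) - (l + 2 lambda - 2) G_(l-2),
   G_0 = 1, G_1 = 2 lambda X *)
Fixpoint gegenbauer (lambda : R) (l : nat) : {poly R} :=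
  match l with
  | 0 => 1
  | l1.+1 =>
    match l1 with
    | 0 => (2 * lambda) *: 'X
    | l2.+1 => (l2.+2%:R)^-1 *:
        ((2 * (l2.+1%:R + lambda)) *: ('X * gegenbauer lambda l1)
         - (l2%:R + 2 * lambda) *: gegenbauer lambda l2)
    end
  end.

Definition zonal d l (t : R) : R :=
  (l%:R + eta d) / (eta d * omega d) * (gegenbauer (eta d) l).[t].

End ZonalKernel.

Section ComplexIntegral.
Context {R : realType} {dT : measure_display} {T : measurableType dT}.

Definition measurable_cfun (D : set T) (X : T -> R[i]) :=
  measurable_fun D (fun w => complex.Re (X w)) /\
  measurable_fun D (fun w => complex.Im (X w)).

Definition cintegral (mu : {measure set T -> \bar R}) (D : set T)
    (X : T -> R[i]) : R[i] :=
  (\int[mu]_(x in D) complex.Re (X x)) +i* (\int[mu]_(x in D) complex.Im (X x)).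

Definition sqrnormc (z : R[i]) : R := complex.Re z ^+ 2 + complex.Im z ^+ 2.

Variable P : probability T R.

Definition cexpectation (X : T -> R[i]) : R[i] := cintegral P setT X.

Definition finite_variance (X : T -> R[i]) :=
  measurable_cfun setT X /\ (\int[P]_w (sqrnormc (X w))%:E < +oo)%E.

Definition ccovariance (X Y : T -> R[i]) : R[i] :=
  cexpectation
    (fun w => (X w - cexpectation X) * conjc (Y w - cexpectation Y)).

Definition cvariance (X : T -> R[i]) : R := complex.Re (ccovariance X X).

Definition ccorrelation (X Y : T -> R[i]) : R[i] :=
  ccovariance X Y / (Num.sqrt (cvariance X * cvariance Y))%:C.

End ComplexIntegral.

Section SphericalHarmonics.
Context {R : realType} (d : nat).
Local Notation E := (d.+1.-tuple R).

Definition laplacian (p : mpoly.mpoly d.+1 R[i]) : mpoly.mpoly d.+1 R[i] :=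
  \sum_(i < d.+1) mpoly.mderiv i (mpoly.mderiv i p).

(* restriction to S^d of a homogeneous harmonic polynomial of degree l *)
Definition spherical_harmonic (l : nat) (h : E -> R[i]) :=
  exists p : mpoly.mpoly d.+1 R[i],
    [/\ p \is mpoly.ishomog1 l mpoly.mdeg, laplacian p = 0 &
        forall x, sphere d x ->
          h x = mpoly.meval (fun i => (tnth x i)%:C) p].

(* N l is the dimension of the space of spherical harmonics of degree l; only
   the values Y l m with m < N l matter. *)
Record orthonormal_harmonics (N : nat -> nat) (Y : nat -> nat -> E -> R[i]) :
    Prop := {
  onh_harmonic : forall l m, (m < N l)%N -> spherical_harmonic l (Y l m) ;
  onh_orthonormal : forall l m m', (m < N l)%N -> (m' < N l)%N ->
    cintegral (surface_measure d) (sphere d)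
      (fun x => Y l m x * conjc (Y l m' x)) = (m == m')%:R ;
  onh_span : forall l h, spherical_harmonic l h ->
    exists c : nat -> R[i], forall x, sphere d x ->
      h x = \sum_(m < N l) c m * Y l m x }.

End SphericalHarmonics.

Section RandomField.
Context {R : realType} (d : nat).
Context {dO : measure_display} {Omega : measurableType dO}.
Variable P : probability Omega R.
Local Notation E := (d.+1.-tuple R).

Definition rotation (M : 'M[R]_(d.+1)) := M^T *m M = 1%:M /\ \det M = 1.

Definition rotate (M : 'M[R]_(d.+1)) (x : E) : E :=
  [tuple \sum_j M i j * tnth x j | i < d.+1].

(* A field is a function on Omega * R^(d+1) of which only the values on
   Omega * S^d matter. Isotropy is invariance of the first two moments. *)
Record isotropic_field (f : Omega -> E -> R[i]) : Prop := {
  field_measurable : measurable_cfun ([set: Omega] `*` sphere d)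
    (fun p : Omega * E => f p.1 p.2) ;
  field_finite_variance : forall x, sphere d x ->
    finite_variance P (fun w => f w x) ;
  field_zero_mean : forall x, sphere d x ->
    cexpectation P (fun w => f w x) = 0 ;
  field_isotropic : forall M x y, rotation M -> sphere d x -> sphere d y ->
    ccovariance P (fun w => f w (rotate M x)) (fun w => f w (rotate M y)) =
    ccovariance P (fun w => f w x) (fun w => f w y) }.

(* f = \sum_l \sum_(m < N l) a_(l,m) Y_(l,m) in L^2(Omega * S^d), with
   uncorrelated zero-mean coefficients of variance C l *)
Record spectral_representation (f : Omega -> E -> R[i]) (C : nat -> R)
    (N : nat -> nat) (Y : nat -> nat -> E -> R[i])
    (a : nat -> nat -> Omega -> R[i]) : Prop := {
  spectral_basis : orthonormal_harmonics N Y ;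
  spectral_coef : forall l m, (m < N l)%N -> finite_variance P (a l m) ;
  spectral_mean : forall l m, (m < N l)%N -> cexpectation P (a l m) = 0 ;
  spectral_cov : forall l m l' m', (m < N l)%N -> (m' < N l')%N ->
    cexpectation P (fun w => a l m w * conjc (a l' m' w)) =
    if (l == l') && (m == m') then (C l)%:C else 0 ;
  spectral_cvg :
    (fun L : nat => (\int[P]_w \int[surface_measure d]_(x in sphere d)
      (sqrnormc (f w x - \sum_(l < L) \sum_(m < N l) a l m w * Y l m x))%:E)%E)
    @ \oo --> 0%E }.

Definition angular_power_spectrum (f : Omega -> E -> R[i]) (C : nat -> R) :=
  exists N Y a, spectral_representation f C N Y a.

(* b j vanishes at l outside a compact set, so that the series is finite *)
Definition needlet_kernel (b : nat -> R -> R) (j : nat) (x y : E) : R :=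
  limn (series (fun l => b j l%:R * zonal d l (dotp x y))).

Definition needlet_coef (b : nat -> R -> R) (f : Omega -> E -> R[i]) (j : nat)
    (x : E) (w : Omega) : R[i] :=
  cintegral (surface_measure d) (sphere d)
    (fun y => f w y * (needlet_kernel b j x y)%:C).

End RandomField.

Section Weights.
Context {R : realType}.

(* Differentiation within D, one-sided at the boundary points of D. *)
Definition diff_quotient (f : R -> R) (x y : R) : R := (f y - f x) / (y - x).

Definition derivable_within (D : set R) (f : R -> R) (x : R) :=
  cvg (diff_quotient f x y @[y --> within (D `\ x) (nbhs x)]).

Definition derive_within (D : set R) (f : R -> R) (x : R) : R :=
  lim (diff_quotient f x y @[y --> within (D `\ x) (nbhs x)]).

Definition derive_within_n (D : set R) (n : nat) (f : R -> R) : R -> R :=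
  iter n (derive_within D) f.

Definition smooth_on (D : set R) (f : R -> R) :=
  forall n x, D x -> derivable_within D (derive_within_n D n f) x.

Record scale_sequence (S : nat -> R) : Prop := {
  scale_increasing : forall j, S j < S j.+1 ;
  scale_0 : S 0%N = 1 ;
  scale_convex : forall j, (0 < j)%N -> S j - S j.-1 <= S j.+1 - S j }.

(* The functions are defined on [0, +oo[: their values at negative reals are
   irrelevant. *)
Record weight_functions (S : nat -> R) (b : nat -> R -> R) : Prop := {
  weight_smooth : forall j, smooth_on `[0, +oo[ (b j) ;
  weight_derive : forall n, exists K : R, forall j u, (0 < j)%N -> 0 <= u ->
    `|derive_within_n `[0, +oo[ n (b j) u| <= K * (S j - S j.-1) ^- n ;
  weight_compact : forall j,
    compact (closure [set u | 0 <= u /\ b j u != 0]) ;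
  weight_support : forall j, (0 < j)%N ->
    closure [set u | 0 <= u /\ b j u != 0] `<=` `[S j.-1, S j.+1] ;
  weight_left : forall j, (0 < j)%N -> b j (S j.-1) = 0 ;
  weight_right : forall j, b j (S j.+1) = 0 ;
  weight_mid : forall j, b j (S j) = 1 ;
  weight_unity : forall u, 1 <= u ->
    series (fun j => b j u ^+ 2) @ \oo --> (1 : R) }.

End Weights.

(* Main.v *)
From HB Require Import structures.
From mathcomp Require Import all_boot all_order all_algebra.
From mathcomp Require Import complex.
From mathcomp Require Import all_classical all_reals all_analysis.
From mathcomp Require Import measurable_realfun.
From mathcomp Require Import ring lra zify.
From mathcomp.multinomials Require mpoly.
Import (canonicals, coercions) mpoly.
Require Import Defs.

Set Implicit Arguments.
Unset Strict Implicit.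
Unset Printing Implicit Defensive.

Import Order.TTheory GRing.Theory Num.Theory numFieldNormedType.Exports.

Local Open Scope classical_set_scope.
Local Open Scope ring_scope.

(* Gaussian integrals in polar coordinates give, for a k-homogeneous polynomial p
   on R^(d+1), [\int Delta p = k (k + d - 1) \int p] over the sphere. This makes
   harmonic polynomials of different degrees orthogonal, makes the zonal
   Gegenbauer polynomials reproducing, and yields the addition theorem, hence
   also |G_l(t)| <= G_l(1) on [-1, 1].

   The L^2 convergence of the spectral representation identifies beta_j(x) almost
   surely with a finite combination of the coefficients a_(l,m), so that, with
   lam = (d - 1) / 2, Cov(beta_j(x), beta_j(y)) is a constant times
   D(t) = \sum_l c_l (l + lam) G_l(t), where c_l = b_j(l)^2 C_l and t = <x, y>.
   The Gegenbauer recurrence turns multiplication of D(t) by 2 (1 - t) into a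
   second-order difference operator on (c_l). Each application gains a factor
   m^(-2), m = min(S_(j-1)^(1-beta), S_j - S_(j-1)), because differences of c_l
   are controlled by derivatives of b_j, g and u^(-alpha); as b_j vanishes to all
   orders at S_(j-1), the loss of l^(-alpha) below S_j is harmless. Since
   2 (1 - cos theta) >= theta^2 / 16, it remains to bound
   \sum_l max(l, S_j)^(-alpha) (l + lam) G_l(1) over the support by D(1): there
   b_j^2 = 1 - b_(j+1)^2 >= 3/4 on an interval to the right of S_j of length
   proportional to S_(j+1) - S_j, and the weights (l + lam) G_l(1) are doubling.
   If m theta is bounded, the estimate follows from D(t) <= D(1). *)

(** * Integration of monomials over the sphere *)

(** Polar coordinates never occur as a change of variables. The surface measure is defined through
    cones, so radius and direction are separated by rescaling inside a double integral; this leaves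
    one unknown factor, which two instances of the same identity eliminate.

    The ratio S_j / S_(j-1) has no upper bound. Just above S_(j-1), l^(-alpha) may exceed
    S_j^(-alpha) by an arbitrary factor, which D(1) could not absorb. Flatness of b_j is used in the
    form |b_j^(k)(u)| <= K u^n (S_j - S_(j-1))^(-k-n), with powers of u instead of u - S_(j-1): when
    the ratio is large, S_j - S_(j-1) is comparable to S_j, and this is already a power of u / S_j.

    The difference estimates start at about S_(j-1) / 2 and use the step m / 2, leaving a margin for
    the neighbouring indices that each application of the operator brings in.

    All thresholds are conditions on m, not on j. Since theta <= pi, a small m makes m theta small
    and the trivial bound applies, so the constant is uniform. *)

Section GaussianMoments.
Context {R : realType}.
Local Notation mu := (@lebesgue_measure R).

Definition gauss_mon (a : nat) (t : R) : R := t ^+ a * expR (- t ^+ 2).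

Lemma continuous_gauss_mon a : continuous (gauss_mon a).
Proof.
move=> x; apply: cvgM; first exact: exprn_continuous.
exact: continuous_gauss_fun.
Qed.

(** The exponential series gives t^a <= a! e^t, and (t - 1)^2 >= 0 gives t - t^2 <= 1 - t. A
    majorant of the form c e^(-t) is convenient because its integral over the half-line is
    explicit. *)
Lemma gauss_mon_le a (t : R) : 0 <= t ->
  gauss_mon a t <= a`!%:R * expR 1 * expR (- t).
Proof.
move=> t0.
have h1 : t ^+ a <= a`!%:R * expR t.
  rewrite mulrC -ler_pdivrMr ?ltr0n ?fact_gt0//.
  case: a => [|a]; first by rewrite expr0 fact0 divr1 -expR0 ler_expR.
  by have := @expR_ge1Dxn R t a t0; lra.
have h2 : expR t * expR (- t ^+ 2) <= expR 1 * expR (- t).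
  rewrite -!expRD ler_expR; have := sqr_ge0 (t - 1).
  move=> h; rewrite -subr_ge0.
  by have -> : 1 - t - (t - t ^+ 2) = (t - 1) ^+ 2 by ring.
rewrite /gauss_mon (le_trans (ler_wpM2r (expR_ge0 _) h1))//.
by rewrite -!mulrA ler_wpM2l.
Qed.

Lemma is_derive_expRN (c x : R) :
  is_derive x 1 (fun t : R => c * expR (- t)) (- (c * expR (- x))).
Proof.
have -> : - (c * expR (- x)) = c *: ((expR (- x)) *: (-1)).
  by rewrite /GRing.scale /= mulrN1 mulrN.
apply: is_deriveZ.
Qed.

Lemma continuous_is_derive (f df : R -> R) :
  (forall x : R, is_derive x 1 f (df x)) -> continuous f.
Proof.
move=> h x; apply: differentiable_continuous.
by apply/derivable1_diffP; have := h x; case.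
Qed.

Lemma ge0_integral_derive (f F : R -> R) :
  continuous f -> (forall x, 0 <= x -> 0 <= f x) ->
  (forall x : R, is_derive x 1 F (f x)) -> F x @[x --> +oo] --> 0 ->
  (\int[mu]_(x in `[0%R, +oo[) (f x)%:E = (- F 0)%:E)%E.
Proof.
move=> cf f0 dF F0; rewrite (@ge0_continuous_FTC2y _ f F 0 0)//.
- by rewrite -EFinB add0r.
- exact: continuous_subspaceT.
- by apply: cvg_at_right_filter; exact: (continuous_is_derive dF).
- by move=> x _; rewrite derive1E; have := dF x; case.
Qed.

Lemma integral_expRN (c : R) : 0 <= c ->
  (\int[mu]_(x in `[0%R, +oo[) (c * expR (- x))%:E = c%:E)%E.
Proof.
move=> c0; pose F x : R := - c * expR (- x).
have dF (x : R) : is_derive x 1 F (c * expR (- x)).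
  by have := is_derive_expRN (- c) x; rewrite mulNr opprK.
have F0 : F x @[x --> +oo] --> 0.
  by rewrite -(mulr0 (- c)); apply: cvgM; [exact: cvg_cst|exact: cvgr_expR].
rewrite (ge0_integral_derive _ _ dF F0).
- by rewrite /F oppr0 expR0 mulr1 opprK.
- exact: continuous_is_derive (is_derive_expRN c).
- by move=> x _; rewrite mulr_ge0// expR_ge0.
Qed.

Lemma integrable_expRN (c : R) : 0 <= c ->
  mu.-integrable `[0%R, +oo[ (EFin \o (fun x => c * expR (- x))).
Proof.
move=> c0; apply/integrableP; split.
  apply/measurable_EFinP; apply: measurable_funTS.
  apply: continuous_measurable_fun.
  exact: continuous_is_derive (is_derive_expRN c).
under eq_integral do rewrite /= ger0_norm ?mulr_ge0 ?expR_ge0//.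
by rewrite integral_expRN// ltry.
Qed.

Lemma integrable_expR_bound (f : R -> R) c : continuous f ->
  (forall x, 0 <= x -> `|f x| <= c * expR (- x)) ->
  mu.-integrable `[0%R, +oo[ (EFin \o f).
Proof.
move=> cf fc; have c0 : 0 <= c.
  by have := fc 0 (lexx _); rewrite oppr0 expR0 mulr1; exact: le_trans.
apply: (le_integrable _ _ _ (integrable_expRN c0)) => //.
- by apply/measurable_EFinP; apply: measurable_funTS; exact: continuous_measurable_fun.
- move=> x; rewrite /= in_itv/= andbT => x0; rewrite lee_fin.
  by rewrite (le_trans (fc _ x0))// ler_norm.
Qed.

(** [ge0_integral_derive] handles nonnegative integrands. Adding c e^(-x), with primitive -c e^(-x),
    makes the integrand nonnegative; the known integral c is subtracted at the end. *)
Lemma Rintegral_derive (f F : R -> R) c :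
  continuous f -> (forall x, 0 <= x -> `|f x| <= c * expR (- x)) ->
  (forall x : R, is_derive x 1 F (f x)) -> F x @[x --> +oo] --> 0 ->
  \int[mu]_(x in `[0%R, +oo[) f x = - F 0.
Proof.
move=> cf fc dF F0; have c0 : 0 <= c.
  by have := fc 0 (lexx _); rewrite oppr0 expR0 mulr1; exact: le_trans.
pose e x := c * expR (- x).
have ce : continuous e := continuous_is_derive (is_derive_expRN c).
have if1 := integrable_expR_bound cf fc.
have ie : mu.-integrable `[0%R, +oo[ (EFin \o e) := integrable_expRN c0.
have h : (\int[mu]_(x in `[0%R, +oo[) (f x + e x)%:E = (- (F 0 - e 0))%:E)%E.
  have dG (x : R) : is_derive x 1 (fun x => F x - e x) (f x + e x).
    by have := is_deriveB (dF x) (is_derive_expRN c x); rewrite opprK.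
  have G0 : (F x - e x) @[x --> +oo] --> 0.
    rewrite -(subr0 0); apply: cvgB => //; rewrite -(mulr0 c).
    by apply: cvgM; [exact: cvg_cst|exact: cvgr_expR].
  apply: (ge0_integral_derive _ _ dG G0).
  - by move=> x; apply: cvgD; [exact: cf|exact: ce].
  - move=> x x0; have := fc _ x0; rewrite ler_norml => /andP[+ _].
    by rewrite -subr_ge0 opprK.
have := congr1 fine h; rewrite [LHS](_ : _ = \int[mu]_(x in `[0%R, +oo[) (f x + e x))//.
rewrite RintegralD// [X in _ + X](_ : _ = c); last first.
  by rewrite /Rintegral integral_expRN.
rewrite /= /e oppr0 expR0; lra.
Qed.

Definition half_moment (a : nat) : R := \int[mu]_(x in `[0%R, +oo[) gauss_mon a x.

Lemma gauss_mon_ge0 a (t : R) : 0 <= t -> 0 <= gauss_mon a t.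
Proof. by move=> t0; rewrite mulr_ge0 ?expR_ge0 ?exprn_ge0. Qed.

Lemma gauss_mon_norm_le a (t : R) : 0 <= t ->
  `|gauss_mon a t| <= a`!%:R * expR 1 * expR (- t).
Proof. by move=> t0; rewrite ger0_norm ?gauss_mon_ge0// gauss_mon_le. Qed.

Lemma integrable_gauss_mon_half a :
  mu.-integrable `[0%R, +oo[ (EFin \o gauss_mon a).
Proof.
apply: integrable_expR_bound; first exact: continuous_gauss_mon.
by move=> x x0; exact: gauss_mon_norm_le.
Qed.

Lemma is_derive_gauss_mon a (x : R) :
  is_derive x 1 (gauss_mon a.+1) (a.+1%:R * gauss_mon a x - 2 * gauss_mon a.+2 x).
Proof.
have h1 : is_derive x 1 (fun t : R => t ^+ a.+1) (a.+1%:R * x ^+ a).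
  have := @is_deriveX _ _ id a.+1 x 1 1 (is_derive_id _ _).
  by rewrite exprfctE /GRing.scale /= mulr1.
have h3 : is_derive x 1 (fun t : R => - t ^+ 2) (- (2 * x)).
  have := @is_deriveN _ _ _ _ _ _ _ (@is_deriveX _ _ id 2 x 1 1 (is_derive_id _ _)).
  by rewrite exprfctE /GRing.scale /= mulr1 expr1.
have h2 : is_derive x 1 (fun t : R => expR (- t ^+ 2)) (- (2 * x) * expR (- x ^+ 2)).
  by have := is_derive1_comp (is_derive_expR _) h3; rewrite mulrC.
apply: (is_derive_eq (is_deriveM h1 h2)).
rewrite /gauss_mon /GRing.scale /= !exprS; ring.
Qed.

(** Integrates the derivative of t^(a+1) e^(-t^2), a function that vanishes at 0 and at infinity. *)
Lemma half_moment_rec a : half_moment a.+2 = a.+1%:R / 2 * half_moment a.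
Proof.
have cf : continuous (fun x : R => a.+1%:R * gauss_mon a x - 2 * gauss_mon a.+2 x).
  by move=> x; apply: cvgB; apply: cvgM; [exact: cvg_cst|exact: continuous_gauss_mon|exact: cvg_cst|exact: continuous_gauss_mon].
have F0 : gauss_mon a.+1 x @[x --> +oo] --> 0.
  apply: (@squeeze_cvgr _ _ _ _ (fun=> 0) (fun x => (a.+1`!%:R * expR 1) * expR (- x))).
  - near=> x; have x0 : 0 <= x by near: x; apply: nbhs_pinfty_ge; rewrite num_real.
    by rewrite gauss_mon_ge0// gauss_mon_le.
  - exact: cvg_cst.
  - by rewrite -(mulr0 (a.+1`!%:R * expR 1)); apply: cvgM; [exact: cvg_cst|exact: cvgr_expR].
have := @Rintegral_derive _ _ (a.+1%:R * (a`!%:R * expR 1) + 2 * (a.+2`!%:R * expR 1))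
   cf _ (is_derive_gauss_mon a) F0.
rewrite RintegralB//; [| |]; last 2 first.
- exact: (integrableZl _ _ (integrable_gauss_mon_half _)).
- exact: (integrableZl _ _ (integrable_gauss_mon_half _)).
rewrite !RintegralZl ?integrable_gauss_mon_half//.
rewrite -/(half_moment _) -/(half_moment _) => h.
have : a.+1%:R * half_moment a - 2 * half_moment a.+2 = 0.
  rewrite h => [|x x0]; first by rewrite /gauss_mon exprS !mul0r oppr0.
  apply: (le_trans (ler_normB _ _)); rewrite [leRHS]mulrDl; apply: lerD.
    by rewrite normrM ger0_norm// -mulrA ler_wpM2l// gauss_mon_norm_le.
  by rewrite normrM ger0_norm// -mulrA ler_wpM2l// gauss_mon_norm_le.
lra.
Unshelve. all: by end_near.
Qed.

Lemma half_moment0_gt0 : 0 < half_moment 0.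
Proof.
rewrite /half_moment /Rintegral /gauss_mon.
under eq_integral do rewrite expr0 mul1r.
by rewrite (@integral0y_gauss R)/= divr_gt0// sqrtr_gt0 pi_gt0.
Qed.

Definition moment (a : nat) : R := \int[mu]_x gauss_mon a x.

Lemma gauss_monN a (t : R) : gauss_mon a (- t) = (-1) ^+ a * gauss_mon a t.
Proof. by rewrite /gauss_mon sqrrN (exprNn t) mulrA. Qed.

Lemma integrable_gauss_mon a : mu.-integrable setT (EFin \o gauss_mon a).
Proof.
apply/integrableP; split.
  apply/measurable_EFinP; apply: continuous_measurable_fun.
  exact: continuous_gauss_mon.
rewrite (_ : (fun x => _) = (fun x => `|gauss_mon a x|%:E)); last by apply/funext.
rewrite ge0_symfun_integralT//.
- rewrite -set_itvcy lte_mul_pinfty//.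
  by have /integrableP[_] := integrable_gauss_mon_half a.
- by move=> x; apply: cvg_norm; exact: continuous_gauss_mon.
- by move=> x /=; rewrite gauss_monN -signr_odd normrMsign.
Qed.

Lemma moment_even a : ~~ odd a -> moment a = 2 * half_moment a.
Proof.
move=> ea; rewrite /moment /half_moment /Rintegral.
rewrite ge0_symfun_integralT//.
- rewrite -set_itvcy fineM//.
  by apply: integrable_fin_num => //; exact: integrable_gauss_mon_half.
- by move=> x; rewrite mulr_ge0 ?expR_ge0// exprn_even_ge0.
- exact: continuous_gauss_mon.
- by move=> x /=; rewrite gauss_monN -signr_odd (negbTE ea) mul1r.
Qed.

Lemma moment_odd a : odd a -> moment a = 0.
Proof.
move=> oa; have h : moment a = - moment a.
  rewrite {1}/moment /Rintegral -(_ : \int[pushforward mu (-%R : _ -> measurableTypeR R)]_x (gauss_mon a x)%:E = \int[mu]_x (gauss_mon a x)%:E)%E; last first.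
    by apply: eq_measure_integral => //= A mA AS; exact: lebesgue_measureN.
  rewrite integral_pushforward//=; last 2 first.
  - apply/measurable_EFinP; apply: continuous_measurable_fun.
    exact: continuous_gauss_mon.
  - rewrite preimage_setT.
    have := integrableZl measurableT ((-1) ^+ a) (integrable_gauss_mon a).
    by congr (integrable _ _ _); apply/funext => x /=; rewrite gauss_monN.
  rewrite preimage_setT -mulN1r -RintegralZl//; last exact: integrable_gauss_mon.
  by congr fine; apply: eq_integral => x _ /=; rewrite gauss_monN -signr_odd oa.
lra.
Qed.

Lemma moment_rec a : 2 * moment a.+2 = a.+1%:R * moment a.
Proof.
have [oa|ea] := boolP (odd a).
  by rewrite !moment_odd ?mulr0//= negbK.
rewrite !moment_even//= ?negbK// half_moment_rec; lra.
Qed.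

Lemma moment_even_gt0 a : ~~ odd a -> 0 < moment a.
Proof.
move=> ea; rewrite moment_even// mulr_gt0//.
elim/ltn_ind : a ea => -[_ _|[//|a] ih ea]; first exact: half_moment0_gt0.
rewrite half_moment_rec mulr_gt0// ?divr_gt0//.
by apply: ih => //; move: ea => /=; rewrite negbK.
Qed.

End GaussianMoments.

(** * Iterated integrals on tuples and integrals of product functions *)

Section TupleIntegral.
Context {R : realType}.
Local Notation mu := (@lebesgue_measure R).
Local Notation tmu := (@lebesgue_tuple R).

Lemma integral_lebesgue_tupleE n (f : n.+1.-tuple R -> \bar R) :
  (\int[tmu n.+1]_x f x =
   \int[pushforward (mu \x tmu n) (@cons_pair R n)]_x f x)%E.
Proof.
pose m := measure_function_pushforward__canonical__measure_function_Measure
  (mu \x tmu n)%E (@measurable_cons_pair R n).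
by apply: (@eq_measure_integral _ _ _ _ m).
Qed.

Lemma ge0_integral_tupleS n (f : n.+1.-tuple R -> \bar R) :
  measurable_fun setT f -> (forall x, 0 <= f x)%E ->
  (\int[tmu n.+1]_x f x = \int[mu]_t \int[tmu n]_y f (cons_pair (t, y)))%E.
Proof.
move=> mf f0; rewrite integral_lebesgue_tupleE.
have mc : measurable_fun [set: measurableTypeR R * n.-tuple R] (@cons_pair R n).
  exact: measurable_cons_pair.
have := @ge0_integral_pushforward _ _ _ _ R _ mc
  (mu \x tmu n)%E setT f measurableT mf (fun x _ => f0 x).
move=> ->; rewrite preimage_setT fubini_tonelli1//.
- exact: measurableT_comp.
- by move=> x; exact: f0.
Qed.

Lemma measurable_tuple_prod n (f : 'I_n -> R -> R) :
  (forall i, measurable_fun setT (f i)) ->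
  measurable_fun setT (fun x : n.-tuple R => \prod_(i < n) f i (tnth x i)).
Proof.
move=> mf; apply: measurable_prod => i _.
exact: measurableT_comp (mf i) (measurable_tnth i).
Qed.

Lemma integral_prod_mul d1 d2 (T1 : measurableType d1) (T2 : measurableType d2)
    (m1 : {sigma_finite_measure set T1 -> \bar R})
    (m2 : {sigma_finite_measure set T2 -> \bar R}) (a : T1 -> R) (b : T2 -> R) :
  m1.-integrable setT (EFin \o a) -> m2.-integrable setT (EFin \o b) ->
  (m1 \x m2)%E.-integrable setT (EFin \o (fun p => a p.1 * b p.2)) /\
  \int[(m1 \x m2)%E]_p (a p.1 * b p.2) = \int[m1]_x a x * \int[m2]_y b y.
Proof.
move=> ia ib.
have ma : measurable_fun setT a by apply/measurable_EFinP; exact: measurable_int ia.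
have mb : measurable_fun setT b by apply/measurable_EFinP; exact: measurable_int ib.
have mb' : measurable_fun setT (fun y => `|b y|%:E) by apply/measurable_EFinP; exact: measurableT_comp.
have ma' : measurable_fun setT (fun y => `|a y|%:E) by apply/measurable_EFinP; exact: measurableT_comp.
have ig : (m1 \x m2)%E.-integrable setT (EFin \o (fun p => a p.1 * b p.2)).
  apply/integrable12ltyP => /=.
    by apply/measurable_EFinP; apply: measurable_funM; exact: measurableT_comp.
  under eq_integral => x _.
    under eq_integral => y _ do rewrite normrM EFinM.
    rewrite ge0_integralZl//.
    over.
  rewrite ge0_integralZr//; last exact: integral_ge0.
  move/integrableP : ia => [_ ia]; move/integrableP : ib => [_ ib].
  by rewrite lte_mul_pinfty// ?ge0_fin_numE ?integral_ge0.
split => //.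
rewrite /Rintegral -(integral12_prod_meas1 ig) /fubini_F /=.
under eq_integral => x _.
  under eq_integral => y _ do rewrite EFinM.
  rewrite integralZl//.
  over.
have ibf := integrable_fin_num measurableT ib.
rewrite -(fineK ibf) integralZr//.
by rewrite fineM// integrable_fin_num.
Qed.

(** Integrability and value are proved together: Fubini for a signed product needs the integrability
    of the tail before its value can be used. *)
Lemma integral_tuple_prod n (f : 'I_n -> R -> R) :
  (forall i, mu.-integrable setT (EFin \o f i)) ->
  (tmu n).-integrable setT
    (EFin \o (fun x => \prod_(i < n) f i (tnth x i))) /\
  \int[tmu n]_x (\prod_(i < n) f i (tnth x i)) = \prod_(i < n) \int[mu]_t f i t.
Proof.
elim: n f => [|n ih] f intf.
  rewrite big_ord0 (_ : (fun x : 0.-tuple R => _) = cst 1); last first.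
    by apply/funext => x; rewrite big_ord0.
  have m1 : measurable_fun [set: 0.-tuple R] (EFin \o cst (1 : R)).
    by apply/measurable_EFinP; exact: measurable_cst.
  split.
    apply/integrableP; split=> //.
    rewrite (_ : (fun x => _) = cst 1%E); last first.
      by apply/funext => x /=; rewrite normr1.
    by rewrite integral_cst// mul1e /= diracT ltry.
  have t1 : tmu 0 setT = 1%E := diracT R _.
  by rewrite Rintegral_cst// mul1r; exact: (congr1 fine t1).
have mf i : measurable_fun setT (f i).
  by apply/measurable_EFinP; exact: measurable_int (intf i).
have [int2 int2E] := ih (fun i => f (lift ord0 i)) (fun i => intf _).
pose g (p : R * n.-tuple R) : R :=
  f ord0 p.1 * \prod_(i < n) f (lift ord0 i) (tnth p.2 i).
have gE p : \prod_(i < n.+1) f i (tnth (cons_pair p) i) = g p.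
  rewrite big_ord_recl /g; congr (_ * _).
  by apply: eq_bigr => i _; rewrite tnthS.
have mc : measurable_fun [set: measurableTypeR R * n.-tuple R] (@cons_pair R n).
  exact: measurable_cons_pair.
have [ig Eg] := integral_prod_mul (intf ord0) int2.
have mF := measurable_tuple_prod mf.
pose m := measure_function_pushforward__canonical__measure_function_Measure
  (mu \x tmu n)%E (@measurable_cons_pair R n).
have ig' : (mu \x tmu n)%E.-integrable (@cons_pair R n @^-1` setT)
   ((EFin \o (fun x => \prod_(i < n.+1) f i (tnth x i))) \o @cons_pair R n).
  by rewrite preimage_setT (_ : _ \o _ = EFin \o g)//; apply/funext => p /=; rewrite gE.
split.
  have := @integrable_pushforward _ _ _ _ R _ mc (mu \x tmu n)%E setT
    _ (proj2 (measurable_EFinP _ _) mF) ig' measurableT.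
  by [].
rewrite /Rintegral integral_lebesgue_tupleE.
have := @integral_pushforward _ _ _ _ R _ mc (mu \x tmu n)%E setT
    _ (proj2 (measurable_EFinP _ _) mF) ig' measurableT.
move=> ->; rewrite big_ord_recl -int2E -Eg preimage_setT.
by congr fine; apply: eq_integral => p _ /=; rewrite gE.
Qed.
End TupleIntegral.

Section Scaling.
Context {R : realType}.
Local Notation mu := (@lebesgue_measure R).
Local Notation tmu := (@lebesgue_tuple R).

Definition scale_tuple n (r : R) (x : n.-tuple R) : n.-tuple R :=
  [tuple r * tnth x i | i < n].

Lemma tnth_scale n r (x : n.-tuple R) i : tnth (scale_tuple r x) i = r * tnth x i.
Proof. by rewrite tnth_mktuple. Qed.

Lemma measurable_scale n (r : R) : measurable_fun setT (@scale_tuple n r).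
Proof.
apply/measurable_fun_tnthP => i.
rewrite (_ : _ \o _ = fun x => r * tnth x i); last first.
  by apply/funext => x /=; rewrite tnth_scale.
by apply: measurable_funM => //; exact: measurable_tnth.
Qed.

(** Both sides are measures that agree on half-open intervals, which characterises Lebesgue
    measure. *)
Lemma lebesgue_measure_scale (r : R) (r0 : 0 < r) (A : set R) : measurable A ->
  (mu A = r%:E * mu ((fun t => r * t)%R @^-1` A))%E.
Proof.
move=> mA; have mr : measurable_fun setT ((fun t => r * t) : measurableTypeR R -> measurableTypeR R).
  exact: measurable_funM.
pose m := measure_function_pushforward__canonical__measure_function_Measure mu mr.
pose rr : {nonneg R} := NngNum (ltW r0).
have -> : (r%:E * mu ((fun t => r * t)%R @^-1` A) = mscale rr m A)%E by [].
apply: lebesgue_measure_unique => //= _ [[a b]] _ <-.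
rewrite /mscale /= /pushforward.
rewrite (_ : _ @^-1` _ = `]a / r, b / r]%classic); last first.
  apply/seteqP; split => x /=; rewrite !in_itv/= ltr_pdivrMr// ler_pdivlMr//;
    by rewrite (mulrC r).
rewrite !lebesgue_measure_itv/= !lte_fin ltr_pM2r ?invr_gt0//.
case: ifPn => _; last by rewrite mule0.
rewrite -EFinB -EFinD -EFinM; congr EFin; field; exact: lt0r_neq0.
Qed.

Lemma ge0_integral_scale1 (r : R) (f : R -> \bar R) : 0 < r ->
  measurable_fun setT f -> (forall t, 0 <= f t)%E ->
  (\int[mu]_t f t = r%:E * \int[mu]_t f (r * t)%R)%E.
Proof.
move=> r0 mf f0; have mr : measurable_fun setT ((fun t => r * t) : measurableTypeR R -> measurableTypeR R).
  exact: measurable_funM.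
pose m := measure_function_pushforward__canonical__measure_function_Measure mu mr.
pose rr : {nonneg R} := NngNum (ltW r0).
rewrite (eq_measure_integral (mscale rr m)); last first.
  by move=> A mA _; exact: lebesgue_measure_scale.
rewrite ge0_integral_mscale//=; congr (_ * _)%E.
by have -> := @ge0_integral_pushforward _ _ _ _ R _ mr mu setT f measurableT mf (fun x _ => f0 x).
Qed.

Lemma scale_cons n r (t : R) (y : n.-tuple R) :
  scale_tuple r (cons_pair (t, y)) = cons_pair (r * t, scale_tuple r y).
Proof.
apply: eq_from_tnth => i; rewrite tnth_scale.
case: (unliftP ord0 i) => [j|] ->; last by [].
by rewrite !tnthS tnth_scale.
Qed.

Lemma ge0_integral_scale n (r : R) (f : n.-tuple R -> \bar R) : 0 < r ->
  measurable_fun setT f -> (forall t, 0 <= f t)%E ->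
  (\int[tmu n]_x f x = (r ^+ n)%:E * \int[tmu n]_x f (scale_tuple r x))%E.
Proof.
move=> r0; elim: n f => [|n ih] f mf f0.
  rewrite expr0 mul1e; apply: eq_integral => x _; congr f.
  by rewrite !tuple0 [RHS]tuple0.
have mc : measurable_fun [set: measurableTypeR R * n.-tuple R] (@cons_pair R n).
  exact: measurable_cons_pair.
have mfc : measurable_fun [set: measurableTypeR R * n.-tuple R] (f \o @cons_pair R n).
  exact: measurableT_comp.
rewrite ge0_integral_tupleS// [in RHS]ge0_integral_tupleS//; last first.
  by apply: measurableT_comp => //; exact: measurable_scale.
have mfs (t : R) : measurable_fun [set: n.-tuple R] (fun y => f (cons_pair (t, y))).
  by apply: (measurableT_comp mfc); exact: pair1_measurable.
under eq_integral => t _.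
  rewrite (ih (fun y => f (cons_pair (t, y))))//; over.
have mF : measurable_fun [set: measurableTypeR R]
    (fun t => \int[tmu n]_y f (cons_pair (t, scale_tuple r y)))%E.
  have := measurable_fun_fubini_tonelli_F (m2 := tmu n)
    (fun p : measurableTypeR R * n.-tuple R => f (cons_pair (p.1, scale_tuple r p.2))).
  apply => //; apply: measurableT_comp => //; apply: measurableT_comp => //.
  apply/measurable_fun_pair => //=; apply: measurableT_comp => //.
  exact: measurable_scale.
have F0 t : (0 <= \int[tmu n]_y f (cons_pair (t, scale_tuple r y)))%E.
  exact: integral_ge0.
have rn0 : (0 <= (r ^+ n)%:E)%E by rewrite lee_fin exprn_ge0// ltW.
rewrite (ge0_integralZl _ measurableT mF (fun x _ => F0 x) rn0).
rewrite (ge0_integral_scale1 r0 mF F0).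
rewrite muleA -EFinM -exprSr; congr (_ * _)%E.
apply: eq_integral => t _; apply: eq_integral => y _.
by rewrite scale_cons.
Qed.
End Scaling.

(** * Separation of radius and direction by rescaling *)

Section Radial.
Context {R : realType} (n : nat).
Hypothesis n0 : (0 < n)%N.
Local Notation tmu := (@lebesgue_tuple R n).
Local Notation T := (n.-tuple R).

Lemma dotp_scale r (x y : T) : dotp (scale_tuple r x) y = r * dotp x y.
Proof. by rewrite /dotp mulr_sumr; apply: eq_bigr => i _; rewrite tnth_scale mulrA. Qed.

Lemma dotpC (x y : T) : dotp x y = dotp y x.
Proof. by apply: eq_bigr => i _; rewrite mulrC. Qed.

Lemma dotp_ge0 (x : T) : 0 <= dotp x x.
Proof. by apply: sumr_ge0 => i _; rewrite -expr2 sqr_ge0. Qed.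

Lemma normt_ge0 (x : T) : 0 <= normt x. Proof. exact: sqrtr_ge0. Qed.

Lemma sqr_normt (x : T) : normt x ^+ 2 = dotp x x.
Proof. by rewrite sqr_sqrtr// dotp_ge0. Qed.

Lemma normt_scale r (x : T) : 0 <= r -> normt (scale_tuple r x) = r * normt x.
Proof.
move=> r0; rewrite /normt dotp_scale dotpC dotp_scale mulrA -expr2.
by rewrite sqrtrM ?sqr_ge0// sqrtr_sqr ger0_norm.
Qed.

Lemma normalizeE (x : T) : normalize x = scale_tuple (normt x)^-1 x.
Proof. by []. Qed.

Lemma normalize_scale r (x : T) : 0 < r -> normalize (scale_tuple r x) = normalize x.
Proof.
move=> r0; apply: eq_from_tnth => i; rewrite !tnth_mktuple normt_scale ?ltW//.
by rewrite invfM mulrACA mulVf ?mul1r ?gt_eqF.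
Qed.

Lemma ge0_integral_mul2 (a b : T -> R) :
  measurable_fun setT a -> measurable_fun setT b ->
  (forall x, 0 <= a x) -> (forall x, 0 <= b x) ->
  (\int[tmu]_y \int[tmu]_x (a x * b y)%:E =
   (\int[tmu]_x (a x)%:E) * (\int[tmu]_y (b y)%:E))%E.
Proof.
move=> ma mb a0 b0.
under eq_integral => y _.
  under eq_integral => x _ do rewrite mulrC EFinM.
  rewrite ge0_integralZl ?lee_fin//; last 2 first.
  - exact/measurable_EFinP.
  - by move=> x _; rewrite lee_fin.
  over.
rewrite ge0_integralZr//; last 3 first.
- exact/measurable_EFinP.
- by move=> x _; rewrite lee_fin.
- by apply: integral_ge0 => x _; rewrite lee_fin.
by rewrite muleC.
Qed.

Lemma ge0_integral_scaleR (r : R) (f : T -> R) : 0 < r ->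
  measurable_fun setT f -> (forall x, 0 <= f x) ->
  (\int[tmu]_x (f x)%:E = \int[tmu]_x (r ^+ n * f (scale_tuple r x))%:E)%E.
Proof.
move=> r0 mf f0; rewrite (ge0_integral_scale r0); last 2 first.
- exact/measurable_EFinP.
- by move=> x; rewrite lee_fin.
rewrite -ge0_integralZl//.
- by apply/measurable_EFinP; apply: measurableT_comp => //; exact: measurable_scale.
- by move=> x _; rewrite lee_fin.
- by rewrite lee_fin exprn_ge0// ltW.
Qed.

Variables (phi psi : R -> R) (h : T -> R).
Hypotheses (mphi : measurable_fun setT phi) (mpsi : measurable_fun setT psi)
  (mh : measurable_fun setT h).
Hypotheses (phi0 : forall r, 0 <= phi r) (psi0 : forall r, 0 <= psi r)
  (h0 : forall x, 0 <= h x).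
Hypotheses (phi00 : phi 0 = 0) (psi00 : psi 0 = 0).
Hypothesis h_scale : forall r x, 0 < r -> h (scale_tuple r x) = h x.

Definition radial_integral (phi : R -> R) (h : T -> R) : \bar R :=
  (\int[tmu]_x (phi (normt x) * h x)%:E)%E.

Definition radial_mass (phi : R -> R) : \bar R := (\int[tmu]_x (phi (normt x))%:E)%E.

(** What is left of psi after the substitutions in [radial_integralM], where |y| / |x| becomes 1 /
    |x|. Its value is never computed; what counts is that phi does not occur in it. *)
Definition inverse_radial_integral : \bar R :=
  (\int[tmu]_x (((normt x)^-1 ^+ (n + n) * psi (normt x)^-1) * h x)%:E)%E.

Let measurable_normt_fst : measurable_fun setT (fun p : T * T => normt p.1).
Proof. by apply: measurableT_comp => //; exact: measurable_normt. Qed.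
Let measurable_normt_snd : measurable_fun setT (fun p : T * T => normt p.2).
Proof. by apply: measurableT_comp => //; exact: measurable_normt. Qed.

Lemma measurable_normtV : measurable_fun setT (fun x : T => (normt x)^-1).
Proof.
rewrite (_ : (fun x => _) = (fun r => r `^ (-1)) \o @normt R n); last first.
  by apply/funext => x /=; rewrite powR_inv1// sqrtr_ge0.
by apply: measurableT_comp; [exact: measurable_powR|exact: measurable_normt].
Qed.

(** Three rescalings of the double integral of phi(|x|) h(x) psi(|y|), with Tonelli in between: x by
    |y|, then y by 1 / |x|, then x by |y| again. As h is constant along rays, phi ends up depending
    on y alone and the integral splits in the other way. With psi fixed, this makes the integral of
    phi(|x|) h(x) proportional to that of phi(|x|). *)
Lemma radial_integralM :
  (radial_integral phi h * radial_mass psi =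
   radial_mass phi * inverse_radial_integral)%E.
Proof.
have mN := @measurable_normt R n.
have mNV := measurable_normtV.
have mph : measurable_fun setT (fun x => phi (normt x) * h x).
  by apply: measurable_funM => //; exact: measurableT_comp.
have mps : measurable_fun setT (fun x : T => psi (normt x)).
  exact: measurableT_comp.
have mph1 : measurable_fun setT (fun x : T => phi (normt x)).
  exact: measurableT_comp.
have mE : measurable_fun setT
    (fun x => (normt x)^-1 ^+ (n + n) * psi (normt x)^-1 * h x).
  apply: measurable_funM => //; apply: measurable_funM.
    exact: measurable_funX.
  exact: measurableT_comp.
have NV0 (x : T) : 0 <= (normt x)^-1 by rewrite invr_ge0 normt_ge0.
have E0 x : 0 <= (normt x)^-1 ^+ (n + n) * psi (normt x)^-1 * h x.
  by rewrite !mulr_ge0 ?exprn_ge0.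
pose G1 (p : T * T) : \bar R :=
  (normt p.2 ^+ n * phi (normt p.2 * normt p.1) * h p.1 * psi (normt p.2))%:E.
pose G2 (p : T * T) : \bar R := ((normt p.1)^-1 ^+ (n + n) * normt p.2 ^+ n
   * phi (normt p.2) * h p.1 * psi (normt p.2 * (normt p.1)^-1))%:E.
have G10 p : (0 <= G1 p)%E by rewrite lee_fin !mulr_ge0 ?exprn_ge0 ?normt_ge0.
have G20 p : (0 <= G2 p)%E by rewrite lee_fin !mulr_ge0 ?exprn_ge0 ?normt_ge0.
have mfst : measurable_fun setT (fst : T * T -> T) by exact: measurable_fst.
have msnd : measurable_fun setT (snd : T * T -> T) by exact: measurable_snd.
have mh1 : measurable_fun setT (fun p : T * T => h p.1) by exact: measurableT_comp.
have mNV1 : measurable_fun setT (fun p : T * T => (normt p.1)^-1).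
  by apply: (measurableT_comp measurable_normtV).
have mG1 : measurable_fun setT G1.
  apply/measurable_EFinP; apply: measurable_funM; last by apply: measurableT_comp.
  apply: measurable_funM => //; apply: measurable_funM.
    exact: measurable_funX.
  by apply: measurableT_comp => //; exact: measurable_funM.
have mG2 : measurable_fun setT G2.
  apply/measurable_EFinP; apply: measurable_funM; last first.
    by apply: measurableT_comp => //; apply: measurable_funM.
  do 2 (apply: measurable_funM; last by [|apply: measurableT_comp]).
  by apply: measurable_funM; exact: measurable_funX.
have mG1x y : measurable_fun setT (fun x => fine (G1 (x, y))).
  apply/measurable_EFinP; rewrite (_ : _ \o _ = fun x => G1 (x, y)).
    by apply: (measurableT_comp mG1); exact: measurable_pair2.
  by apply/funext.
have mG1y x : measurable_fun setT (fun y => fine (G1 (x, y))).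
  apply/measurable_EFinP; rewrite (_ : _ \o _ = fun y => G1 (x, y)).
    by apply: (measurableT_comp mG1); exact: pair1_measurable.
  by apply/funext.
have mG2x y : measurable_fun setT (fun x => fine (G2 (x, y))).
  apply/measurable_EFinP; rewrite (_ : _ \o _ = fun x => G2 (x, y)).
    by apply: (measurableT_comp mG2); exact: measurable_pair2.
  by apply/funext.
have step1 : (radial_integral phi h * radial_mass psi =
    \int[tmu]_y \int[tmu]_x G1 (x, y))%E.
  rewrite -(ge0_integral_mul2 mph mps); last 2 first.
  - by move=> x; rewrite mulr_ge0.
  - by move=> x.
  apply: eq_integral => y _.
  (* Rescaling by |y| is impossible at |y| = 0; there [psi00] makes both integrands vanish. *)
  have [Ny|Ny] := eqVneq (normt y) 0.
    by apply: eq_integral => x _; rewrite /G1 /= Ny psi00 !mulr0.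
  have y0 : 0 < normt y by rewrite lt_def Ny normt_ge0.
  rewrite (ge0_integral_scaleR y0); last 2 first.
  - exact: measurable_funM.
  - by move=> x; rewrite !mulr_ge0.
  apply: eq_integral => x _; rewrite /G1 /=; congr EFin.
  by rewrite normt_scale ?ltW// h_scale// !mulrA.
have step2 : (\int[tmu]_y \int[tmu]_x G1 (x, y) = \int[tmu]_x \int[tmu]_y G2 (x, y))%E.
  rewrite -(fubini_tonelli (m1 := tmu) (m2 := tmu) G1 mG1 G10); apply: eq_integral => x _.
  have [Nx|Nx] := eqVneq (normt x) 0.
    apply: eq_integral => y _; rewrite /G1 /G2 /= Nx invr0 expr0n addn_eq0.
    by rewrite eqn0Ngt n0 mulr0 phi00 /= !(mul0r, mulr0).
  have x0 : 0 < (normt x)^-1 by rewrite invr_gt0 lt_def Nx normt_ge0.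
  rewrite (_ : (\int[tmu]_y G1 (x, y) = \int[tmu]_y (fine (G1 (x, y)))%:E)%E)//.
  rewrite (ge0_integral_scaleR x0 (mG1y x)); last first.
    by move=> y; rewrite -lee_fin; exact: (G10 (x, y)).
  apply: eq_integral => y _; rewrite /G1 /G2 /=; congr EFin.
  rewrite normt_scale ?ltW//.
  have -> : (normt x)^-1 * normt y * normt x = normt y by field.
  rewrite [in RHS](mulrC (normt y)) exprMn exprD; ring.
rewrite step1 step2 (fubini_tonelli (m1 := tmu) (m2 := tmu) G2 mG2 G20) {step1 step2}.
rewrite /radial_mass muleC -(ge0_integral_mul2 mE mph1); last 2 first.
- exact: E0.
- by move=> x; exact: phi0.
apply: eq_integral => y _.
have [Ny|Ny] := eqVneq (normt y) 0.
  by apply: eq_integral => x _; rewrite /G2 /= Ny phi00 !(mulr0, mul0r).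
have y0 : 0 < normt y by rewrite lt_def Ny normt_ge0.
rewrite (_ : (\int[tmu]_x G2 (x, y) = \int[tmu]_x (fine (G2 (x, y)))%:E)%E)//.
rewrite (ge0_integral_scaleR y0 (mG2x y)); last first.
  by move=> x; rewrite -lee_fin; exact: (G20 (x, y)).
apply: eq_integral => x _; rewrite /G2 /=; congr EFin.
rewrite normt_scale ?ltW// h_scale// invfM exprMn.
have -> : normt y * ((normt y)^-1 * (normt x)^-1) = (normt x)^-1 by rewrite mulVKf.
rewrite [in (normt y)^-1 ^+ _]exprD.
have : normt y ^+ n * (normt y)^-1 ^+ n = 1 by rewrite -exprMn mulfV// expr1n.
move=> e; set a := normt y ^+ n in e *; set b := (normt y)^-1 ^+ n in e *.
have -> : a * (b * b * (normt x)^-1 ^+ (n + n) * a * phi (normt y) * h x * psi (normt x)^-1) =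
  (a * b) * (a * b) * ((normt x)^-1 ^+ (n + n) * phi (normt y) * h x * psi (normt x)^-1) by ring.
by rewrite e; ring.
Qed.
End Radial.

(** * Sphere integrals of monomials, obtained from Gaussian moments *)

Section SphereIntegral.
Context {R : realType}.

Lemma ge0_integral_mrestr d (T : measurableType d)
    (m : {measure set T -> \bar R}) (D : set T) (mD : measurable D)
    (f : T -> \bar R) : measurable_fun setT f -> (forall x, 0 <= f x)%E ->
  (\int[mrestr m mD]_x f x = \int[m]_(x in D) f x)%E.
Proof.
move=> mf f0; rewrite (@ge0_negligible_integral _ _ _ _ setT (~` D))//; last 2 first.
- exact: measurableC.
- by rewrite /= /mrestr setICl measure0.
rewrite setTD setCK; apply: eq_measure_integral => A mA AD.
by rewrite /= /mrestr setIidl.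
Qed.

Lemma Rintegral_sum d (T : measurableType d) (m : {measure set T -> \bar R})
    (D : set T) (I : Type) (s : seq I) (P : pred I) (f : I -> T -> R) :
  measurable D -> (forall i, m.-integrable D (EFin \o f i)) ->
  \int[m]_(x in D) (\sum_(i <- s | P i) f i x) =
  \sum_(i <- s | P i) \int[m]_(x in D) f i x.
Proof.
move=> mD fi; rewrite /Rintegral.
under eq_integral => x _ do rewrite -sumEFin.
rewrite integral_sum// (eq_bigr (fun i => (\int[m]_(x in D) f i x)%:E)).
  by rewrite sumEFin.
by move=> i _; rewrite /Rintegral fineK//; exact: (integrable_fin_num mD (fi i)).
Qed.

Variable d : nat.
Local Notation n := d.+1.
Local Notation tmu := (@lebesgue_tuple R n).
Local Notation sigma := (@surface_measure R d).
Local Notation T := (n.-tuple R).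

Lemma normtN0 (x : T) : normt x = 0 -> forall i, tnth x i = 0.
Proof.
move=> h i; have : dotp x x = 0 by rewrite -sqr_normt h expr0n.
move/eqP; rewrite psumr_eq0; last by move=> j _; rewrite -expr2 sqr_ge0.
by move=> /allP /(_ i (mem_index_enum _)); rewrite mulf_eq0 orbb => /eqP.
Qed.

Lemma normt_normalize (x : T) : 0 < normt x -> normt (normalize x) = 1.
Proof.
by move=> x0; rewrite normalizeE normt_scale ?invr_ge0 ?normt_ge0// mulVf ?gt_eqF.
Qed.

Lemma measurable_sphere : measurable (@sphere R d).
Proof.
rewrite -[X in measurable X]setTI.
have := @measurable_normt R n measurableT [set 1] (measurable_set1 _).
by [].
Qed.

Lemma sphereE (x : T) : sphere d x -> dotp x x = 1.
Proof. by rewrite /sphere /= -sqr_normt => ->; rewrite expr1n. Qed.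

Definition unit_ind (r : R) : R := \1_(`]0, 1]%classic) r.

(** The surface measure is n times the image under [normalize] of Lebesgue measure on the punctured
    ball. This image does not charge the complement of the sphere, so the domain of integration may
    be enlarged to the whole space. *)
Lemma ge0_integral_sphere (f : T -> R) : measurable_fun setT f ->
  (forall x, 0 <= f x) ->
  (\int[sigma]_(x in sphere d) (f x)%:E =
   n%:R%:E * \int[tmu]_x (unit_ind (normt x) * f (normalize x))%:E)%E.
Proof.
move=> mf f0.
have mB := @measurable_punctured_ball R n.
have mNz := @measurable_normalize R n.
pose m := measure_function_pushforward__canonical__measure_function_Measure
  (mrestr tmu mB) mNz.
pose rr : {nonneg R} := NngNum (ler0n R n).
have mS := measurable_sphere.
have mfE : measurable_fun setT (EFin \o f) by exact/measurable_EFinP.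
have fE0 x : (0 <= (EFin \o f) x)%E by rewrite lee_fin.
have mfz : measurable_fun setT ((EFin \o f) \o @normalize R n).
  exact: measurableT_comp.
have -> : (\int[sigma]_(x in sphere d) (f x)%:E = \int[sigma]_x (f x)%:E)%E.
  rewrite [RHS](@ge0_negligible_integral _ _ _ _ setT (~` sphere d))//.
  - by rewrite setTD setCK.
  - exact: measurableC.
  - by move=> x _; exact: fE0.
  - rewrite /= /surface_measure (_ : _ `&` _ = set0) ?measure0 ?mule0//.
    rewrite -subset0 => x [/andP[x0 _]]; apply; exact: normt_normalize.
rewrite (eq_measure_integral (mscale rr m)); last first.
  move=> A mA AS; rewrite /mscale /= /surface_measure /m /= /pushforward /mrestr /=.
  by rewrite setIC.
apply: (etrans (ge0_integral_mscale m measurableT rr mfE (fun x _ => fE0 x))).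
apply: (congr1 (fun z => n%:R%:E * z)%E).
apply: (etrans (@ge0_integral_pushforward _ _ _ _ R _ mNz (mrestr tmu mB) setT
  (EFin \o f) measurableT mfE (fun x _ => fE0 x))).
rewrite preimage_setT ge0_integral_mrestr; last 2 first.
- exact: mfz.
- by move=> x; exact: fE0.
rewrite [LHS]integral_mkcond; apply: eq_integral => x _.
rewrite /patch /unit_ind indicE; case: ifPn => [/set_mem xB|/negP xB].
  by rewrite mem_set ?mul1r//= in_itv.
rewrite memNset ?mul0r// => xB'; apply: xB; rewrite inE.
by move: xB'; rewrite /= in_itv.
Qed.

Definition mon (m : 'I_n -> nat) (x : T) : R := \prod_(i < n) tnth x i ^+ m i.
Definition mdegf (m : 'I_n -> nat) : nat := (\sum_i m i)%N.

Lemma measurable_mon m : measurable_fun setT (mon m).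
Proof.
apply: (@measurable_tuple_prod _ _ (fun i t => t ^+ m i)) => i.
exact: measurable_funX.
Qed.

Lemma mon_scale m r x : mon m (scale_tuple r x) = r ^+ mdegf m * mon m x.
Proof.
rewrite /mon /mdegf -prodrXr -big_split /=.
by apply: eq_bigr => i _; rewrite tnth_scale exprMn.
Qed.

Lemma tnth_le_normt (x : T) i : `|tnth x i| <= normt x.
Proof.
rewrite -[X in X <= _]sqrtr_sqr ler_sqrt ?dotp_ge0// /dotp (bigD1 i)//= -expr2 lerDl.
by apply: sumr_ge0 => j _; rewrite -expr2 sqr_ge0.
Qed.

Lemma norm_mon_le m x : `|mon m x| <= normt x ^+ mdegf m.
Proof.
rewrite /mon /mdegf -prodrXr normr_prod; apply: ler_prod => i _.
by rewrite normr_ge0 normrX lerXn2r ?nnegrE ?normt_ge0// tnth_le_normt.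
Qed.

Lemma mon_normalize m (x : T) : 0 < normt x ->
  mon m x = normt x ^+ mdegf m * mon m (normalize x).
Proof.
move=> x0; rewrite normalizeE mon_scale mulrA -exprMn mulfV ?gt_eqF//.
by rewrite expr1n mul1r.
Qed.

Lemma gauss_tupleE m (x : T) :
  mon m x * expR (- normt x ^+ 2) = \prod_(i < n) gauss_mon (m i) (tnth x i).
Proof.
rewrite /mon /gauss_mon big_split /=; congr (_ * _).
by rewrite sqr_normt -expR_sum sumrN; congr (expR (- _)); apply: eq_bigr.
Qed.

Definition gauss_moment m : R := \prod_(i < n) moment (m i).

Lemma gauss_momentE m : tmu.-integrable setT (EFin \o (fun x => mon m x * expR (- normt x ^+ 2)))
  /\ \int[tmu]_x (mon m x * expR (- normt x ^+ 2)) = gauss_moment m.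
Proof.
rewrite (_ : (fun x => _) = fun x => \prod_(i < n) gauss_mon (m i) (tnth x i)).
  by apply: integral_tuple_prod => i; exact: integrable_gauss_mon.
by apply/funext => x; rewrite gauss_tupleE.
Qed.

(** The factor [(0 < r)] forces the value 0 at r = 0 even for k = 0, as [dir_integral_prop]
    requires, and makes the function nonnegative on all reals. *)
Definition gauss_radial k (r : R) : R := (0 < r)%R%:R * (r ^+ k * expR (- r ^+ 2)).

Lemma box_integral (a b : R) : a <= b ->
  tmu.-integrable setT (EFin \o (fun x : T => \prod_(i < n) \1_(`]a, b]%classic) (tnth x i))) /\
  \int[tmu]_x (\prod_(i < n) \1_(`]a, b]%classic) (tnth x i)) = (b - a) ^+ n.
Proof.
move=> ab; have h : lebesgue_measure.-integrable setT (EFin \o (\1_(`]a, b]%classic) : R -> R)).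
  apply/integrableP; split; first by apply/measurable_EFinP; exact: measurable_indic.
  under eq_integral => x _ do rewrite /= ger0_norm//.
  rewrite integral_indic// setIT /= lebesgue_measure_itv/=; case: ifPn => _ //.
  by rewrite -EFinB ltry.
have [h1 h2] := integral_tuple_prod (fun _ : 'I_n => h); split => //.
rewrite h2 prodr_const card_ord; congr (_ ^+ _).
rewrite /Rintegral integral_indic// setIT /= lebesgue_measure_itv/= lte_fin.
case: ifPn => //=; rewrite -leNgt => ba; lra.
Qed.

Lemma box_indicator (a b : R) (x : T) :
  \prod_(i < n) \1_(`]a, b]%classic) (tnth x i) =
  [forall i, a < tnth x i <= b]%:R :> R.
Proof.
case: forallP => [h|/forallP]; last first.
  rewrite negb_forall => /existsP[i hi]; rewrite (bigD1 i)//= indicE memNset ?mul0r//=.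
  by rewrite in_itv/=; apply/negP.
by apply: big1 => i _; rewrite indicE mem_set//= in_itv/= h.
Qed.

Definition mass (phi : R -> R) : R := fine (radial_mass n phi).

Lemma measurable_unit_ind : measurable_fun setT unit_ind.
Proof. exact: measurable_indic. Qed.

Lemma measurable_gauss_radial k : measurable_fun setT (gauss_radial k).
Proof.
apply: measurable_funM.
  rewrite (_ : (fun r : R => (0 < r)%R%:R) = \1_(`]0, +oo[%classic)).
    exact: measurable_indic.
  apply/funext => r; rewrite indicE; congr (nat_of_bool _)%:R.
  by apply/idP/idP => [h|/set_mem]; rewrite ?inE /= in_itv/= andbT.
by apply: continuous_measurable_fun => x; exact: (@continuous_gauss_mon R k).
Qed.

Lemma unit_ind_ge0 r : 0 <= unit_ind r. Proof. by rewrite /unit_ind. Qed.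

Lemma gauss_radial_ge0 k r : 0 <= gauss_radial k r.
Proof.
rewrite /gauss_radial; case: ltP => r0; last by rewrite mul0r.
by rewrite mul1r mulr_ge0 ?expR_ge0// exprn_ge0// ltW.
Qed.

(** Positivity comes from a cube on which phi is at least c, finiteness from the majorant g; cubes
    and product majorants are what [integral_tuple_prod] can integrate. *)
Lemma mass_bounds (phi : R -> R) c a b (g : T -> R) : measurable_fun setT phi ->
  (forall r, 0 <= r -> 0 <= phi r) ->
  0 < c -> a < b ->
  (forall x : T, (forall i, a < tnth x i <= b) -> c <= phi (normt x)) ->
  tmu.-integrable setT (EFin \o g) ->
  (forall x, phi (normt x) <= g x) ->
  tmu.-integrable setT (EFin \o (fun x => phi (normt x))) /\ 0 < mass phi.
Proof.
move=> mphi phi0 c0 ab lb ig ub.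
have mN := @measurable_normt R n.
have mf : measurable_fun setT (fun x : T => phi (normt x)) by exact: measurableT_comp.
have ip : tmu.-integrable setT (EFin \o (fun x => phi (normt x))).
  apply: (le_integrable _ _ _ ig) => //; first exact/measurable_EFinP.
  move=> x _; rewrite lee_fin ger0_norm ?phi0 ?normt_ge0//.
  exact: le_trans (ub x) (ler_norm _).
split => //.
have [ib Eb] := box_integral (ltW ab).
apply: (@lt_le_trans _ _ (c * (b - a) ^+ n)).
  by rewrite mulr_gt0// exprn_gt0// subr_gt0.
rewrite -Eb -RintegralZl//; apply: le_Rintegral => //.
  by have := integrableZl measurableT c ib.
move=> x _; rewrite box_indicator; case: forallP => [h|_].
  by rewrite mulr1; exact: lb.
by rewrite mulr0 phi0 ?normt_ge0.
Qed.

Lemma unit_ball_mass :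
  tmu.-integrable setT (EFin \o (fun x => unit_ind (normt x))) /\ 0 < mass unit_ind.
Proof.
have n0 : 0 < (n%:R : R) by rewrite ltr0n.
(* The majorant cube is ]-2, 1], since ]-1, 1] would miss the points having a coordinate -1. The
   lower bound uses the cube ]0, 1/n], on which x_i^2 <= x_i <= 1/n and so |x| <= 1. *)
have [ib _] := @box_integral (-2) 1 ltac:(lra).
apply: (mass_bounds measurable_unit_ind (fun r _ => unit_ind_ge0 r) ltr01 (_ : 0 < n%:R^-1) _ ib).
- by rewrite invr_gt0.
- move=> x h; rewrite /unit_ind indicE mem_set//= in_itv/=.
  apply/andP; split.
    rewrite (lt_le_trans _ (tnth_le_normt x ord0))// normr_gt0.
    by have /andP[/gt_eqF -> _] := h ord0.
  rewrite -(ler_sqr (normt_ge0 x) ler01) expr1n sqr_normt /dotp.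
  apply: (@le_trans _ _ (\sum_(i < n) n%:R^-1)).
    apply: ler_sum => i _; have /andP[h0 h1] := h i.
    apply: (@le_trans _ _ (tnth x i * 1)); last by rewrite mulr1.
    rewrite ler_wpM2l// ?(ltW h0)// (le_trans h1)// invf_le1// ler1n//.
  by rewrite sumr_const card_ord -[_ *+ _]mulr_natr mulVf// gt_eqF.
- move=> x; rewrite box_indicator /unit_ind indicE ler_nat.
  case: (boolP (_ \in _)) => //; rewrite inE /= in_itv/= => /andP[_ h].
  have -> // : [forall i, -2 < tnth x i <= 1].
  apply/forallP => i; have := le_trans (tnth_le_normt x i) h.
  by rewrite ler_norml => /andP[h1 ->]; rewrite andbT (lt_le_trans _ h1)// ltrN2 ltr1n.
Qed.

Lemma gauss_radial_mass k :
  tmu.-integrable setT (EFin \o (fun x => gauss_radial k (normt x))) /\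
  0 < mass (gauss_radial k).
Proof.
(* Since |x| <= 1 + |x|^2 <= \prod_i (1 + x_i^2), the radial function lies below a product of
   one-variable functions. *)
pose G (t : R) : R := (1 + t ^+ 2) ^+ k * expR (- t ^+ 2).
have iG : lebesgue_measure.-integrable setT (EFin \o G).
  rewrite (_ : _ \o _ = fun t => (\sum_(i < k.+1) ('C(k, i)%:R)%:E * (EFin \o gauss_mon (2 * i)) t)%E).
    apply: integrable_sum => // i _.
    by apply: integrableZl => //; exact: integrable_gauss_mon.
  apply/funext => t; rewrite /= /G addrC exprD1n mulr_suml sumEFin; congr EFin.
  by apply: eq_bigr => i _; rewrite /gauss_mon exprM mulrA mulr_natl.
have [ig _] := integral_tuple_prod (fun _ : 'I_n => iG).
apply: (mass_bounds (measurable_gauss_radial k) (fun r _ => gauss_radial_ge0 k r)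
  (_ : 0 < 2^-1 ^+ k * expR (- n%:R)) (_ : 2^-1 < 1 :> R) _ ig).
- by rewrite mulr_gt0 ?exprn_gt0 ?expR_gt0.
- by rewrite invf_lt1 ?ltr1n.
- move=> x h; have hN : 2^-1 <= normt x.
    apply: le_trans (tnth_le_normt x ord0); have /andP[h0 _] := h ord0.
    by rewrite (le_trans (ltW h0))// ler_norm.
  rewrite /gauss_radial (lt_le_trans _ hN) ?invr_gt0// mul1r.
  apply: ler_pM; rewrite ?exprn_ge0 ?expR_ge0//.
    by rewrite lerXn2r// nnegrE ?normt_ge0.
  rewrite ler_expR lerN2 sqr_normt /dotp.
  apply: (@le_trans _ _ (\sum_(i < n) 1)); last by rewrite sumr_const card_ord.
  apply: ler_sum => i _; have /andP[h0 h1] := h i; rewrite -expr2.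
  by rewrite expr_le1//; apply: ltW; apply: lt_trans h0; rewrite invr_gt0.
- move=> x; rewrite /gauss_radial /G.
  apply: (@le_trans _ _ (normt x ^+ k * expR (- normt x ^+ 2))).
    by case: ltP => _; rewrite ?mul1r// mul0r mulr_ge0 ?exprn_ge0 ?normt_ge0 ?expR_ge0.
  rewrite big_split /= -expR_sum sumrN sqr_normt /dotp.
  rewrite (eq_bigr (fun i => tnth x i ^+ 2)); last by move=> i _; rewrite expr2.
  rewrite ler_pM2r ?expR_gt0// prodrXl lerXn2r// ?nnegrE ?normt_ge0//.
    by apply: prodr_ge0 => i _; rewrite addr_ge0// sqr_ge0.
  apply: (@le_trans _ _ (1 + \sum_i tnth x i ^+ 2)).
    have -> : \sum_i tnth x i ^+ 2 = normt x ^+ 2.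
      by rewrite sqr_normt; apply: eq_bigr => i _; rewrite expr2.
    by have := sqr_ge0 (normt x - 1); have := normt_ge0 x; rewrite sqrrB; lra.
  suff [] : 1 + \sum_i tnth x i ^+ 2 <= \prod_i (1 + tnth x i ^+ 2) /\
            0 <= \sum_i tnth x i ^+ 2 by [].
  elim/big_rec2 : _ => [|i y z _ [ih y0]]; first by rewrite addr0.
  have u0 := sqr_ge0 (tnth x i); split; last exact: addr_ge0.
  rewrite addrCA mulrDl mul1r addrC; apply: lerD => //.
  by rewrite ler_peMr// (le_trans _ ih)// lerDl.
Qed.

Lemma measurable_normt0 : measurable [set x : T | normt x = 0].
Proof.
rewrite -[X in measurable X]setTI.
by have := @measurable_normt R n measurableT [set 0] (measurable_set1 _).
Qed.

(* {0} is invariant under x |-> 2 x, which multiplies measures by 2^n *)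
Lemma normt0_negligible : tmu [set x | normt x = 0] = 0%E.
Proof.
set Z := [set x : T | normt x = 0].
have mZ : measurable Z := measurable_normt0.
have mI : measurable_fun setT (EFin \o (\1_Z : T -> R)).
  by apply/measurable_EFinP; exact: measurable_indic.
have I0 t : (0 <= (EFin \o (\1_Z : T -> R)) t)%E by rewrite lee_fin.
have := ge0_integral_scale (ltr0n R 2) mI I0.
have -> : (\int[tmu]_x (EFin \o (\1_Z : T -> R)) (scale_tuple 2 x) = tmu Z)%E.
  transitivity (\int[tmu]_x (\1_Z x)%:E)%E; last by rewrite integral_indic// setIT.
  apply: eq_integral => x _ /=.
  rewrite !indicE; congr (nat_of_bool _)%:R%:E.
  by apply/idP/idP; rewrite !inE /Z /= normt_scale//; lra.
move=> sc.
have [ib _] := @box_integral (-1) 1 ltac:(lra).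
have iZ : tmu.-integrable setT (EFin \o (\1_Z : T -> R)).
  apply: (le_integrable _ _ _ ib) => //; move=> x _ /=; rewrite lee_fin.
  rewrite box_indicator !normr_nat ler_nat; case: (boolP (_ \in _)) => // /set_mem xZ.
  have -> // : [forall i, -1 < tnth x i <= 1].
  by apply/forallP => i; rewrite (normtN0 xZ); lra.
have fin := integrable_fin_num measurableT iZ.
have e : (\int[tmu]_x (EFin \o (\1_Z : T -> R)) x = tmu Z)%E.
  by rewrite integral_indic// setIT.
move: sc fin; rewrite e; case: (tmu Z) => // z [zE] _.
have h : 1 < 2 ^+ n :> R by rewrite exprn_egt1// ltr1n.
have : (2 ^+ n - 1) * z = 0 by rewrite mulrBl mul1r -zE subrr.
by move/eqP; rewrite mulf_eq0 subr_eq0 (gt_eqF h)/= => /eqP ->.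
Qed.

Lemma mon_normalize_le1 m x : `|mon m (normalize x)| <= 1.
Proof.
rewrite (le_trans (norm_mon_le _ _))// exprn_ile1 ?normt_ge0//.
have [x0|x0] := ltrP 0 (normt x); first by rewrite normt_normalize.
have e : normt x = 0 by apply/eqP; rewrite eq_le x0 normt_ge0.
by rewrite normalizeE normt_scale ?invr_ge0 ?normt_ge0// e mulr0.
Qed.

Definition dir_integral (phi : R -> R) m : R :=
  \int[tmu]_x (phi (normt x) * mon m (normalize x)).

Lemma measurable_mon_normalize m : measurable_fun setT (fun x => mon m (normalize x)).
Proof. by apply: (measurableT_comp (measurable_mon m)); exact: measurable_normalize. Qed.

Lemma integrable_dir (phi : R -> R) m : measurable_fun setT phi ->
  (forall r, 0 <= phi r) ->
  tmu.-integrable setT (EFin \o (fun x => phi (normt x))) ->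
  tmu.-integrable setT (EFin \o (fun x => phi (normt x) * mon m (normalize x))).
Proof.
move=> mphi phi0 ip; apply: (le_integrable _ _ _ ip) => //.
  apply/measurable_EFinP; apply: measurable_funM; last exact: measurable_mon_normalize.
  by apply: measurableT_comp => //; exact: measurable_normt.
by move=> x _ /=; rewrite lee_fin normrM ler_piMr// mon_normalize_le1.
Qed.

Lemma dir_integralE (phi : R -> R) m : measurable_fun setT phi ->
  (forall r, 0 <= phi r) ->
  tmu.-integrable setT (EFin \o (fun x => phi (normt x))) ->
  radial_integral phi (fun x : T => 1 + mon m (normalize x)) =
   (mass phi + dir_integral phi m)%:E.
Proof.
move=> mphi phi0 ip.
have im := integrable_dir m mphi phi0 ip.
rewrite /radial_integral /mass /radial_mass /dir_integral.
rewrite EFinD fineK; last exact: integrable_fin_num.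
rewrite /Rintegral fineK; last exact: (integrable_fin_num _ im).
rewrite -integralD//; apply: eq_integral => x _.
by rewrite -EFinD mulrDr mulr1.
Qed.

(** [radial_integralM] for the pairs (phi, [unit_ind]) and ([unit_ind], [unit_ind]) contains the
    same unknown [inverse_radial_integral], which is eliminated. Tonelli wants nonnegative
    integrands, hence h = 1 + mon instead of the monomial itself. *)
Lemma dir_integral_prop (phi : R -> R) m : measurable_fun setT phi ->
  (forall r, 0 <= phi r) -> phi 0 = 0 ->
  tmu.-integrable setT (EFin \o (fun x => phi (normt x))) ->
  dir_integral phi m * mass unit_ind = mass phi * dir_integral unit_ind m.
Proof.
move=> mphi phi0 phi00 ip.
pose h (x : T) := 1 + mon m (normalize x).
have mh : measurable_fun setT h.
  by apply: measurable_funD => //; exact: measurable_mon_normalize.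
have h0 x : 0 <= h x.
  have := mon_normalize_le1 m x; rewrite ler_norml => /andP[+ _].
  by rewrite -subr_ge0 opprK addrC.
have hs r x : 0 < r -> h (scale_tuple r x) = h x.
  by move=> r0; rewrite /h normalize_scale.
have [ib B0] := unit_ball_mass.
have u00 : unit_ind 0 = 0 by rewrite /unit_ind indicE memNset//= in_itv/= ltxx.
have massE (p : R -> R) : tmu.-integrable setT (EFin \o (fun x => p (normt x))) ->
    radial_mass n p = (mass p)%:E.
  by move=> ipp; rewrite /mass fineK// integrable_fin_num.
have := radial_integralM (ltn0Sn d) mphi measurable_unit_ind mh phi0 unit_ind_ge0 h0 phi00 u00 hs.
have := radial_integralM (ltn0Sn d) measurable_unit_ind measurable_unit_ind mh unit_ind_ge0 unit_ind_ge0 h0 u00 u00 hs.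
rewrite !massE// !dir_integralE//.
have := @inverse_radial_integral.
(* An infinite unknown would make a finite left-hand side infinite, because [mass unit_ind] is
   positive. *)
case: (inverse_radial_integral _ _) => [e _| |].
- rewrite -!EFinM => -[e1] [e2].
  have e3 : e = mass unit_ind + dir_integral unit_ind m.
    by apply: (mulfI (lt0r_neq0 B0)); rewrite -e1 mulrC.
  move: e2; rewrite e3 mulrDl mulrDr; lra.
- by rewrite gt0_muley ?lte_fin.
- by rewrite gt0_muleNy ?lte_fin.
- exact: measurable_unit_ind.
Qed.

Lemma gauss_moment_dir m : gauss_moment m = dir_integral (gauss_radial (mdegf m)) m.
Proof.
have [ig <-] := gauss_momentE m.
have mZ := measurable_normt0.
have [ir _] := gauss_radial_mass (mdegf m).
have im := integrable_dir m (measurable_gauss_radial _) (gauss_radial_ge0 _) ir.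
rewrite /dir_integral /Rintegral; congr fine.
rewrite (negligible_integral mZ _ ig normt0_negligible)//.
rewrite [RHS](negligible_integral mZ _ im normt0_negligible)//.
apply: eq_integral => x; rewrite inE /= => -[_ /eqP x0].
have {}x0 : 0 < normt x by rewrite lt_def x0 normt_ge0.
rewrite /= /gauss_radial x0 mul1r [in LHS]mon_normalize//; congr EFin; ring.
Qed.

Lemma surface_fin : (sigma setT < +oo)%E.
Proof.
rewrite /= /surface_measure preimage_setT setIT.
rewrite lte_mul_pinfty// ?lee_fin//.
have [ib _] := unit_ball_mass; have mB := @measurable_punctured_ball R n.
have := integrable_fin_num measurableT ib.
rewrite (_ : (fun x => _) = \1_(punctured_ball n)); last first.
  by apply/funext => x; rewrite /unit_ind !indicE; congr (nat_of_bool _)%:R.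
have -> : (\int[tmu]_x (EFin \o (\1_(punctured_ball n) : T -> R)) x = tmu (punctured_ball n))%E.
  by rewrite integral_indic// setIT.
by rewrite ge0_fin_numE.
Qed.

HB.instance Definition _ := @Measure_isFinite.Build _ _ _ sigma
  (lty_fin_num_fun surface_fin).

Definition area : R := fine (sigma (sphere d)).
Definition sphere_mon m : R := \int[sigma]_(x in sphere d) mon m x.

Lemma normalize_sphere (x : T) : sphere d x -> normalize x = x.
Proof.
move=> Sx; apply: eq_from_tnth => i.
by rewrite normalizeE tnth_scale (Sx : normt x = 1) invr1 mul1r.
Qed.

Lemma integrable_sphere_mon m : sigma.-integrable (sphere d) (EFin \o mon m).
Proof.
have mS := measurable_sphere.
have i1 : sigma.-integrable (sphere d) (EFin \o cst 1).
  exact: finite_measure_integrable_cst.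
apply: (le_integrable mS _ _ i1).
  by apply/measurable_EFinP; apply: measurable_funTS; exact: measurable_mon.
move=> x Sx /=; rewrite lee_fin normr1 -{1}(normalize_sphere Sx).
exact: mon_normalize_le1.
Qed.

Lemma area_mass : area = n%:R * mass unit_ind.
Proof.
have := @ge0_integral_sphere (cst 1) (@measurable_cst _ _ _ _ _ _) (fun _ => ler01).
have e1 : (\int[sigma]_(x in sphere d) (cst 1 x)%:E = sigma (sphere d))%E.
  exact: (etrans (integral_cst sigma measurable_sphere 1%E) (mul1e _)).
have e2 : (\int[tmu]_x (unit_ind (normt x) * cst 1 (normalize x))%:E =
           \int[tmu]_x (unit_ind (normt x))%:E)%E.
  by apply: eq_integral => x _; rewrite mulr1.
rewrite e1 e2 => h; rewrite /area [X in fine X]h /mass /radial_mass.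
have [ib _] := unit_ball_mass; have fin := integrable_fin_num measurableT ib.
by rewrite fineM.
Qed.

Lemma sphere_mon_dir m : sphere_mon m = n%:R * dir_integral unit_ind m.
Proof.
have mS := measurable_sphere.
have [ib _] := unit_ball_mass.
have h0 x : 0 <= 1 + mon m (normalize x).
  have := mon_normalize_le1 m x; rewrite ler_norml => /andP[+ _].
  by rewrite -subr_ge0 opprK addrC.
have mh : measurable_fun setT (fun x => 1 + mon m (normalize x)).
  by apply: measurable_funD => //; exact: measurable_mon_normalize.
have := ge0_integral_sphere mh h0.
have -> : (\int[sigma]_(x in sphere d) (1 + mon m (normalize x))%:E)%E
    = (area + sphere_mon m)%:E.
  rewrite (eq_integral (fun x => 1%:E + (EFin \o mon m) x)%E); last first.
    by move=> x; rewrite inE => Sx; rewrite normalize_sphere.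
  rewrite integralD//; last 2 first.
  - exact: finite_measure_integrable_cst.
  - exact: integrable_sphere_mon.
  rewrite (etrans (integral_cst sigma mS 1%E) (mul1e _)) EFinD /area /sphere_mon /Rintegral !fineK//.
  - exact: (integrable_fin_num mS (integrable_sphere_mon m)).
  - exact: (fin_num_measure sigma).
have := dir_integralE m measurable_unit_ind unit_ind_ge0 ib.
rewrite /radial_integral => e.
have -> : (\int[tmu]_x (unit_ind (normt x) * (1 + mon m (normalize (normalize x))))%:E =
   \int[tmu]_x (unit_ind (normt x) * (1 + mon m (normalize x)))%:E)%E.
  apply: eq_integral => x _; congr EFin.
  rewrite /unit_ind indicE; case: (boolP (_ \in _)) => [|_]; last by rewrite !mul0r.
  rewrite inE /= in_itv /= => /andP[x0 _]; rewrite (@normalize_sphere (normalize x))//.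
  exact: normt_normalize.
rewrite e -EFinM => -[]; rewrite area_mass mulrDr; exact: addrI.
Qed.

Lemma area_gt0 : 0 < area.
Proof. by rewrite area_mass mulr_gt0// ?ltr0n//; have [] := unit_ball_mass. Qed.

(** Homogeneity writes the Gaussian moment as a radial integral with weight r^k e^(-r^2), while the
    surface measure corresponds to the weight [unit_ind]; the proportionality in [dir_integral_prop]
    links the two. *)
Lemma sphere_mon_gauss m :
  gauss_moment m * area = mass (gauss_radial (mdegf m)) * sphere_mon m.
Proof.
have [ir _] := gauss_radial_mass (mdegf m).
have r0 : gauss_radial (mdegf m) 0 = 0 by rewrite /gauss_radial ltxx mul0r.
have := dir_integral_prop m (measurable_gauss_radial _) (gauss_radial_ge0 _) r0 ir.
rewrite -gauss_moment_dir area_mass sphere_mon_dir => e.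
by rewrite mulrCA e mulrCA.
Qed.

Definition upd (m : 'I_n -> nat) i k : 'I_n -> nat := fun j => if j == i then k else m j.

Lemma mdegf_upd m i k : (mdegf (upd m i k) + m i = mdegf m + k)%N.
Proof.
rewrite /mdegf (bigD1 i)//= [in RHS](bigD1 i)//= /upd eqxx.
rewrite (eq_bigr (fun j => m j)); first by lia.
by move=> j /negbTE ->.
Qed.

Lemma gauss_moment_upd m i k :
  gauss_moment (upd m i k) * moment (m i) = gauss_moment m * moment k :> R.
Proof.
rewrite /gauss_moment (bigD1 i)//= [in RHS](bigD1 i)//= /upd eqxx.
rewrite (eq_bigr (fun j => moment (m j))); last by move=> j /negbTE ->.
ring.
Qed.

Lemma sphere_mon_odd m i : odd (m i) -> sphere_mon m = 0.
Proof.
move=> oi; have := sphere_mon_gauss m.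
rewrite /gauss_moment (bigD1 i)//= moment_odd// !mul0r => /esym/eqP.
by have [_ /gt_eqF] := gauss_radial_mass (mdegf m); rewrite mulf_eq0 => -> /= /eqP.
Qed.

Lemma mon_upd m i k x : mon (upd m i (m i + k)%N) x = tnth x i ^+ k * mon m x.
Proof.
rewrite /mon (bigD1 i)//= [in RHS](bigD1 i)//= /upd eqxx exprD.
rewrite (eq_bigr (fun j => tnth x j ^+ m j)); last by move=> j /negbTE ->.
ring.
Qed.

Lemma sphere_monD m : sphere_mon m = \sum_i sphere_mon (upd m i (m i + 2)%N).
Proof.
have mS := measurable_sphere.
rewrite /sphere_mon -Rintegral_sum//; last by move=> i; exact: integrable_sphere_mon.
apply: eq_Rintegral => x; rewrite inE => Sx.
under eq_bigr => i _ do rewrite mon_upd expr2.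
by rewrite -mulr_suml -/(dotp x x) sphereE// mul1r.
Qed.

Lemma gauss_moment_even_gt0 m : (forall i, ~~ odd (m i)) -> 0 < gauss_moment m.
Proof. by move=> em; apply: prodr_gt0 => i _; rewrite moment_even_gt0. Qed.

(** Obtained without radial integration by parts: [sphere_mon_gauss] is read at x_0^k and at the
    monomials x_i^2 x_0^k, whose sphere integrals add up to that of x_0^k because |x| = 1. The
    integral of x_0^k is cancelled at the end, and k even makes it nonzero. *)
Lemma radial_rec k : ~~ odd k -> 2 * mass (gauss_radial k.+2) =
  (k + n)%:R * mass (gauss_radial k).
Proof.
move=> ek; pose m (i : 'I_n) := if i == ord0 then k else 0%N.
have em i : ~~ odd (m i) by rewrite /m; case: ifP.
have dm : mdegf m = k.
  by rewrite /mdegf (bigD1 ord0)//= big1 ?addn0 /m ?eqxx// => i /negbTE ->.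
have gm := gauss_moment_even_gt0 em.
have du i : mdegf (upd m i (m i + 2)%N) = k.+2 by have := mdegf_upd m i (m i + 2); lia.
have gu i : 2 * gauss_moment (upd m i (m i + 2)%N) = (m i).+1%:R * gauss_moment m.
  have m0 := moment_even_gt0 (R := R) (em i).
  apply: (mulIf (lt0r_neq0 m0)); rewrite -mulrA gauss_moment_upd addn2.
  by rewrite mulrCA moment_rec; ring.
have Jm := sphere_mon_gauss m; rewrite dm in Jm.
have J0 : sphere_mon m != 0.
  apply/eqP => e; move: Jm; rewrite e mulr0 => /eqP.
  by rewrite mulf_eq0 !gt_eqF// area_gt0.
apply: (mulIf J0); rewrite -mulrA {1}sphere_monD mulr_sumr mulr_sumr.
rewrite (eq_bigr (fun i => (m i).+1%:R * (gauss_moment m * area))).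
  rewrite -mulr_suml Jm mulrA; congr (_ * _ * _); rewrite -natr_sum; congr _%:R.
  under eq_bigr => i _ do rewrite -addn1.
  by rewrite big_split /= sum_nat_const card_ord muln1 -/(mdegf m) dm.
move=> i _; rewrite -(du i) -sphere_mon_gauss !mulrA gu; ring.
Qed.

(* The relation [\int Delta p = k (k + d - 1) \int p] for a monomial of degree k *)
Lemma sphere_mon_rec m :
  (mdegf m * (mdegf m + d).-1)%:R * sphere_mon m =
  \sum_i (m i * (m i).-1)%:R * sphere_mon (upd m i (m i - 2)%N).
Proof.
have [/existsP[i0 oi]|] := boolP [exists i, odd (m i)].
  rewrite (sphere_mon_odd oi) mulr0 big1// => i _.
  case: (eqVneq i i0) => [->|ii0].
    case mi: (m i0) (oi) => [//|[|k]] /=; first by rewrite muln0 mul0r.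
    rewrite negbK => ok; rewrite (@sphere_mon_odd _ i0) ?mulr0//.
    by rewrite /upd eqxx subn2.
  by rewrite (@sphere_mon_odd _ i0) ?mulr0// /upd eq_sym (negbTE ii0).
rewrite negb_exists => /forallP em.
have [k0|k0] := posnP (mdegf m).
  have m0 i : m i = 0%N.
    by apply/eqP; have /eqP := k0; rewrite /mdegf sum_nat_eq0 => /forallP /(_ i).
  by rewrite k0 mul0n mul0r big1// => i _; rewrite m0 mul0n mul0r.
have ek : ~~ odd (mdegf m).
  rewrite /mdegf; elim/big_rec : _ => // i x _; rewrite oddD => /negbTE ->.
  by rewrite addbF.
case kE: (mdegf m) k0 ek => [//|[//|k]] _ /=; rewrite negbK => ek.
have [_ r0] := gauss_radial_mass k.
apply: (mulfI (lt0r_neq0 r0)); rewrite mulr_sumr.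
rewrite (eq_bigr (fun i => (m i)%:R * (2 * gauss_moment m * area))); last first.
  move=> i _; have [|mi] := ltnP (m i) 2.
    by move: (em i); case: (m i) => [|[|//]]// _ _; rewrite !mul0n !mul0r mulr0.
  have du : mdegf (upd m i (m i - 2)%N) = k by have := mdegf_upd m i (m i - 2); lia.
  rewrite mulrCA -{1}du -sphere_mon_gauss natrM -!mulrA; congr (_ * _).
  rewrite !mulrA; congr (_ * _).
  have m0 := moment_even_gt0 (R := R) (em i).
  apply: (mulIf (lt0r_neq0 m0)); rewrite -mulrA gauss_moment_upd.
  have := moment_rec (R := R) (m i - 2); have -> : (m i - 2).+2 = m i by lia.
  have -> : (m i - 2).+1 = (m i).-1 by lia.
  by move=> e; rewrite mulrCA -e; ring.
rewrite -mulr_suml -natr_sum -/(mdegf m) kE.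
have := sphere_mon_gauss m; rewrite kE -mulrA => ->.
rewrite [2 * _]mulrA radial_rec// natrM.
have -> : (k.+1 + d)%N = (k + n)%N by lia.
ring.
Qed.

End SphereIntegral.

Local Open Scope complex_scope.

(** * Spherical harmonics and the addition theorem *)

Section ComplexIntegralTheory.
Context {R : realType} {dT : measure_display} {T : measurableType dT}.
Variable (mu : {measure set T -> \bar R}) (D : set T).
Hypothesis mD : measurable D.
Local Notation Re := (@complex.Re R).
Local Notation Im := (@complex.Im R).

Definition cintegrable (X : T -> R[i]) :=
  mu.-integrable D (EFin \o (Re \o X)) /\ mu.-integrable D (EFin \o (Im \o X)).

Lemma eq_cintegral (X Y : T -> R[i]) : (forall x, D x -> X x = Y x) ->
  cintegral mu D X = cintegral mu D Y.
Proof.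
move=> XY; rewrite /cintegral; congr (_ +i* _);
  by apply: eq_Rintegral => x; rewrite inE => Dx; rewrite XY.
Qed.

Lemma eq_cintegrable (X Y : T -> R[i]) : (forall x, D x -> X x = Y x) ->
  cintegrable X -> cintegrable Y.
Proof.
move=> XY [rX iX]; split; [apply: eq_integrable rX|apply: eq_integrable iX] => //;
  by move=> x; rewrite inE => Dx /=; rewrite XY.
Qed.

Lemma cReD (x y : R[i]) : Re (x + y) = Re x + Re y. Proof. by case: x y => ? ? []. Qed.
Lemma cImD (x y : R[i]) : Im (x + y) = Im x + Im y. Proof. by case: x y => ? ? []. Qed.
Lemma cReM (x y : R[i]) : Re (x * y) = Re x * Re y - Im x * Im y.
Proof. by case: x y => ? ? []. Qed.
Lemma cImM (x y : R[i]) : Im (x * y) = Re x * Im y + Im x * Re y.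
Proof. by case: x y => ? ? []. Qed.

Lemma cintegrableD (X Y : T -> R[i]) : cintegrable X -> cintegrable Y ->
  cintegrable (fun x => X x + Y x).
Proof.
move=> [rX iX] [rY iY]; split.
- rewrite (_ : _ \o _ = (EFin \o (Re \o X)) \+ (EFin \o (Re \o Y)))%E; last first.
    by apply/funext => x /=; rewrite cReD.
  exact: integrableD.
- rewrite (_ : _ \o _ = (EFin \o (Im \o X)) \+ (EFin \o (Im \o Y)))%E; last first.
    by apply/funext => x /=; rewrite cImD.
  exact: integrableD.
Qed.

Lemma cintegralD (X Y : T -> R[i]) : cintegrable X -> cintegrable Y ->
  cintegral mu D (fun x => X x + Y x) = cintegral mu D X + cintegral mu D Y.
Proof.
move=> [rX iX] [rY iY]; rewrite /cintegral /=; apply/eqP; rewrite eq_complex /=.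
apply/andP; split; apply/eqP; rewrite -RintegralD//; apply: eq_Rintegral => x _.
  by rewrite cReD.
by rewrite cImD.
Qed.

Lemma cintegrableZ c (X : T -> R[i]) : cintegrable X ->
  cintegrable (fun x => c * X x).
Proof.
move=> [rX iX]; split.
- rewrite (_ : _ \o _ = (fun x => (Re c)%:E * (EFin \o (Re \o X)) x) \+
    (fun x => (- Im c)%:E * (EFin \o (Im \o X)) x))%E; last first.
    by apply/funext => x /=; rewrite cReM -EFinD mulNr.
  by apply: integrableD => //; exact: integrableZl.
- rewrite (_ : _ \o _ = (fun x => (Re c)%:E * (EFin \o (Im \o X)) x) \+
    (fun x => (Im c)%:E * (EFin \o (Re \o X)) x))%E; last first.
    by apply/funext => x /=; rewrite cImM -EFinD.
  by apply: integrableD => //; exact: integrableZl.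
Qed.

Lemma cintegralZ c (X : T -> R[i]) : cintegrable X ->
  cintegral mu D (fun x => c * X x) = c * cintegral mu D X.
Proof.
move=> [rX iX]; rewrite /cintegral; apply/eqP; rewrite eq_complex cReM cImM /=.
apply/andP; split; apply/eqP.
- rewrite -!RintegralZl// -RintegralB//; first by apply: eq_Rintegral => x _; rewrite cReM.
  + exact: (integrableZl mD _ rX).
  + exact: (integrableZl mD _ iX).
- rewrite -!RintegralZl// -RintegralD//; first by apply: eq_Rintegral => x _; rewrite cImM.
  + exact: (integrableZl mD _ iX).
  + exact: (integrableZl mD _ rX).
Qed.

Lemma cintegrable0 : cintegrable (fun _ => 0).
Proof. by split; exact: integrable0. Qed.

Lemma cintegral0 : cintegral mu D (fun _ => 0) = 0.
Proof. by rewrite /cintegral /= /Rintegral integral0. Qed.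

Lemma cintegrable_sum (I : Type) (s : seq I) (P : pred I) (X : I -> T -> R[i]) :
  (forall i, P i -> cintegrable (X i)) -> cintegrable (fun x => \sum_(i <- s | P i) X i x).
Proof.
move=> iX; elim: s => [|i s ih].
  by apply: (eq_cintegrable _ cintegrable0) => x _; rewrite big_nil.
apply: (@eq_cintegrable (fun x => (if P i then X i x else 0) + \sum_(i <- s | P i) X i x)).
  by move=> x _; rewrite big_cons; case: ifP => // _; rewrite add0r.
apply: cintegrableD => //; have [Pi|_] := boolP (P i); [exact: iX|exact: cintegrable0].
Qed.

Lemma cintegral_sum (I : Type) (s : seq I) (P : pred I) (X : I -> T -> R[i]) :
  (forall i, P i -> cintegrable (X i)) ->
  cintegral mu D (fun x => \sum_(i <- s | P i) X i x) =
  \sum_(i <- s | P i) cintegral mu D (X i).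
Proof.
move=> iX; elim: s => [|i s ih].
  rewrite [RHS]big_nil -[RHS]cintegral0.
  by apply: eq_cintegral => x _; rewrite big_nil.
rewrite big_cons -ih; case: ifPn => Pi; last first.
  by apply: eq_cintegral => x _; rewrite big_cons (negbTE Pi).
rewrite -cintegralD//; [|exact: iX|exact: cintegrable_sum].
by apply: eq_cintegral => x _; rewrite big_cons Pi.
Qed.

End ComplexIntegralTheory.

(** * Polynomials on the sphere and the integral of a Laplacian *)

Section SpherePolynomials.
Context {R : realType} (d : nat).
Local Notation C := R[i].
Local Notation n := d.+1.
Local Notation sigma := (@surface_measure R d).
Local Notation T := (n.-tuple R).
Local Notation MP := (mpoly.mpoly n C).
Local Notation X_ i := (@mpoly.mpolyX n C (mpoly.mnm1 i)).
Local Notation "p ^`M i" := (mpoly.mderiv i p) (at level 8, i at level 2, format "p ^`M  i").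
Local Notation homog k := (mpoly.ishomog1 k (@mpoly.mdeg n)).
Implicit Types (p q : MP) (x : T).

Definition evs p x : C := mpoly.meval (fun i => (tnth x i)%:C) p.

Definition sphI p : C := cintegral sigma (sphere d) (evs p).

Lemma evsD p q x : evs (p + q) x = evs p x + evs q x. Proof. exact: mpoly.mevalD. Qed.
Lemma evsM p q x : evs (p * q) x = evs p x * evs q x. Proof. exact: mpoly.mevalM. Qed.
Lemma evsZ c p x : evs (c *: p) x = c * evs p x. Proof. exact: mpoly.mevalZ. Qed.
Lemma evs_sum (I : Type) (s : seq I) (P : pred I) (F : I -> MP) x :
  evs (\sum_(i <- s | P i) F i) x = \sum_(i <- s | P i) evs (F i) x.
Proof. by rewrite /evs raddf_sum. Qed.
Lemma evsXU i x : evs (X_ i) x = (tnth x i)%:C. Proof. exact: mpoly.mevalXU. Qed.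

Lemma evsX (m : mpoly.multinom n) x : evs (mpoly.mpolyX C m) x = (mon m x)%:C.
Proof.
rewrite /evs mpoly.mevalX /mon rmorph_prod; apply: eq_bigr => i _.
by rewrite rmorphXn.
Qed.

Lemma cintegrable_real (f : T -> R) : sigma.-integrable (sphere d) (EFin \o f) ->
  cintegrable sigma (sphere d) (fun x => (f x)%:C).
Proof. by move=> h; split => //; exact: integrable0. Qed.

Lemma cintegrable_evs p : cintegrable sigma (sphere d) (evs p).
Proof.
have mS := @measurable_sphere R d.
apply: (@eq_cintegrable _ _ _ _ _ _ (fun x => \sum_(m <- mpoly.msupp p) mpoly.mcoeff m p * (mon m x)%:C)) => //.
  move=> x _; rewrite [in RHS](mpoly.mpolyE p) evs_sum; apply: eq_bigr => m _.
  by rewrite evsZ evsX.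
apply: cintegrable_sum => // m _; apply: cintegrableZ => //.
by apply: cintegrable_real; exact: integrable_sphere_mon.
Qed.

Lemma sphID p q : sphI (p + q) = sphI p + sphI q.
Proof.
have mS := @measurable_sphere R d; rewrite /sphI.
rewrite -cintegralD//; [|exact: cintegrable_evs|exact: cintegrable_evs].
by apply: eq_cintegral => x _; rewrite evsD.
Qed.

Lemma sphIZ c p : sphI (c *: p) = c * sphI p.
Proof.
have mS := @measurable_sphere R d; rewrite /sphI.
rewrite -cintegralZ//; last exact: cintegrable_evs.
by apply: eq_cintegral => x _; rewrite evsZ.
Qed.

Lemma sphI_sum (I : Type) (s : seq I) (P : pred I) (F : I -> MP) :
  sphI (\sum_(i <- s | P i) F i) = \sum_(i <- s | P i) sphI (F i).
Proof.
apply: (big_morph sphI sphID).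
by rewrite -(scale0r (0 : MP)) sphIZ mul0r.
Qed.

Lemma sphIX (m : mpoly.multinom n) : sphI (mpoly.mpolyX C m) = (sphere_mon (m : 'I_n -> nat))%:C.
Proof.
rewrite /sphI (@eq_cintegral _ _ _ _ _ _ (fun x => (mon m x)%:C)); last by move=> x _; rewrite evsX.
by rewrite /cintegral /= {2}/Rintegral integral0.
Qed.

Lemma eq_sphI p q : (forall x, sphere d x -> evs p x = evs q x) -> sphI p = sphI q.
Proof. exact: eq_cintegral. Qed.

Lemma laplacianX (m : mpoly.multinom n) : laplacian (mpoly.mpolyX C m) =
  \sum_i (m i * (m i).-1)%:R *: mpoly.mpolyX C (mpoly.mnm_sub (mpoly.mnm_sub m (mpoly.mnm1 i)) (mpoly.mnm1 i)).
Proof.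
apply: eq_bigr => i _; rewrite mpoly.mderivX mpoly.mderivZ mpoly.mderivX scalerA.
by rewrite -natrM mpoly.mnmBE mpoly.mnm1E eqxx subn1.
Qed.

Lemma laplacianD p q : laplacian (p + q) = laplacian p + laplacian q.
Proof. by rewrite /laplacian -big_split; apply: eq_bigr => i _; rewrite !mpoly.mderivD. Qed.

Lemma laplacianZ c p : laplacian (c *: p) = c *: laplacian p.
Proof. by rewrite /laplacian scaler_sumr; apply: eq_bigr => i _; rewrite !mpoly.mderivZ. Qed.

Lemma laplacian_sum (I : Type) (s : seq I) (P : pred I) (F : I -> MP) :
  laplacian (\sum_(i <- s | P i) F i) = \sum_(i <- s | P i) laplacian (F i).
Proof.
apply: (big_morph (@laplacian R d) laplacianD).
by rewrite -{1}(scale0r (0 : MP)) laplacianZ scale0r.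
Qed.

Lemma laplacianM p q : laplacian (p * q) =
  laplacian p * q + p * laplacian q + 2 * \sum_i p^`M i * q^`M i.
Proof.
rewrite /laplacian mulr_suml !mulr_sumr -!big_split; apply: eq_bigr => i _ /=.
rewrite !(mpoly.mderivM, mpoly.mderivD) mulr2n mulrDl !mul1r.
have h (V : zmodType) (a b c : V) : a + b + (b + c) = a + c + (b + b).
  by rewrite (addrC b c) addrACA.
exact: h.
Qed.

Lemma sphI_laplacian k p : p \is homog k ->
  sphI (laplacian p) = (k * (k + d).-1)%:R * sphI p.
Proof.
move=> hp; rewrite {1 2}(mpoly.mpolyE p) laplacian_sum !sphI_sum mulr_sumr.
apply: eq_big_seq => m mp; rewrite laplacianZ !sphIZ mulrCA; congr (_ * _).
rewrite laplacianX sphI_sum sphIX.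
have mk : mdegf m = k.
  by rewrite /mdegf -mpoly.mdegE; have := mpoly.dhomog_mf hp mp.
rewrite -[(_ * _)%:R](rmorph_nat (real_complex R)) -rmorphM -mk sphere_mon_rec.
rewrite rmorph_sum; apply: eq_bigr => i _; rewrite sphIZ sphIX.
rewrite -[(_ * _)%:R in LHS](rmorph_nat (real_complex R)) -rmorphM.
congr ((_ * sphere_mon _)%:C); apply/funext => j.
rewrite !mpoly.mnmBE !mpoly.mnm1E /upd eq_sym; case: eqP => [->|_]; lia.
Qed.

End SpherePolynomials.

(** * Orthogonality by degree, and the zonal polynomials as reproducing harmonics *)

Section Harmonics.
Context {R : realType} (d : nat).
Hypothesis hd : (2 <= d)%N.
Local Notation C := R[i].
Local Notation n := d.+1.
Local Notation sigma := (@surface_measure R d).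
Local Notation T := (n.-tuple R).
Local Notation MP := (mpoly.mpoly n C).
Local Notation X_ i := (@mpoly.mpolyX n C (mpoly.mnm1 i)).
Local Notation "p ^`M i" := (mpoly.mderiv i p) (at level 8, i at level 2, format "p ^`M  i").
Local Notation homog k := (mpoly.ishomog1 k (@mpoly.mdeg n)).
Implicit Types (p q K : MP) (x : T).

Lemma mderiv_sum i (I : Type) (s : seq I) (P : pred I) (F : I -> MP) :
  (\sum_(j <- s | P j) F j)^`M i = \sum_(j <- s | P j) (F j)^`M i.
Proof. by rewrite raddf_sum. Qed.

Lemma dhomog_mderiv k p i : p \is homog k -> p^`M i \is homog k.-1.
Proof.
move=> hp; apply/mpoly.dhomogP => m; rewrite mpoly.mcoeff_msupp mpoly.mcoeff_mderiv.
move=> h; have hm : (mpoly.mnm_add m (mpoly.mnm1 i)) \in mpoly.msupp p.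
  by rewrite mpoly.mcoeff_msupp; apply: contraNneq h => ->; rewrite mul0rn.
by have /= := mpoly.dhomog_mf hp hm; rewrite mpoly.mdegD mpoly.mdeg1 addn1 => <-.
Qed.

Lemma dhomog0_const p : p \is homog 0 -> p = mpoly.mpolyC n (mpoly.mcoeff (@mpoly.mnm0 n) p).
Proof.
move=> hp; apply/mpoly.mpolyP => m; rewrite mpoly.mcoeffC.
case: eqVneq => [->|m0]; first by rewrite mulr1.
rewrite mulr0; apply/eqP; rewrite mpoly.mcoeff_eq0; apply/negP => hm.
by have /= /eqP := mpoly.dhomog_mf hp hm; rewrite mpoly.mdeg_eq0 (negbTE m0).
Qed.

Lemma mderiv_homog0 p i : p \is homog 0 -> p^`M i = 0.
Proof. by move=> /dhomog0_const ->; rewrite mpoly.mderivC. Qed.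

Lemma dhomog_sum k (I : Type) (s : seq I) (P : pred I) (F : I -> MP) :
  (forall i, P i -> F i \is homog k) -> \sum_(i <- s | P i) F i \is homog k.
Proof. by move=> hF; apply: rpred_sum. Qed.

Lemma dhomog_laplacian k p : p \is homog k -> laplacian p \is homog k.-2.
Proof. by move=> hp; apply: dhomog_sum => i _; do 2 apply: dhomog_mderiv. Qed.

Lemma laplacian_homog1 k p : (k < 2)%N -> p \is homog k -> laplacian p = 0.
Proof.
move=> k2 hp; apply: big1 => i _; apply: mderiv_homog0.
by have := dhomog_mderiv i hp; case: k k2 {hp} => [|[|]].
Qed.

Lemma laplacian_mderiv p i : laplacian p^`M i = (laplacian p)^`M i.
Proof.
rewrite /laplacian mderiv_sum; apply: eq_bigr => j _.
by rewrite (mpoly.mderiv_comm i j) (mpoly.mderiv_comm i j).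
Qed.

Lemma sphI0 : sphI (0 : MP) = 0.
Proof. by rewrite -(scale0r (0 : MP)) sphIZ mul0r. Qed.

Lemma natC_neq0 k : (0 < k)%N -> (k%:R : C) != 0.
Proof. by move=> k0; rewrite pnatr_eq0 -lt0n. Qed.

Lemma sphI2 p : sphI (2 * p) = 2 * sphI p.
Proof. by rewrite mulr_natl mulr2n sphID mulr_natl mulr2n. Qed.

Lemma sphI_laplacianM k l K q : K \is homog k -> q \is homog l -> laplacian q = 0 ->
  ((k + l) * (k + l + d).-1)%:R * sphI (K * q) =
  sphI (laplacian K * q) + 2 * \sum_i sphI (K^`M i * q^`M i).
Proof.
move=> hK hq Lq; rewrite -(sphI_laplacian (mpoly.dhomogM hK hq)).
by rewrite laplacianM Lq mulr0 addr0 sphID sphI2 sphI_sum.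
Qed.

(** K is an arbitrary homogeneous polynomial. In the Laplacian identity for K q, with q harmonic,
    only (Delta K) q and products of first derivatives remain. There deg K has dropped by 2, or by 1
    along with deg q, so K still has the lower degree and induction on k applies. The factor (k +
    l)(k + l + d - 1) is nonzero as l > 0. *)
Lemma harmonic_orth_lower l k K q : q \is homog l -> laplacian q = 0 ->
  K \is homog k -> (k < l)%N -> sphI (K * q) = 0.
Proof.
elim/ltn_ind : k l K q => k ih l K q hq Lq hK kl.
have c0 : (((k + l) * (k + l + d).-1)%:R : C) != 0 by apply: natC_neq0; nia.
apply: (mulfI c0); rewrite (sphI_laplacianM hK hq Lq) mulr0.
have -> : sphI (laplacian K * q) = 0.
  have [k2|k2] := ltnP k 2.
    by rewrite (laplacian_homog1 k2 hK) mul0r sphI0.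
  by apply: (ih k.-2 _ l) => //; [lia|exact: dhomog_laplacian|lia].
rewrite big1 ?mulr0 ?addr0// => i _.
have [k0|k0] := posnP k.
  rewrite (_ : K^`M i = 0) ?mul0r ?sphI0//.
  by apply: mderiv_homog0; move: hK; rewrite k0.
apply: (ih k.-1 _ l.-1); [lia| | | |lia].
- exact: dhomog_mderiv.
- by rewrite laplacian_mderiv Lq linear0.
- exact: dhomog_mderiv.
Qed.

Lemma euler k p : p \is homog k -> \sum_i X_ i * p^`M i = k%:R *: p.
Proof.
move=> hp; rewrite {2}(mpoly.mpolyE p) scaler_sumr.
under eq_bigr => i _.
  rewrite {1}(mpoly.mpolyE p) mderiv_sum mulr_sumr.
  under eq_bigr => m _ do rewrite mpoly.mderivZ mpoly.mderivX.
  over.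
rewrite exchange_big /=; apply: eq_big_seq => m mp.
have /= <- := mpoly.dhomog_mf hp mp.
rewrite mpoly.mdegE natr_sum scaler_suml; apply: eq_bigr => i _.
rewrite -!scalerAr scalerA mulrC -scalerA.
have [->|mi] := eqVneq (m i) 0%N; first by rewrite !scale0r.
by rewrite -mpoly.mpolyXD mpoly.addmC mpoly.submK ?mpoly.lep1mP.
Qed.

Lemma evs_euler k p x : p \is homog k ->
  \sum_i (tnth x i)%:C * evs p^`M i x = k%:R * evs p x.
Proof.
move=> /euler hp; rewrite -evsZ -hp evs_sum; apply: eq_bigr => i _.
by rewrite evsM evsXU.
Qed.

Lemma gegenbauer_rec (a : R) l (t : R) : l.+2%:R * (gegenbauer a l.+2).[t] =
  2 * (l.+1%:R + a) * t * (gegenbauer a l.+1).[t] - (l%:R + 2 * a) * (gegenbauer a l).[t].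
Proof.
have -> : gegenbauer a l.+2 = (l.+2%:R)^-1 *:
  ((2 * (l.+1%:R + a)) *: ('X * gegenbauer a l.+1) - (l%:R + 2 * a) *: gegenbauer a l) by [].
rewrite hornerZ hornerD hornerN !hornerZ hornerM hornerX mulrA mulfV ?mul1r ?pnatr_eq0//.
by rewrite !mulrA.
Qed.

Section Zonal.
Variable x : T.
Hypothesis Sx : sphere d x.

Definition linx : MP := \sum_i (tnth x i)%:C *: X_ i.

Lemma evs_linx y : evs linx y = (dotp x y)%:C.
Proof.
rewrite evs_sum rmorph_sum; apply: eq_bigr => i _.
by rewrite evsZ evsXU rmorphM.
Qed.

Lemma mderivXU i j : (X_ i)^`M j = (i == j)%:R.
Proof.
rewrite mpoly.mderivX mpoly.mnm1E; case: eqP => [->|_]; last by rewrite scale0r.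
by rewrite scale1r -mpoly.mpolyX0; congr mpoly.mpolyX; apply/mpoly.mnmP => k; rewrite mpoly.mnmBE mpoly.mnm0E subnn.
Qed.

Lemma mderiv_linx i : linx^`M i = ((tnth x i)%:C)%:A.
Proof.
rewrite mderiv_sum (bigD1 i)//= mpoly.mderivZ mderivXU eqxx big1 ?addr0//.
by move=> j ji; rewrite mpoly.mderivZ mderivXU (negbTE ji) scaler0.
Qed.

Lemma linx_homog : linx \is homog 1.
Proof.
by apply: dhomog_sum => i _; apply: mpoly.dhomogZ; rewrite mpoly.dhomogX /= mpoly.mdeg1.
Qed.

Lemma mderiv_linxX i k : (linx ^+ k.+1)^`M i = (k.+1%:R * (tnth x i)%:C) *: linx ^+ k.
Proof.
elim: k => [|k ih]; first by rewrite expr1 expr0 mderiv_linx mul1r.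
rewrite exprS mpoly.mderivM ih mderiv_linx -scalerAl mul1r -scalerAr -exprS.
by rewrite -scalerDl -[in RHS]natr1 mulrDl mul1r addrC.
Qed.

(** Integration against [linx]^l multiplies a harmonic of degree l by this constant ([sphI_linxX]);
    the ratio from l to l + 1 is (l + 1) / (2 l + d + 1). *)
Fixpoint kappa (l : nat) : R :=
  if l is l'.+1 then kappa l' * (l%:R / (2 * l + d).-1%:R) else area d.

Lemma sphI1 : sphI (1 : MP) = (area d)%:C.
Proof.
rewrite -(mpoly.mpolyX0 n C) sphIX /sphere_mon; congr (_%:C).
rewrite (@eq_Rintegral _ _ _ sigma (sphere d) (cst 1)); last by move=> y _; rewrite /mon big1// => i _; rewrite mpoly.mnm0E.
by rewrite Rintegral_cst ?mul1r//; exact: measurable_sphere.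
Qed.

(** In the Laplacian identity the term with the Laplacian of the power of [linx] is orthogonal to q
    by degree. The gradient term consists of a lower power of [linx] against the partial derivatives
    of q, which are harmonic of degree one less; the induction evaluates them at x, and Euler's
    identity collects them into q(x). *)
Lemma sphI_linxX l q : q \is homog l -> laplacian q = 0 ->
  sphI (linx ^+ l * q) = (kappa l)%:C * evs q x.
Proof.
elim: l q => [|l ih] q hq Lq.
  rewrite expr0 mul1r (dhomog0_const hq) -mpoly.alg_mpolyC sphIZ sphI1 evsZ.
  by rewrite /evs mpoly.meval1 mulr1 mulrC.
have c0 : (((l.+1 + l.+1) * (l.+1 + l.+1 + d).-1)%:R : C) != 0 by apply: natC_neq0; nia.
have hl : linx ^+ l.+1 \is homog l.+1.
  by have := mpoly.dhomogMn l.+1 linx_homog; rewrite mul1n.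
apply: (mulfI c0); rewrite (sphI_laplacianM hl hq Lq).
have -> : sphI (laplacian (linx ^+ l.+1) * q) = 0.
  have [k2|k2] := ltnP l.+1 2.
    by rewrite (laplacian_homog1 k2 hl) mul0r sphI0.
  by apply: (harmonic_orth_lower hq Lq (dhomog_laplacian hl)); lia.
rewrite add0r (eq_bigr (fun i => l.+1%:R * (kappa l)%:C * ((tnth x i)%:C * evs q^`M i x))); last first.
  move=> i _; rewrite mderiv_linxX -scalerAl sphIZ ih; first ring.
    exact: dhomog_mderiv hq.
  by rewrite laplacian_mderiv Lq linear0.
rewrite -mulr_sumr (evs_euler _ hq).
have -> : kappa l.+1 = kappa l * (l.+1%:R / (2 * l.+1 + d).-1%:R) by [].
have e0 : ((2 * l.+1 + d).-1%:R : R) != 0 by rewrite pnatr_eq0; lia.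
rewrite (_ : (l.+1 + l.+1 + d).-1 = (2 * l.+1 + d).-1); last lia.
have {}e0 : ((2 * l.+1 + d).-1%:R : C) != 0 by rewrite pnatr_eq0; lia.
rewrite !(rmorphM (real_complex R)) fmorphV !(rmorph_nat (real_complex R)) natrM natrD.
by field.
Qed.

Variable lam : R.
Hypothesis lam2 : 2 * lam = d%:R - 1.

Definition sqsum : MP := \sum_(i < n) X_ i ^+ 2.

Lemma evs_sqsum y : evs sqsum y = (dotp y y)%:C.
Proof.
rewrite evs_sum rmorph_sum; apply: eq_bigr => i _.
by rewrite expr2 evsM evsXU rmorphM.
Qed.

Lemma sqsum_homog : sqsum \is homog 2.
Proof.
apply: dhomog_sum => i _; rewrite mpoly.mpolyXn mpoly.dhomogX /=.
by rewrite mpoly.mdegMn mpoly.mdeg1.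
Qed.

Lemma mderiv_sqsum i : sqsum^`M i = 2 *: X_ i.
Proof.
rewrite mderiv_sum (bigD1 i)//= expr2 mpoly.mderivM mderivXU eqxx big1 ?addr0.
  by rewrite mul1r mulr1 scaler_nat mulr2n.
by move=> j ji; rewrite expr2 mpoly.mderivM mderivXU (negbTE ji) mulr0 mul0r addr0.
Qed.

(* |z|^l G_l(<x, z> / |z|), a polynomial in z *)
Fixpoint solid_gegenbauer (l : nat) : MP :=
  match l with
  | 0 => 1
  | l1.+1 =>
    match l1 with
    | 0 => (2 * lam)%:C *: linx
    | l2.+1 => ((l2.+2%:R : C)^-1) *:
        ((2 * (l2.+1%:R + lam))%:C *: (linx * solid_gegenbauer l1)
         - (l2%:R + 2 * lam)%:C *: (sqsum * solid_gegenbauer l2))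
    end
  end.

Lemma solid_gegenbauerS l : l.+2%:R *: solid_gegenbauer l.+2 =
  (2 * (l.+1%:R + lam))%:C *: (linx * solid_gegenbauer l.+1) -
  (l%:R + 2 * lam)%:C *: (sqsum * solid_gegenbauer l).
Proof. by rewrite [in LHS]/= scalerA mulfV ?scale1r// natC_neq0. Qed.

Lemma solid_gegenbauer_homog l : solid_gegenbauer l \is homog l.
Proof.
elim/ltn_ind : l => -[_|[_|l ih]].
- exact: mpoly.dhomog1.
- by apply: mpoly.dhomogZ; exact: linx_homog.
- apply: mpoly.dhomogZ; apply: mpoly.dhomogD.
    by apply: mpoly.dhomogZ; apply: (mpoly.dhomogM linx_homog); exact: ih.
  rewrite -scaleNr; apply: mpoly.dhomogZ; apply: (mpoly.dhomogM sqsum_homog); exact: ih.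
Qed.

Lemma evs_solid_gegenbauer l y : sphere d y ->
  evs (solid_gegenbauer l) y = ((gegenbauer lam l).[dotp x y])%:C.
Proof.
move=> Sy; elim/ltn_ind : l => -[_|[_|l ih]].
- by rewrite /evs mpoly.meval1 hornerC.
- have -> : gegenbauer lam 1 = (2 * lam) *: 'X by [].
  have -> : solid_gegenbauer 1 = (2 * lam)%:C *: linx by [].
  by rewrite evsZ evs_linx hornerZ hornerX [in RHS]rmorphM.
- apply: (mulfI (natC_neq0 (ltn0Sn l.+1))).
  rewrite -evsZ solid_gegenbauerS -scaleNr evsD !evsZ !evsM evs_linx evs_sqsum !ih//.
  rewrite (sphereE Sy) -[in RHS](rmorph_nat (real_complex R)).
  rewrite -[in RHS](rmorphM (real_complex R)) gegenbauer_rec.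
  rewrite (rmorphB (real_complex R)) !(rmorphM (real_complex R)) rmorph1 mul1r.
  by rewrite mulrA mulNr.
Qed.

Definition dirderiv p : MP := \sum_i (tnth x i)%:C *: p^`M i.

Lemma dirderivD p q : dirderiv (p + q) = dirderiv p + dirderiv q.
Proof. by rewrite /dirderiv -big_split; apply: eq_bigr => i _; rewrite mpoly.mderivD scalerDr. Qed.

Lemma dirderivZ c p : dirderiv (c *: p) = c *: dirderiv p.
Proof.
rewrite /dirderiv scaler_sumr; apply: eq_bigr => i _.
by rewrite mpoly.mderivZ !scalerA mulrC.
Qed.

Lemma dirderivM p q : dirderiv (p * q) = dirderiv p * q + p * dirderiv q.
Proof.
rewrite /dirderiv mulr_suml mulr_sumr -big_split; apply: eq_bigr => i _.
by rewrite mpoly.mderivM scalerDr scalerAl scalerAr.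
Qed.

Lemma dirderiv_linx : dirderiv linx = 1.
Proof.
rewrite /dirderiv; under eq_bigr => i _ do rewrite mderiv_linx scalerA -rmorphM.
by rewrite -scaler_suml -rmorph_sum -/(dotp x x) sphereE// scale1r.
Qed.

Lemma dirderiv_sqsum : dirderiv sqsum = 2 *: linx.
Proof.
rewrite /dirderiv /linx scaler_sumr; apply: eq_bigr => i _.
by rewrite mderiv_sqsum !scalerA mulrC.
Qed.

Ltac ring_real_complex := rewrite ?(rmorph_nat (real_complex R), rmorphB (real_complex R),
  rmorphD (real_complex R), rmorphM (real_complex R), rmorph0 (real_complex R),
  rmorph1 (real_complex R)); ring.

(** The linear algebra behind the induction step of [dirderiv_gegenbauer], kept abstract so that
    only scalar identities remain. A is a solid polynomial, B is [linx] times its predecessor, and D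
    is [sqsum] times the one before. *)
Let recurrence_aux (V : lmodType C) (A B D : V) (a b s v : C) :
  s *: A = (a - 2) *: B - v *: D ->
  a *: (A + b *: B) - b *: (2 *: B + v *: D) = (a + b * s) *: A.
Proof.
move=> h; rewrite [RHS]scalerDl -[in RHS]scalerA h scalerBr !scalerDr opprD !scalerA.
rewrite -addrA; congr (_ + _); rewrite addrA -scalerBl; congr (_ *: _ - _).
ring.
Qed.

(** Differentiate the three-term recurrence along x, where [linx] has derivative 1 and [sqsum] has
    derivative 2 [linx]; the claim in lower degrees then lets the recurrence close up again. This
    feeds harmonicity, as [linx] p has Laplacian 2 [dirderiv] p for harmonic p. *)
Lemma dirderiv_gegenbauer l : dirderiv (solid_gegenbauer l.+1) =
  (l%:R + 2 * lam)%:C *: solid_gegenbauer l.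
Proof.
elim/ltn_ind : l => -[_|l ih].
  by rewrite dirderivZ dirderiv_linx add0r.
have e2 : (l.+2%:R : C) != 0 by exact: natC_neq0.
apply: (scalerI e2); rewrite -dirderivZ solid_gegenbauerS.
rewrite -scaleNr dirderivD !dirderivZ !dirderivM dirderiv_linx dirderiv_sqsum mul1r ih//.
rewrite scaleNr.
(* For l = 0 the polynomial multiplied by [sqsum] is constant and has derivative 0, so the auxiliary
   identity is used with D = 0. *)
case: l ih e2 => [|l] ih e2.
  have -> : dirderiv (solid_gegenbauer 0) = 0.
    by rewrite /dirderiv big1// => i _; rewrite mpoly.mderivC scaler0.
  have := @recurrence_aux MP (solid_gegenbauer 1) linx 0 (2 * (1 + lam))%:C
    (0 + 2 * lam)%:C 1 0.
  rewrite !scaler0 !mulr1 mulr0 -scalerAr mulr1 => ->.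
    move: (solid_gegenbauer 1) => u; rewrite scalerA; congr (_ *: u).
    ring_real_complex.
  rewrite scale1r subr0 [solid_gegenbauer 1]/=; congr (_ *: linx).
  ring_real_complex.
rewrite ih// -!scalerAr -!scalerAl.
have -> := @recurrence_aux MP (solid_gegenbauer l.+2) (linx * solid_gegenbauer l.+1)
  (sqsum * solid_gegenbauer l) (2 * (l.+2%:R + lam))%:C (l.+1%:R + 2 * lam)%:C
  l.+2%:R (l%:R + 2 * lam)%:C; last first.
  rewrite solid_gegenbauerS; congr (_ *: (linx * _) - _).
  ring_real_complex.
move: (solid_gegenbauer l.+2) => u; rewrite scalerA; congr (_ *: u).
ring_real_complex.
Qed.

Lemma laplacian_linxM p : laplacian (linx * p) = 2 *: dirderiv p + linx * laplacian p.
Proof.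
rewrite laplacianM (laplacian_homog1 (ltnSn 1) linx_homog) mul0r add0r addrC.
congr (_ + _); rewrite mulr_natl -scaler_nat; congr (_ *: _); apply: eq_bigr => i _.
by rewrite mderiv_linx -scalerAl mul1r.
Qed.

Lemma laplacian_sqsumM k q : q \is homog k ->
  laplacian (sqsum * q) = (2 * n%:R + 4 * k%:R) *: q + sqsum * laplacian q.
Proof.
move=> hq; rewrite laplacianM [LHS]addrAC; congr (_ + _).
have -> : laplacian sqsum = (2 * n%:R) *: 1.
  rewrite /laplacian (eq_bigr (fun=> 2 *: 1)).
    by rewrite sumr_const card_ord -[LHS]scaler_nat scalerA mulrC.
  by move=> i _; rewrite mderiv_sqsum mpoly.mderivZ mderivXU eqxx.
rewrite -scalerAl mul1r scalerDl; congr (_ + _).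
rewrite (eq_bigr (fun i => 2 *: (X_ i * q^`M i))).
  rewrite -scaler_sumr (euler hq) mulr_natl -[LHS]scaler_nat !scalerA.
  by congr (_ *: q); ring.
by move=> i _; rewrite mderiv_sqsum scalerAl.
Qed.

Let laplacian_aux (V : lmodType C) (A : V) (a b c : C) : a * (2 * b) = b * c ->
  a *: (2 *: (b *: A)) - b *: (c *: A) = 0.
Proof. by move=> h; rewrite !scalerA -scalerBl -h mulrA subrr scale0r. Qed.

(** Applied to the recurrence, the Laplacian leaves two multiples of the polynomial of degree l,
    with factors 2 (l + 1 + lam) 2 (l + 2 lam) and (l + 2 lam)(2 n + 4 l). They cancel because n = 2
    lam + 2: here the parameter is tied to the dimension. *)
Lemma laplacian_gegenbauer l : laplacian (solid_gegenbauer l) = 0.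
Proof.
elim/ltn_ind : l => -[_|[_|l ih]].
- exact: (laplacian_homog1 (ltn0Sn 1) (solid_gegenbauer_homog 0)).
- exact: (laplacian_homog1 (ltnSn 1) (solid_gegenbauer_homog 1)).
- apply: (scalerI (natC_neq0 (ltn0Sn l.+1))); rewrite scaler0 -laplacianZ.
  rewrite solid_gegenbauerS -scaleNr laplacianD !laplacianZ laplacian_linxM.
  rewrite (laplacian_sqsumM (solid_gegenbauer_homog l)) !ih// !mulr0 !addr0.
  rewrite dirderiv_gegenbauer scaleNr; apply: laplacian_aux.
  have e : n%:R = (2 * lam + 2)%:C.
    rewrite lam2 -(rmorph_nat (real_complex R)); apply: (congr1 (real_complex R)).
    by rewrite -natr1; ring.
  rewrite e; ring_real_complex.
Qed.

(** The leading coefficient of [gegenbauer lam l]. *)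
Fixpoint gegenbauer_lead (l : nat) : R :=
  if l is l'.+1 then 2 * (l'%:R + lam) / l%:R * gegenbauer_lead l' else 1.

Let mul_combination (V : algType C) (A B D q : V) (a b : C) :
  A * (a *: B - b *: D) * q = a *: (A * B * q) + (- b) *: (A * D * q).
Proof. by rewrite mulrBr mulrBl -!scalerAr -!scalerAl scaleNr. Qed.

(** On the sphere [sqsum] is 1, so the second term of the recurrence has degree below that of q and
    integrates to 0; only the top power of [linx] survives. The extra power [linx]^i absorbs the
    factor [linx] that each recurrence step produces. *)
Lemma sphI_linxX_gegenbauer l i q : q \is homog (i + l) -> laplacian q = 0 ->
  sphI (linx ^+ i * solid_gegenbauer l * q) =
  (gegenbauer_lead l)%:C * sphI (linx ^+ (i + l) * q).
Proof.
elim/ltn_ind : l i q => -[_ i q|[_ i q|l ih i q]] hq Lq.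
- by rewrite mulr1 addn0 mul1r.
- rewrite /= add0r divr1 mulr1 -scalerAr -scalerAl sphIZ -exprSr addn1//.
- have e2 := natC_neq0 (ltn0Sn l.+1); apply: (mulfI e2).
  have -> : l.+2%:R * sphI (linx ^+ i * solid_gegenbauer l.+2 * q) =
      sphI (linx ^+ i * (l.+2%:R *: solid_gegenbauer l.+2) * q).
    by move: (solid_gegenbauer l.+2) => u; rewrite -scalerAr -scalerAl sphIZ.
  rewrite solid_gegenbauerS mul_combination sphID !sphIZ.
  have -> : sphI (linx ^+ i * (sqsum * solid_gegenbauer l) * q) = 0.
    rewrite (@eq_sphI _ _ _ (linx ^+ i * solid_gegenbauer l * q)); last first.
      by move=> y Sy; rewrite !evsM evs_sqsum sphereE// mul1r.
    apply: (harmonic_orth_lower hq Lq (k := (i + l)%N)); last by lia.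
    apply: mpoly.dhomogM (solid_gegenbauer_homog l).
    by have := mpoly.dhomogMn i linx_homog; rewrite mul1n.
  have -> : sphI (linx ^+ i * (linx * solid_gegenbauer l.+1) * q) =
      (gegenbauer_lead l.+1)%:C * sphI (linx ^+ (i + l.+2) * q).
    have hq' : q \is homog (i.+1 + l.+1) by rewrite addSnnS.
    have := ih l.+1 (ltnSn _) i.+1 q hq' Lq; rewrite addSnnS.
    move: (solid_gegenbauer l.+1) => u.
    by rewrite (exprSr linx i) -(mulrA (linx ^+ i) linx u).
  rewrite mulr0 addr0 !mulrA; move: (sphI _) => I; congr (_ * I).
  rewrite -(rmorph_nat (real_complex R)) -!(rmorphM (real_complex R)).
  apply: (congr1 (real_complex R)).
  have -> : gegenbauer_lead l.+2 =
    2 * (l.+1%:R + lam) / l.+2%:R * gegenbauer_lead l.+1 by [].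
  have w0 : (l.+2%:R : R) != 0 by rewrite pnatr_eq0.
  by move: (gegenbauer_lead l.+1) (l.+2%:R) w0 => g w w0; field.
Qed.

Lemma sphI_gegenbauer l q : q \is homog l -> laplacian q = 0 ->
  sphI (solid_gegenbauer l * q) = (gegenbauer_lead l * kappa l)%:C * evs q x.
Proof.
move=> hq Lq; have := @sphI_linxX_gegenbauer l 0 q; rewrite add0n expr0 mul1r => ->//.
by rewrite sphI_linxX// mulrA -rmorphM.
Qed.

Lemma sphI_gegenbauer_orth k l q : q \is homog k -> laplacian q = 0 -> k != l ->
  sphI (solid_gegenbauer l * q) = 0.
Proof.
move=> hq Lq; rewrite neq_ltn => /orP[kl|lk].
  rewrite mulrC; exact: harmonic_orth_lower (solid_gegenbauer_homog l) (laplacian_gegenbauer l) hq kl.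
exact: harmonic_orth_lower hq Lq (solid_gegenbauer_homog l) lk.
Qed.

End Zonal.

(** Since 2 lam = d - 1, the denominator in [kappa] is 2 (l + 1 + lam), and the product telescopes
    with ratio (l + lam) / (l + 1 + lam). *)
Lemma gegenbauer_lead_kappa (lam : R) l : 0 < lam -> 2 * lam = d%:R - 1 ->
  gegenbauer_lead lam l * kappa l = area d * lam / (l%:R + lam).
Proof.
move=> l0 lam2; elim: l => [|l ih]; first by rewrite add0r mul1r mulfK// gt_eqF.
have p0 (k : nat) : k%:R + lam != 0 by rewrite gt_eqF// ltr_wpDl.
have w0 : (l.+1%:R : R) != 0 by rewrite pnatr_eq0.
have -> : gegenbauer_lead lam l.+1 * kappa l.+1 = (gegenbauer_lead lam l * kappa l) *
   (2 * (l%:R + lam) / (2 * l.+1 + d).-1%:R).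
  have -> : kappa l.+1 = kappa l * (l.+1%:R / (2 * l.+1 + d).-1%:R) by [].
  have -> : gegenbauer_lead lam l.+1 = 2 * (l%:R + lam) / l.+1%:R * gegenbauer_lead lam l by [].
  have v0 : ((2 * l.+1 + d).-1%:R : R) != 0 by rewrite pnatr_eq0; lia.
  move: (l.+1%:R) ((2 * l.+1 + d).-1%:R) w0 v0 => w v w0 v0.
  by field; rewrite ?w0 ?v0.
rewrite ih; have -> : (2 * l.+1 + d).-1%:R = 2 * (l.+1%:R + lam) :> R.
  by rewrite mulrDr lam2 -subn1 natrB ?natrD ?natrM; [ring|lia].
have := p0 l; have := p0 l.+1; move: (l.+1%:R + lam) (l%:R + lam) => u v u0 v0.
by field; rewrite ?u0 ?v0.
Qed.
End Harmonics.

(** * Addition theorem and comparison with the value at 1 *)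

Section AdditionTheorem.
Context {R : realType} (d : nat).
Hypothesis hd : (2 <= d)%N.
Local Notation C := R[i].
Local Notation n := d.+1.
Local Notation sigma := (@surface_measure R d).
Local Notation T := (n.-tuple R).
Local Notation lam := (@eta R d).

Lemma eta_gt0 : 0 < lam.
Proof. by rewrite divr_gt0// subr_gt0 ltr1n. Qed.

Lemma eta2 : 2 * lam = d%:R - 1.
Proof. by rewrite /eta; field. Qed.

Lemma conjcM (z w : C) : conjc (z * w) = conjc z * conjc w.
Proof. by rewrite rmorphM. Qed.

Lemma evs_conj (p : mpoly.mpoly n C) (x : T) :
  evs (mpoly.map_mpoly (@conjc R) p) x = conjc (evs p x).
Proof.
rewrite [in RHS](mpoly.mpolyE p) {1}(mpoly.mpolyE p) raddf_sum !evs_sum rmorph_sum.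
apply: eq_bigr => m _.
rewrite /= mpoly.map_mpolyZ mpoly.map_mpolyX !evsZ !evsX rmorphM.
by congr (_ * _); rewrite /= oppr0.
Qed.

Lemma cintegral_conj (X : T -> C) : cintegrable sigma (sphere d) X ->
  cintegral sigma (sphere d) (fun z => conjc (X z)) = conjc (cintegral sigma (sphere d) X).
Proof.
move=> [_ iX]; have mS := @measurable_sphere R d.
rewrite /cintegral /=; congr (_ +i* _).
  by apply: eq_Rintegral => z _; case: (X z).
rewrite -mulN1r -RintegralZl//; apply: eq_Rintegral => z _.
by rewrite mulN1r; case: (X z).
Qed.

Definition reproducing_const l : R := area d * lam / (l%:R + lam).

Lemma reproducing_const_gt0 l : 0 < reproducing_const l.
Proof.
apply: divr_gt0; first by apply: mulr_gt0; [exact: area_gt0|exact: eta_gt0].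
by apply: ltr_wpDl; [exact: ler0n|exact: eta_gt0].
Qed.

Lemma harmonic_reproducing l k (h : T -> C) x : spherical_harmonic l h ->
  sphere d x ->
  cintegral sigma (sphere d) (fun z => h z * ((gegenbauer lam k).[dotp x z])%:C) =
  if l == k then (reproducing_const l)%:C * h x else 0.
Proof.
move=> [p [hp Lp hE]] Sx.
have -> : cintegral sigma (sphere d) (fun z => h z * ((gegenbauer lam k).[dotp x z])%:C) =
    sphI (solid_gegenbauer x lam k * p).
  apply: eq_cintegral => z Sz; rewrite evsM evs_solid_gegenbauer// mulrC.
  by rewrite hE.
case: eqVneq => [<-|lk].
  rewrite (sphI_gegenbauer hd _ _ hp Lp) (gegenbauer_lead_kappa hd l eta_gt0 eta2).
  by rewrite hE.
exact: (sphI_gegenbauer_orth hd Sx eta2 hp Lp lk).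
Qed.

Lemma gegenbauer_harmonic l x : sphere d x ->
  spherical_harmonic l (fun z : T => ((gegenbauer lam l).[dotp x z])%:C).
Proof.
move=> Sx; exists (solid_gegenbauer x lam l); split.
- exact: solid_gegenbauer_homog.
- exact: (laplacian_gegenbauer Sx eta2).
- by move=> z Sz; rewrite -evs_solid_gegenbauer.
Qed.

Lemma spherical_harmonic_evs l (h : T -> C) : spherical_harmonic l h ->
  exists p, forall x, sphere d x -> h x = evs p x.
Proof. by move=> [p [_ _ hE]]; exists p. Qed.

Lemma cintegrable_harmonicM l k (g h : T -> C) : spherical_harmonic l g ->
  spherical_harmonic k h -> cintegrable sigma (sphere d) (fun z => g z * h z).
Proof.
move=> /spherical_harmonic_evs[p pE] /spherical_harmonic_evs[q qE].
apply: (eq_cintegrable (@measurable_sphere R d) _ (cintegrable_evs (p * q))).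
by move=> x Sx; rewrite evsM pE// qE.
Qed.

Lemma cintegrable_harmonicMconj l k (g h : T -> C) : spherical_harmonic l g ->
  spherical_harmonic k h -> cintegrable sigma (sphere d) (fun z => g z * conjc (h z)).
Proof.
move=> /spherical_harmonic_evs[p pE] /spherical_harmonic_evs[q qE].
apply: (eq_cintegrable (@measurable_sphere R d) _ (cintegrable_evs (p * mpoly.map_mpoly (@conjc R) q))).
by move=> x Sx; rewrite evsM pE// qE// evs_conj.
Qed.

Variables (N : nat -> nat) (Y : nat -> nat -> T -> C).
Hypothesis hY : orthonormal_harmonics N Y.

(** The function z |-> G_l(<y, z>) is a harmonic of degree l, hence a combination of the [Y l m].
    Orthonormality extracts its coefficients, and the reproducing property evaluates each as a
    constant times the conjugate of [Y l m y]. *)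
Lemma addition_theorem l x y : sphere d x -> sphere d y ->
  (reproducing_const l)%:C * \sum_(m < N l) Y l m x * conjc (Y l m y) =
  ((gegenbauer lam l).[dotp x y])%:C.
Proof.
move=> Sx Sy; have mS := @measurable_sphere R d.
have hG := gegenbauer_harmonic l Sy.
have [c cE] := onh_span hY hG.
rewrite dotpC (cE x Sx) mulr_sumr; apply: eq_bigr => m _.
have hm := onh_harmonic hY (ltn_ord m).
rewrite (mulrC (Y l m x)) mulrA; congr (_ * _).
have e1 := harmonic_reproducing l hm Sy; rewrite eqxx in e1.
have <- : cintegral sigma (sphere d) (fun z => ((gegenbauer lam l).[dotp y z])%:C * conjc (Y l m z)) = c m.
  rewrite (@eq_cintegral _ _ _ _ _ _ (fun z => \sum_(k < N l) c k * (Y l k z * conjc (Y l m z)))); last first.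
    by move=> z Sz; rewrite cE// mulr_suml; apply: eq_bigr => k _; rewrite mulrA.
  rewrite cintegral_sum//; last first.
    move=> k _; apply: cintegrableZ => //.
    by apply: cintegrable_harmonicMconj hm; exact: (onh_harmonic hY (ltn_ord k)).
  rewrite (bigD1 m)//= cintegralZ//; last exact: (cintegrable_harmonicMconj hm hm).
  rewrite (onh_orthonormal hY)// eqxx mulr1 big1 ?addr0// => k km.
  rewrite cintegralZ//; last first.
    by apply: cintegrable_harmonicMconj hm; exact: (onh_harmonic hY (ltn_ord k)).
  by rewrite (onh_orthonormal hY)// -val_eqE in km *; rewrite (negbTE km) mulr0.
have := congr1 conjc e1; rewrite -cintegral_conj; last exact: (cintegrable_harmonicM hm hG).
rewrite conjcM conjc_real => <-.
apply: eq_cintegral => z _.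
by rewrite conjcM conjc_real mulrC.
Qed.

(** The sum of |Y_(l,m)|^2 is the same at all points, namely G_l(1) up to a positive factor. The
    inequality 2 |Re (z conj w)| <= |z|^2 + |w|^2, summed over m, then bounds the off-diagonal value
    by the diagonal one. *)
Lemma gegenbauer_le1 l x y : sphere d x -> sphere d y ->
  `|(gegenbauer lam l).[dotp x y]| <= (gegenbauer lam l).[1].
Proof.
move=> Sx Sy; have k0 := reproducing_const_gt0 l.
pose c := reproducing_const l.
have sq z : sphere d z -> (gegenbauer lam l).[1] = c * \sum_(m < N l) sqrnormc (Y l m z).
  move=> Sz; have := addition_theorem l Sz Sz; rewrite sphereE// => e.
  apply: (@complexI R); rewrite -e (rmorphM (real_complex R) c) (rmorph_sum (real_complex R)); congr (_ * _).
  apply: eq_bigr => m _; rewrite /sqrnormc; case: (Y l m z) => a b /=.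
  by apply/eqP; rewrite eq_complex /=; apply/andP; split; apply/eqP; ring.
have e := addition_theorem l Sx Sy.
have {}e : (gegenbauer lam l).[dotp x y] = c * \sum_(m < N l) complex.Re (Y l m x * conjc (Y l m y)).
  have := congr1 (@complex.Re R) e; rewrite cReM /= mul0r subr0 => <-; congr (_ * _).
  by rewrite (big_morph (@complex.Re R) (@cReD R) (erefl : complex.Re 0 = 0)).
have b1 : 2 * `|\sum_(m < N l) complex.Re (Y l m x * conjc (Y l m y))| <=
    \sum_(m < N l) sqrnormc (Y l m x) + \sum_(m < N l) sqrnormc (Y l m y).
  rewrite -big_split /= (le_trans (ler_wpM2l _ (ler_norm_sum _ _ _)))//.
  rewrite mulr_sumr; apply: ler_sum => m _; rewrite /sqrnormc.
  case: (Y l m x) => a b; case: (Y l m y) => a' b' /=.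
  have h1 := sqr_ge0 (a - a'); have h2 := sqr_ge0 (b - b').
  have h3 := sqr_ge0 (a + a'); have h4 := sqr_ge0 (b + b').
  rewrite -[2]gtr0_norm// -normrM ler_norml.
  by rewrite sqrrB sqrrD in h1 h3; rewrite !(sqrrB, sqrrD) in h1 h2 h3 h4 *; apply/andP; split; lra.
rewrite e normrM gtr0_norm// -(ler_pM2l (ltr0n R 2)).
have := sq x Sx; have := sq y Sy => ey ex.
rewrite mulrCA [leRHS](_ : _ = c * (\sum_(m < N l) sqrnormc (Y l m x) + \sum_(m < N l) sqrnormc (Y l m y))).
  by rewrite ler_pM2l.
by rewrite mulrDr -ex -ey mulr_natl mulr2n.
Qed.

End AdditionTheorem.

(** * Covariance of the needlet coefficients *)

Section AlmostSureIdentification.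
Context {R : realType} {dO dT : measure_display}.
Context {Omega : measurableType dO} {T : measurableType dT}.
Variables (P : probability Omega R) (sigma : {finite_measure set T -> \bar R}).
Variable (D : set T).
Hypothesis mD : measurable D.

(** Positive and negative parts are treated separately by Tonelli, since for an individual w the
    function u(w, .) may fail to be integrable. *)
Lemma measurable_Rintegral_param (u : Omega * T -> R) : measurable_fun setT u ->
  measurable_fun setT (fun w => \int[sigma]_(y in D) u (w, y)).
Proof.
move=> mu; pose U (p : Omega * T) : \bar R := ((EFin \o u) \_ (setT `*` D)) p.
have mU : measurable_fun setT U.
  apply: (proj1 (measurable_restrictT _ (measurableX measurableT mD))).
  by apply: measurable_funTS; exact/measurable_EFinP.
have -> : (fun w => \int[sigma]_(y in D) u (w, y)) =
   (fun w => fine (\int[sigma]_y U^\+ (w, y) - \int[sigma]_y U^\- (w, y))%E).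
  apply/funext => w; rewrite /Rintegral integral_mkcond; congr fine.
  rewrite integralE; congr (_ - _)%E; apply: eq_integral => y _.
    rewrite !funeposE; congr (Order.max _ _); rewrite /U /patch !in_setX in_setT/=.
    by case: ifP.
  rewrite !funenegE; congr (Order.max (- _)%E _); rewrite /U /patch !in_setX in_setT/=.
  by case: ifP.
apply: measurableT_comp; first exact: fine_measurable.
apply: emeasurable_funB.
  apply: (measurable_fun_fubini_tonelli_F (m2 := sigma) (fun p => U^\+ p)%E) => //.
  exact: measurable_funepos.
apply: (measurable_fun_fubini_tonelli_F (m2 := sigma) (fun p => U^\- p)%E) => //.
exact: measurable_funeneg.
Qed.

Lemma measurable_integral_param (u : Omega * T -> R) : measurable_fun setT u ->
  (forall p, 0 <= u p) ->
  measurable_fun setT (fun w => \int[sigma]_(y in D) (u (w, y))%:E)%E.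
Proof.
move=> mu u0; pose U (p : Omega * T) : \bar R := ((EFin \o u) \_ (setT `*` D)) p.
have mU : measurable_fun setT U.
  apply: (proj1 (measurable_restrictT _ (measurableX measurableT mD))).
  by apply: measurable_funTS; exact/measurable_EFinP.
have U0 p : (0 <= U p)%E by rewrite /U /patch; case: ifP => // _; rewrite lee_fin.
have -> : (fun w => \int[sigma]_(y in D) (u (w, y))%:E)%E = (fun w => \int[sigma]_y U (w, y))%E.
  apply/funext => w; rewrite integral_mkcond; apply: eq_integral => y _.
  by rewrite /U /patch !in_setX in_setT.
exact: (measurable_fun_fubini_tonelli_F (m2 := sigma) U).
Qed.

Variables (u : Omega * T -> R) (h : T -> R) (H : R) (B : Omega -> R).
Hypotheses (mu : measurable_fun setT u) (mh : measurable_fun setT h).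
Hypotheses (hH : forall y, D y -> `|h y| <= H) (mB : measurable_fun setT B).
Let beta w := \int[sigma]_(y in D) (u (w, y) * h y).

(* |r h| <= H (e + r^2 / e) pointwise, whether or not r^2 is integrable *)
Lemma abs_sub_le_L2 (v : Omega * T -> R) w (e : R) : 0 < e -> 0 < H ->
  measurable_fun setT v ->
  sigma.-integrable D (EFin \o (fun y => v (w, y) * h y)) ->
  \int[sigma]_(y in D) (v (w, y) * h y) = B w ->
  (`|beta w - B w|%:E <= (H * e)%:E * sigma D + (H * e^-1)%:E *
     \int[sigma]_(y in D) (((u (w, y) - v (w, y)) ^+ 2)%:E))%E.
Proof.
move=> e0 H0 mv iv Bv; have He : 0 < H * e^-1 by rewrite mulr_gt0// invr_gt0.
pose r y := u (w, y) - v (w, y).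
have mr : measurable_fun setT r.
  apply: measurable_funB; [exact: (measurableT_comp mu (pair1_measurable w))|exact: (measurableT_comp mv (pair1_measurable w))].
have mr2 : measurable_fun D (EFin \o (fun y => r y ^+ 2)).
  by apply/measurable_EFinP; apply: measurable_funTS; exact: measurable_funX.
have [r2oo|r2fin] := eqVneq (\int[sigma]_(y in D) ((r y) ^+ 2)%:E)%E +oo%E.
  rewrite r2oo gt0_muley ?lte_fin// addey ?leey//.
  by rewrite gt_eqF// (lt_le_trans (ltNyr 0))// mule_ge0// lee_fin mulr_ge0// ltW.
have ir2 : sigma.-integrable D (EFin \o (fun y => r y ^+ 2)).
  apply/integrableP; split => //.
  under eq_integral => y _ do rewrite /= ger0_norm ?sqr_ge0//.
  by rewrite ltey.
have ib : sigma.-integrable D (EFin \o (fun y => H * e + H * e^-1 * r y ^+ 2)).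
  have i1 : sigma.-integrable D (EFin \o cst (H * e)).
    exact: finite_measure_integrable_cst.
  exact: (integrableD mD i1 (integrableZl mD (H * e^-1) ir2)).
have rb y : D y -> `|r y * h y| <= H * e + H * e^-1 * r y ^+ 2.
  move=> Dy; rewrite normrM (le_trans (ler_wpM2l (normr_ge0 _) (hH Dy)))//.
  rewrite -(real_normK (num_real (r y))); set a := `|r y|.
  have key : a <= e + e^-1 * a ^+ 2.
    rewrite -subr_ge0 (_ : _ - a = (e ^+ 2 + a ^+ 2 - a * e) / e); last by field; rewrite gt_eqF.
    rewrite divr_ge0 ?(ltW e0)//; have := sqr_ge0 (a - e); have := sqr_ge0 a; have := sqr_ge0 e.
    by rewrite sqrrB; lra.
  by rewrite -mulrA -mulrDr mulrC ler_pM2l.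
have ir : sigma.-integrable D (EFin \o (fun y => r y * h y)).
  apply: (le_integrable mD _ _ ib).
    apply/measurable_EFinP; apply: measurable_funTS; exact: measurable_funM.
  move=> y Dy; rewrite lee_fin (le_trans (rb y Dy))// ler_norm//.
have -> : beta w - B w = \int[sigma]_(y in D) (r y * h y).
  rewrite -Bv /beta.
  have -> : \int[sigma]_(y in D) (u (w, y) * h y) =
            \int[sigma]_(y in D) (r y * h y + v (w, y) * h y).
    by apply: eq_Rintegral => y _; rewrite -mulrDl subrK.
  by rewrite RintegralD// addrK.
have h1 : (`|\int[sigma]_(y in D) (r y * h y)| <= \int[sigma]_(y in D) (H * e + H * e^-1 * r y ^+ 2))%R.
  apply: le_trans (le_normr_Rintegral mD ir) _; apply: le_Rintegral => //.
  exact: integrable_norm ir.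
rewrite (le_trans (_ : _ <= (\int[sigma]_(y in D) (H * e + H * e^-1 * r y ^+ 2))%:E)%E) ?lee_fin//.
rewrite /Rintegral fineK ?integrable_fin_num//.
under eq_integral => y _ do rewrite EFinD.
rewrite integralD//; last 2 first.
- exact: finite_measure_integrable_cst.
- by have := integrableZl mD (H * e^-1) ir2.
rewrite (integral_cst sigma mD (H * e)%:E) leeD2l//.
under eq_integral => y _ do rewrite EFinM.
by rewrite integralZl.
Qed.

(** The pointwise bound [abs_sub_le_L2] is integrated over w for fixed e; L -> oo removes its L^2
    term, then e -> 0 the other one, so beta - B has L^1 norm 0. Integrated against h, every v L
    with L >= L0 gives the same B. *)
Lemma ae_eq_approximation (v : nat -> Omega * T -> R) (L0 : nat) (E : nat -> \bar R) :
  0 < H ->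
  (forall L, measurable_fun setT (v L)) ->
  (forall L w, (L0 <= L)%N -> sigma.-integrable D (EFin \o (fun y => v L (w, y) * h y))) ->
  (forall L w, (L0 <= L)%N -> \int[sigma]_(y in D) (v L (w, y) * h y) = B w) ->
  (forall L, (\int[P]_w \int[sigma]_(y in D) ((u (w, y) - v L (w, y)) ^+ 2)%:E <= E L)%E) ->
  E @ \oo --> 0%E ->
  measurable_fun setT beta /\ ae_eq P setT (EFin \o beta) (EFin \o B).
Proof.
move=> H0 mv iv Bv hE E0.
have mbeta : measurable_fun setT beta.
  apply: (measurable_Rintegral_param (u := fun p => u p * h p.2)).
  by apply: measurable_funM => //; exact: measurableT_comp.
split => //.
have md : measurable_fun setT (fun w => beta w - B w) by exact: measurable_funB.
have mad : measurable_fun setT (fun w => `|beta w - B w|%:E).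
  by apply/measurable_EFinP; exact: measurableT_comp.
have sfin : sigma D \is a fin_num by exact: fin_num_measure.
have bound (e : R) L : 0 < e -> (L0 <= L)%N ->
    (\int[P]_w `|beta w - B w|%:E <= (H * e)%:E * sigma D + (H * e^-1)%:E * E L)%E.
  move=> e0 LL.
  have He : 0 < H * e^-1 by rewrite mulr_gt0// invr_gt0.
  have mI : measurable_fun setT (fun w => \int[sigma]_(y in D) ((u (w, y) - v L (w, y)) ^+ 2)%:E)%E.
    apply: (measurable_integral_param (u := fun p => (u p - v L p) ^+ 2)).
      by apply: measurable_funX; exact: measurable_funB.
    by move=> p; exact: sqr_ge0.
  have I0 w : (0 <= \int[sigma]_(y in D) ((u (w, y) - v L (w, y)) ^+ 2)%:E)%E.
    by apply: integral_ge0 => y _; rewrite lee_fin sqr_ge0.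
  have c0 : (0 <= (H * e)%:E * sigma D)%E by rewrite mule_ge0// lee_fin mulr_ge0// ltW.
  apply: (@le_trans _ _ (\int[P]_w ((H * e)%:E * sigma D + (H * e^-1)%:E *
     \int[sigma]_(y in D) (((u (w, y) - v L (w, y)) ^+ 2)%:E)))%E).
    apply: ge0_le_integral => //.
    - apply: emeasurable_funD; first exact: measurable_cst.
      by apply: emeasurable_funM => //; exact: measurable_cst.
    - move=> w _; apply: abs_sub_le_L2 => //; [exact: iv|exact: Bv].
  rewrite ge0_integralD//; last 2 first.
  - by move=> w _; rewrite mule_ge0// lee_fin ltW.
  - by apply: emeasurable_funM => //; exact: measurable_cst.
  have ic : (\int[P]_w ((H * e)%:E * sigma D) = (H * e)%:E * sigma D)%E.
    apply: (etrans (integral_cst P measurableT ((H * e)%:E * sigma D)%E)).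
    exact: (etrans (congr1 (fun c => (H * e)%:E * sigma D * c)%E (probability_setT P)) (mule1 _)).
  rewrite ic leeD2l//.
  rewrite ge0_integralZl//; last by rewrite lee_fin ltW.
  by rewrite lee_pmul2l// lte_fin.
have bound2 (e : R) : 0 < e -> (\int[P]_w `|beta w - B w|%:E <= (H * e)%:E * sigma D)%E.
  move=> e0.
  have cv : ((fun L => (H * e)%:E * sigma D + (H * e^-1)%:E * E L) @ \oo -->
     (H * e)%:E * sigma D + (H * e^-1)%:E * 0)%E.
    apply: cvgeD; [|exact: cvg_cst|by apply: cvgeZl].
    by rewrite mule0 fin_num_adde_defl.
  rewrite -[leRHS]adde0 -[X in (_ + X)%E](mule0 (H * e^-1)%:E).
  apply: (cvge_ge _ cv); near=> L; apply: bound => //; near: L; exact: nbhs_infty_ge.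
have int0 : (\int[P]_w `|beta w - B w|%:E = 0)%E.
  apply/eqP; rewrite eq_le integral_ge0 ?andbT//.
  apply/lee_addgt0Pr => e e0; rewrite add0e.
  (* The summand 1 keeps the choice of e valid when D has measure 0. *)
  have s1 : 0 < fine (sigma D) + 1 by rewrite ltr_wpDl// fine_ge0.
  have e1 : 0 < e / (H * (fine (sigma D) + 1)) by rewrite divr_gt0// mulr_gt0.
  apply: (le_trans (bound2 _ e1)).
  rewrite -[X in (_ * X)%E](fineK sfin) -EFinM lee_fin.
  have f0 : 0 <= fine (sigma D) by exact: fine_ge0.
  move: s1 e1 f0; move: (fine _) => s s1 e1 f0.
  rewrite (_ : H * _ * _ = e * (s / (s + 1))); last first.
    by field; rewrite !gt_eqF.
  by rewrite ler_piMr ?(ltW e0)// ler_pdivrMr// mul1r lerDl.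
have mde : measurable_fun setT (fun w => (beta w - B w)%:E) by exact/measurable_EFinP.
have := proj1 (ae_eq_integral_abs P measurableT mde) int0.
apply: filterS => w /(_ I) /= -[/eqP]; rewrite subr_eq0 => /eqP bB _.
by rewrite /= bB.
Unshelve. all: by end_near.
Qed.

End AlmostSureIdentification.

Section ComplexRandomVariables.
Context {R : realType} {dT : measure_display} {T : measurableType dT}.
Local Notation C := R[i].
Local Notation mcfun := (measurable_cfun [set: T]).

Lemma measurable_cfun_cst (c : C) : mcfun (fun _ => c).
Proof. by split; exact: measurable_cst. Qed.

Lemma measurable_cfunD (X Y : T -> C) : mcfun X -> mcfun Y -> mcfun (fun w => X w + Y w).
Proof.
move=> [rX iX] [rY iY]; split.
- by under eq_fun do rewrite cReD; exact: measurable_funD.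
- by under eq_fun do rewrite cImD; exact: measurable_funD.
Qed.

Lemma measurable_cfunM (X Y : T -> C) : mcfun X -> mcfun Y -> mcfun (fun w => X w * Y w).
Proof.
move=> [rX iX] [rY iY]; split.
- by under eq_fun do rewrite cReM; apply: measurable_funB; exact: measurable_funM.
- by under eq_fun do rewrite cImM; apply: measurable_funD; exact: measurable_funM.
Qed.

Lemma measurable_cfun_conj (X : T -> C) : mcfun X -> mcfun (fun w => conjc (X w)).
Proof.
move=> [rX iX]; split.
- by rewrite (_ : (fun w => _) = (fun w => complex.Re (X w)))//; apply/funext => w; case: (X w).
- rewrite (_ : (fun w => _) = (fun w => - complex.Im (X w))); last by apply/funext => w; case: (X w).
  exact: measurableT_comp.
Qed.

Lemma measurable_cfun_sum (I : Type) (s : seq I) (Q : pred I) (X : I -> T -> C) :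
  (forall i, Q i -> mcfun (X i)) -> mcfun (fun w => \sum_(i <- s | Q i) X i w).
Proof.
move=> mX; elim: s => [|i s IH].
  by under eq_fun do rewrite big_nil; exact: measurable_cfun_cst.
under eq_fun do rewrite big_cons.
case Qi: (Q i) => //; apply: measurable_cfunD => //; exact: mX.
Qed.

Lemma sqrnormc_ge0 (z : C) : 0 <= sqrnormc z.
Proof. by rewrite addr_ge0// sqr_ge0. Qed.

Lemma sqr_Re_le (z : C) : complex.Re z ^+ 2 <= sqrnormc z.
Proof. by rewrite lerDl sqr_ge0. Qed.

Lemma sqr_Im_le (z : C) : complex.Im z ^+ 2 <= sqrnormc z.
Proof. by rewrite lerDr sqr_ge0. Qed.

Lemma measurable_sqrnormc (X : T -> C) : mcfun X ->
  measurable_fun setT (fun w => sqrnormc (X w)).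
Proof. by move=> [rX iX]; apply: measurable_funD; exact: measurable_funX. Qed.

Lemma Re_mul_conj_le (z w : C) :
  `|complex.Re (z * conjc w)| <= sqrnormc z + sqrnormc w.
Proof.
case: z w => a b [a' b']; rewrite /sqrnormc /= ler_norml.
have := sqr_ge0 (a - a'); have := sqr_ge0 (b - b').
have := sqr_ge0 (a + a'); have := sqr_ge0 (b + b').
have := sqr_ge0 a; have := sqr_ge0 b; have := sqr_ge0 a'; have := sqr_ge0 b'.
by rewrite !(sqrrB, sqrrD) => *; apply/andP; split; lra.
Qed.

Lemma Im_mul_conj_le (z w : C) :
  `|complex.Im (z * conjc w)| <= sqrnormc z + sqrnormc w.
Proof.
case: z w => a b [a' b']; rewrite /sqrnormc /= ler_norml.
have := sqr_ge0 (a - b'); have := sqr_ge0 (b - a').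
have := sqr_ge0 (a + b'); have := sqr_ge0 (b + a').
have := sqr_ge0 a; have := sqr_ge0 b; have := sqr_ge0 a'; have := sqr_ge0 b'.
by rewrite !(sqrrB, sqrrD) => *; apply/andP; split; lra.
Qed.

Variable P : probability T R.

Lemma cintegrable_L2 (X Y : T -> C) : finite_variance P X -> finite_variance P Y ->
  cintegrable P setT (fun w => X w * conjc (Y w)).
Proof.
move=> [mX iX] [mY iY].
have sq (Z : T -> C) : mcfun Z -> (\int[P]_w (sqrnormc (Z w))%:E < +oo)%E ->
    P.-integrable setT (EFin \o (fun w => sqrnormc (Z w))).
  move=> mZ iZ; apply/integrableP; split.
    by apply/measurable_EFinP; exact: measurable_sqrnormc.
  under eq_integral => w _ do rewrite /= ger0_norm ?sqrnormc_ge0//.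
  exact: iZ.
have ib := integrableD measurableT (sq _ mX iX) (sq _ mY iY).
have [rm im] := measurable_cfunM mX (measurable_cfun_conj mY).
split; (apply: (le_integrable measurableT _ _ ib); [exact/measurable_EFinP|]) => w _.
- by rewrite /= lee_fin (le_trans (Re_mul_conj_le _ _))// ler_norm.
- by rewrite /= lee_fin (le_trans (Im_mul_conj_le _ _))// ler_norm.
Qed.

Lemma cintegrable_L1 (X : T -> C) : finite_variance P X -> cintegrable P setT X.
Proof.
move=> vX; have v1 : finite_variance P (fun _ : T => 1 : C).
  split; first exact: measurable_cfun_cst.
  rewrite (@integral_cst _ _ _ P setT measurableT (sqrnormc (1 : C))%:E).
  apply: (@eq_ind_r _ _ (fun c => (sqrnormc (1 : C))%:E * c < +oo)%E _ _ (probability_setT P)).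
  by rewrite mule1 ltry.
apply: (@eq_cintegrable _ _ _ _ _ measurableT (fun w => X w * conjc 1)); last exact: cintegrable_L2.
by move=> w _; rewrite conjc1 mulr1.
Qed.

Lemma ae_cexpectation (X Y : T -> C) : mcfun X -> mcfun Y ->
  {ae P, forall w, X w = Y w} -> cexpectation P X = cexpectation P Y.
Proof.
move=> [rX iX] [rY iY] XY; rewrite /cexpectation /cintegral /Rintegral.
congr (fine _ +i* fine _); apply: ae_eq_integral => //; try exact/measurable_EFinP.
- by move: XY; apply: filterS => w e _ /=; rewrite e.
- by move: XY; apply: filterS => w e _ /=; rewrite e.
Qed.

End ComplexRandomVariables.

(** * Needlet coefficients as finite sums of the a_(l,m), and their covariance *)

Section NeedletCovariance.
Context {R : realType} (d : nat).
Hypothesis hd : (2 <= d)%N.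
Context {dO : measure_display} {Omega : measurableType dO}.
Local Notation C := R[i].
Local Notation n := d.+1.
Local Notation sigma := (@surface_measure R d).
Local Notation T := (n.-tuple R).
Local Notation lam := (@eta R d).
Variables (P : probability Omega R) (f : Omega -> T -> C) (pw : nat -> R).
Variables (N : nat -> nat) (Y : nat -> nat -> T -> C) (a : nat -> nat -> Omega -> C).
Hypothesis hf : isotropic_field P f.
Hypothesis hs : spectral_representation P f pw N Y a.
Variables (c : nat -> R) (L0 : nat).

Let hY := spectral_basis hs.
(* No property of [omega d] is used: were it 0, then [tau = 0] and all the
   needlet coefficients would vanish almost surely. *)
Let tau : R := area d / omega d.

Definition needlet_kernel_sum (x y : T) : R :=
  \sum_(l < L0) c l * zonal d l (dotp x y).

Definition needlet_coef_sum (x : T) (w : Omega) : C :=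
  cintegral sigma (sphere d) (fun y => f w y * (needlet_kernel_sum x y)%:C).

Local Notation kern := needlet_kernel_sum.
Local Notation coef := needlet_coef_sum.

Let B x w : C :=
  \sum_(l < L0) \sum_(m < N l) ((c l * tau)%:C * Y l m x) * a l m w.

Lemma zonal_reproducing l (t : R) :
  zonal d l t = tau / reproducing_const d l * (gegenbauer lam l).[t].
Proof.
congr (_ * _); rewrite /tau /reproducing_const.
have e0 := eta_gt0 (R := R) hd; have a0 := area_gt0 (R := R) d.
move: (omega d : R) (area d : R) lam (l%:R : R) a0 e0 => o A e k a0 e0.
have u : A * A^-1 = 1 by rewrite mulfV ?gt_eqF.
rewrite !invfM invrK mulrCA [RHS](_ : _ = (A * A^-1) * (o^-1 * (e^-1 * (k + e)))); last by ring.
by rewrite u mul1r; ring.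
Qed.

(** By the reproducing property, only the degree-l term of the kernel sees Y_(l,m). *)
Lemma cintegral_harmonic_kernel l m x : (m < N l)%N -> sphere d x ->
  cintegrable sigma (sphere d) (fun y => Y l m y * (kern x y)%:C) /\
  cintegral sigma (sphere d) (fun y => Y l m y * (kern x y)%:C) =
  if (l < L0)%N then (c l * tau)%:C * Y l m x else 0.
Proof.
move=> mN Sx; have mS := @measurable_sphere R d.
have hm := onh_harmonic hY mN.
pose F k y : C := (c k * (tau / reproducing_const d k))%:C *
    (Y l m y * ((gegenbauer lam k).[dotp x y])%:C).
have E y : sphere d y -> \sum_(k < L0) F k y = Y l m y * (kern x y)%:C.
  move=> Sy; rewrite /kern (rmorph_sum (real_complex R)) mulr_sumr; apply: eq_bigr => k _.
  rewrite zonal_reproducing mulrA (rmorphM (real_complex R)) /F /= mulrCA.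
  by congr (_ * _).
have iF k : cintegrable sigma (sphere d) (F k).
  apply: cintegrableZ => //.
  exact: cintegrable_harmonicM hm (gegenbauer_harmonic k Sx).
split.
  by apply: (eq_cintegrable mS E); apply: cintegrable_sum.
rewrite -(eq_cintegral sigma E) cintegral_sum//.
under eq_bigr => k _.
  rewrite cintegralZ//; last exact: cintegrable_harmonicM hm (gegenbauer_harmonic k Sx).
  rewrite (harmonic_reproducing hd k hm Sx); over.
have r0 := reproducing_const_gt0 (R := R) hd l.
have rr : (c l * (tau / reproducing_const d l)) * reproducing_const d l = c l * tau.
  by rewrite -mulrA divfK ?gt_eqF.
case: ifPn => lL.
  rewrite (bigD1 (Ordinal lL))//= eqxx big1 ?addr0.
    by rewrite mulrA -(rmorphM (real_complex R)) /= rr.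
  by move=> k kl; rewrite ifN ?mulr0//; apply: contraNN kl => /eqP e; apply/eqP/val_inj.
rewrite big1// => k _; rewrite ifN ?mulr0//.
by apply: contraNN lL => /eqP ->.
Qed.

Lemma measurable_kernel x : measurable_fun [set: T] (kern x).
Proof.
apply: measurable_sum => l; apply: measurable_funM; first exact: measurable_cst.
apply: measurable_funM; first exact: measurable_cst.
apply: (measurableT_comp (f := horner (gegenbauer lam l))).
  by apply: continuous_measurable_fun; exact: continuous_horner.
by apply: measurable_sum => i; apply: measurable_funM; [exact: measurable_cst|exact: measurable_tnth].
Qed.

Lemma kernel_bounded x : sphere d x ->
  exists2 H : R, 0 < H & forall y, sphere d y -> `|kern x y| <= H.
Proof.
move=> Sx; exists (1 + \sum_(l < L0) `|c l * (tau / reproducing_const d l)| * (gegenbauer lam l).[1]).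
  rewrite ltr_wpDr// sumr_ge0// => l _; rewrite mulr_ge0//.
  exact: le_trans (normr_ge0 _) (gegenbauer_le1 hd hY l Sx Sx).
move=> y Sy; rewrite ler_wpDl// (le_trans (ler_norm_sum _ _ _))//.
apply: ler_sum => l _; rewrite zonal_reproducing mulrA normrM ler_wpM2l//.
exact: (gegenbauer_le1 hd hY l Sx Sy).
Qed.

Lemma measurable_evs (p : mpoly.mpoly n C) : measurable_cfun [set: T] (evs p).
Proof.
have -> : evs p = (fun x : T => \sum_(m <- mpoly.msupp p) mpoly.mcoeff m p * (mon m x)%:C).
  apply/funext => x; rewrite [in LHS](mpoly.mpolyE p) evs_sum; apply: eq_bigr => m _.
  by rewrite evsZ evsX.
apply: measurable_cfun_sum => m _; apply: measurable_cfunM; first exact: measurable_cfun_cst.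
split => /=; last exact: measurable_cst.
apply: measurable_prod => i _; apply: measurable_funX; exact: measurable_tnth.
Qed.

(** The field is measurable only over the sphere; its extension by zero is jointly measurable on the
    whole product, as [ae_eq_approximation] asks. *)
Let field0 (w : Omega) (y : T) : C := if y \in sphere d then f w y else 0.

Let measurable_field0 : measurable_cfun [set: Omega * T] (fun p => field0 p.1 p.2).
Proof.
have [mr mi] := field_measurable hf.
have mS : measurable ([set: Omega] `*` @sphere R d).
  exact: measurableX measurableT (@measurable_sphere R d).
have E (p : Omega * T) : (p \in [set: Omega] `*` @sphere R d) = (p.2 \in @sphere R d).
  by case: p => w y; rewrite in_setX in_setT.
split.
  move/(measurable_restrictT _ mS) : mr; congr measurable_fun; apply/funext => p.
  by rewrite /patch E /field0; case: ifP.
move/(measurable_restrictT _ mS) : mi; congr measurable_fun; apply/funext => p.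
by rewrite /patch E /field0; case: ifP.
Qed.

Let measurable_B x : measurable_cfun [set: Omega] (B x).
Proof.
apply: measurable_cfun_sum => l _; apply: measurable_cfun_sum => m _.
apply: measurable_cfunM; first exact: measurable_cfun_cst.
exact: (proj1 (spectral_coef hs (ltn_ord m))).
Qed.

(** [pr] is the real or the imaginary part; the hypotheses list what the argument uses of either, so
    that it runs once for both. *)
Lemma ae_part (pr : C -> R) x : sphere d x ->
  (forall z w, pr (z - w) = pr z - pr w) -> (forall z r, pr (z * r%:C) = pr z * r) ->
  (forall z, pr z ^+ 2 <= sqrnormc z) ->
  (forall dT (X : measurableType dT) (D : set X) Z, measurable_cfun D Z -> measurable_fun D (pr \o Z)) ->
  (forall Z, pr (cintegral sigma (sphere d) Z) = \int[sigma]_(y in sphere d) pr (Z y)) ->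
  (forall Z, cintegrable sigma (sphere d) Z -> sigma.-integrable (sphere d) (EFin \o (pr \o Z))) ->
  measurable_fun setT (pr \o coef x) /\ {ae P, forall w, pr (coef x w) = pr (B x w)}.
Proof.
move=> Sx prB prZ prle prm pri prI; have mS := @measurable_sphere R d.
(* [Y l m] is controlled on the sphere only; in the partial sums it is replaced by a polynomial with
   the same values there, which is measurable everywhere. *)
have [p pE] : exists p : nat -> nat -> mpoly.mpoly n C, forall l m, (m < N l)%N ->
    forall y, sphere d y -> Y l m y = evs (p l m) y.
  have h l m : exists q : mpoly.mpoly n C, (m < N l)%N ->
      forall y, sphere d y -> Y l m y = evs q y.
    case: (ltnP m (N l)) => mN; last by exists 0.
    by have [q qE] := spherical_harmonic_evs (onh_harmonic hY mN); exists q.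
  have [q qE] := choice (fun lm : nat * nat => h lm.1 lm.2).
  by exists (fun l m => q (l, m)) => l m; exact: (qE (l, m)).
pose v L (q : Omega * T) : C := \sum_(l < L) \sum_(m < N l) a l m q.1 * evs (p l m) q.2.
have mv L : measurable_cfun setT (v L).
  apply: measurable_cfun_sum => l _; apply: measurable_cfun_sum => m _.
  have [[ra ia] _] := spectral_coef hs (ltn_ord m).
  have [re ie] := measurable_evs (p l m).
  apply: measurable_cfunM.
    by split; [exact: (measurableT_comp ra measurable_fst)|exact: (measurableT_comp ia measurable_fst)].
  by split; [exact: (measurableT_comp re measurable_snd)|exact: (measurableT_comp ie measurable_snd)].
have vE L w y : sphere d y -> v L (w, y) = \sum_(l < L) \sum_(m < N l) a l m w * Y l m y.
  by move=> Sy; apply: eq_bigr => l _; apply: eq_bigr => m _; rewrite pE.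
have [H H0 Hk] := kernel_bounded Sx.
have mk := measurable_kernel x.
have [vI vB] : (forall L w, cintegrable sigma (sphere d) (fun y => v L (w, y) * (kern x y)%:C)) /\
    forall L w, (L0 <= L)%N -> cintegral sigma (sphere d) (fun y => v L (w, y) * (kern x y)%:C) = B x w.
  have E L w y : sphere d y -> \sum_(l < L) \sum_(m < N l) a l m w * (Y l m y * (kern x y)%:C) =
      v L (w, y) * (kern x y)%:C.
    move=> Sy; rewrite vE// mulr_suml; apply: eq_bigr => l _.
    by rewrite mulr_suml; apply: eq_bigr => m _; rewrite mulrA.
  have I1 l w (m : 'I_(N l)) : cintegrable sigma (sphere d) (fun y => a l m w * (Y l m y * (kern x y)%:C)).
    by apply: cintegrableZ => //; exact: (proj1 (cintegral_harmonic_kernel (ltn_ord m) Sx)).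
  have I2 l w : cintegrable sigma (sphere d) (fun y => \sum_(m < N l) a l m w * (Y l m y * (kern x y)%:C)).
    by apply: cintegrable_sum.
  split => L w; first by apply: (eq_cintegrable mS (E L w)); apply: cintegrable_sum.
  move=> L0L; rewrite -(eq_cintegral sigma (E L w)) cintegral_sum//.
  (* The kernel has no term of degree L0 or more, so higher degrees of the partial sum integrate to
     0 and the result does not depend on L. *)
  transitivity (\sum_(l < L) if (l < L0)%N then \sum_(m < N l) ((c l * tau)%:C * Y l m x) * a l m w else 0).
    apply: eq_bigr => l _; rewrite cintegral_sum//.
    under eq_bigr => m _.
      have [I3 I4] := cintegral_harmonic_kernel (ltn_ord m) Sx.
      rewrite cintegralZ// I4; over.
    case: ifP => lL; last by rewrite big1// => m _; rewrite mulr0.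
    by apply: eq_bigr => m _; rewrite mulrC.
  by rewrite -big_mkcond /= /B (big_ord_widen _ (fun l => \sum_(m < N l) ((c l * tau)%:C * Y l m x) * a l m w) L0L).
have mu := prm _ _ _ _ measurable_field0.
have coefE w : pr (coef x w) = \int[sigma]_(y in sphere d) (pr (field0 w y) * kern x y).
  rewrite pri; apply: eq_Rintegral => y; rewrite inE => Sy; rewrite prZ /field0 ifT// inE//.
have [] := @ae_eq_approximation R _ _ Omega _ P sigma (sphere d) mS
    (fun q => pr (field0 q.1 q.2)) (kern x) H (fun w => pr (B x w)) mu mk Hk _
    (fun L q => pr (v L q)) L0 _ H0 _ _ _ _ (spectral_cvg hs).
- by apply: prm; exact: measurable_B.
- by move=> L; exact: prm.
- move=> L w _; have := prI _ (vI L w); apply: eq_integrable => // y _ /=.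
  by rewrite prZ.
- move=> L w L0L; rewrite -(vB L w L0L) pri; apply: eq_Rintegral => y _.
  by rewrite prZ.
- move=> L /=.
  have mW : measurable_cfun setT (fun q : Omega * T => field0 q.1 q.2 - v L q).
    have -> : (fun q : Omega * T => field0 q.1 q.2 - v L q) =
        (fun q => field0 q.1 q.2 + (-1) * v L q) by apply/funext => q; rewrite mulN1r.
    by apply: measurable_cfunD => //; apply: measurable_cfunM => //; exact: measurable_cfun_cst.
  under [leRHS]eq_integral => w _.
    under eq_integral => y.
      rewrite inE => Sy; rewrite -(vE L w y Sy) [f w y](_ : _ = field0 w y); last first.
        by rewrite /field0 ifT// inE.
      over.
    over.
  apply: ge0_le_integral => //.
  + by move=> w _; apply: integral_ge0 => y _; rewrite lee_fin sqr_ge0.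
  + apply: (measurable_integral_param sigma mS (u := fun q => (pr (field0 q.1 q.2) - pr (v L q)) ^+ 2)).
      apply: measurable_funX; apply: measurable_funB; exact: prm.
    by move=> q; exact: sqr_ge0.
  + apply: (measurable_integral_param sigma mS (u := fun q => sqrnormc (field0 q.1 q.2 - v L q))).
      exact: measurable_sqrnormc.
    by move=> q; exact: sqrnormc_ge0.
  + move=> w _; apply: ge0_le_integral => //.
    * by move=> y _; rewrite lee_fin sqr_ge0.
    * apply: measurable_funTS; apply/measurable_EFinP; apply: measurable_funX.
      apply: measurable_funB.
        exact: (measurableT_comp (prm _ _ _ _ measurable_field0) (pair1_measurable w)).
      exact: (measurableT_comp (prm _ _ _ _ (mv L)) (pair1_measurable w)).
    * apply: measurable_funTS; apply/measurable_EFinP.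
      exact: (measurableT_comp (measurable_sqrnormc mW) (pair1_measurable w)).
    * by move=> y _; rewrite lee_fin -prB; exact: prle.
- move=> m1 m2; split; first by apply: eq_measurable_fun m1 => w _; rewrite /= -coefE.
  by move: m2; apply: filterS => w /(_ I) [e]; rewrite coefE.
Qed.

Lemma ae_needlet_coef x : sphere d x -> measurable_cfun setT (coef x) /\
  {ae P, forall w, coef x w = B x w}.
Proof.
move=> Sx.
have [mr er] := @ae_part (@complex.Re R) x Sx
  (fun z w => ltac:(by case: z w => ? ? [])) (fun z r => ltac:(by rewrite cReM /= mulr0 subr0))
  (@sqr_Re_le R) (fun _ _ _ _ => @proj1 _ _) (fun _ => erefl) (fun _ => @proj1 _ _).
have [mi ei] := @ae_part (@complex.Im R) x Sx
  (fun z w => ltac:(by case: z w => ? ? [])) (fun z r => ltac:(by rewrite cImM /= mulr0 add0r))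
  (@sqr_Im_le R) (fun _ _ _ _ => @proj2 _ _) (fun _ => erefl) (fun _ => @proj2 _ _).
split; first by split.
move: er ei; apply: filterS2 => w; case: (coef x w) (B x w) => s t [s' t'] /= -> -> //.
Qed.

Lemma cexpectation_needlet_coef x : sphere d x -> cexpectation P (coef x) = 0.
Proof.
move=> Sx; have [mc cB] := ae_needlet_coef Sx.
rewrite (ae_cexpectation mc (measurable_B x) cB).
have i1 l (m : 'I_(N l)) : cintegrable P setT (a l m).
  exact: cintegrable_L1 (spectral_coef hs (ltn_ord m)).
have i2 l (m : 'I_(N l)) : cintegrable P setT (fun w => (c l * tau)%:C * Y l m x * a l m w).
  exact: cintegrableZ.
rewrite /cexpectation cintegral_sum//; last by move=> l _; exact: cintegrable_sum.
rewrite big1// => l _; rewrite cintegral_sum// big1// => m _.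
rewrite cintegralZ// [X in _ * X](_ : _ = 0) ?mulr0//.
exact: (spectral_mean hs (ltn_ord m)).
Qed.

(** In the fourfold sum only l = l', m = m' survive, as the a_(l,m) are uncorrelated; the addition
    theorem carries out the sum over m. *)
Lemma ccovariance_needlet_coef x y : sphere d x -> sphere d y ->
  ccovariance P (coef x) (coef y) =
  (\sum_(l < L0) (c l * tau) ^+ 2 * pw l / reproducing_const d l *
     (gegenbauer lam l).[dotp x y])%:C.
Proof.
move=> Sx Sy; rewrite /ccovariance !cexpectation_needlet_coef//.
have [mx xB] := ae_needlet_coef Sx; have [my yB] := ae_needlet_coef Sy.
pose k z l (m : nat) : C := (c l * tau)%:C * Y l m z.
pose F l m l' m' w := (k x l m * conjc (k y l' m')) * (a l m w * conjc (a l' m' w)).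
transitivity (cexpectation P (fun w => \sum_(l < L0) \sum_(m < N l) \sum_(l' < L0) \sum_(m' < N l')
    F l m l' m' w)).
  have E w : B x w * conjc (B y w) =
      \sum_(l < L0) \sum_(m < N l) \sum_(l' < L0) \sum_(m' < N l') F l m l' m' w.
    rewrite /B mulr_suml; apply: eq_bigr => l _; rewrite mulr_suml; apply: eq_bigr => m _.
    rewrite (rmorph_sum (@conjc R)) mulr_sumr; apply: eq_bigr => l' _.
    rewrite (rmorph_sum (@conjc R)) mulr_sumr; apply: eq_bigr => m' _.
    by rewrite /F -(mulrACA (k x l m)) -(@conjcM R (k y l' m')).
  have <- : cexpectation P (fun w => B x w * conjc (B y w)) = cexpectation P (fun w => \sum_(l < L0)
      \sum_(m < N l) \sum_(l' < L0) \sum_(m' < N l') F l m l' m' w).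
    by congr (cexpectation P _); apply/funext.
  have -> : (fun w => (coef x w - 0) * conjc (coef y w - 0)) =
      (fun w => coef x w * conjc (coef y w)) by apply/funext => w; rewrite !subr0.
  apply: ae_cexpectation.
  - by apply: measurable_cfunM => //; exact: measurable_cfun_conj.
  - by apply: measurable_cfunM => //; apply: measurable_cfun_conj.
  - by move: xB yB; apply: filterS2 => w -> ->.
have ia l m l' m' : (m < N l)%N -> (m' < N l')%N ->
    cintegrable P setT (fun w => a l m w * conjc (a l' m' w)).
  move=> h h'; exact: (cintegrable_L2 (spectral_coef hs h) (spectral_coef hs h')).
have i0 l m l' m' : (m < N l)%N -> (m' < N l')%N -> cintegrable P setT (F l m l' m').
  by move=> h h'; apply: cintegrableZ => //; exact: ia.
rewrite /cexpectation cintegral_sum//; last first.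
  by move=> l _; do 3 (apply: cintegrable_sum => // ? _); exact: i0.
rewrite (rmorph_sum (real_complex R)); apply: eq_bigr => l _.
rewrite cintegral_sum//; last first.
  by move=> m _; do 2 (apply: cintegrable_sum => // ? _); exact: i0.
transitivity (\sum_(m < N l) k x l m * conjc (k y l m) * (pw l)%:C).
  apply: eq_bigr => m _; rewrite cintegral_sum//; last first.
    by move=> l' _; apply: cintegrable_sum => // ? _; exact: i0.
  rewrite (bigD1 l)//= [X in _ + X]big1 ?addr0; last first.
    move=> l' l'l; rewrite cintegral_sum//; last by move=> m' _; exact: i0.
    rewrite big1// => m' _; rewrite cintegralZ//; last first.
      exact: ia.
    rewrite [X in _ * X](spectral_cov hs (ltn_ord m) (ltn_ord m')).
    by rewrite ifF ?mulr0//; apply/negbTE; rewrite negb_and eq_sym l'l.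
  rewrite cintegral_sum//; last by move=> m' _; exact: i0.
  rewrite (bigD1 m)//= [X in _ + X]big1 ?addr0; last first.
    move=> m' m'm; rewrite cintegralZ//; last first.
      exact: ia.
    rewrite [X in _ * X](spectral_cov hs (ltn_ord m) (ltn_ord m')).
    by rewrite eqxx /= [(m : nat) == m']eq_sym [(m' : nat) == m](negbTE m'm) mulr0.
  rewrite cintegralZ//; last exact: ia.
  rewrite [X in _ * X](spectral_cov hs (ltn_ord m) (ltn_ord m)).
  by rewrite !eqxx.
rewrite -mulr_suml.
have e := addition_theorem hd hY l Sx Sy.
have r0 := reproducing_const_gt0 (R := R) hd l.
have {}e : \sum_(m < N l) Y l m x * conjc (Y l m y) =
    ((gegenbauer lam l).[dotp x y] / reproducing_const d l)%:C.
  have rC : (reproducing_const d l)%:C != 0 :> C.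
    by rewrite eq_complex /= negb_and gt_eqF.
  apply: (mulfI rC); rewrite e -(rmorphM (real_complex R)) /= mulrC divfK// gt_eqF//.
rewrite (eq_bigr (fun m : 'I_(N l) => ((c l * tau) ^+ 2)%:C * (Y l m x * conjc (Y l m y)))); last first.
  move=> m _; rewrite /k conjcM conjc_real mulrACA -(rmorphM (real_complex R)) /=.
  by rewrite -expr2.
rewrite -mulr_sumr e -!(rmorphM (real_complex R)) /=; apply: (congr1 (real_complex R)).
by ring.
Qed.

End NeedletCovariance.

Section NeedletCorrelation.
Context {R : realType} (d : nat).
Hypothesis hd : (2 <= d)%N.
Context {dO : measure_display} {Omega : measurableType dO}.
Local Notation T := (d.+1.-tuple R).
Local Notation lam := (@eta R d).
Variables (P : probability Omega R) (f : Omega -> T -> R[i]) (pw : nat -> R).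
Hypothesis hf : isotropic_field P f.
Hypothesis hpw : angular_power_spectrum P f pw.
Variables (b : nat -> R -> R) (j L0 : nat).
Hypothesis b0 : forall l, (L0 <= l)%N -> b j l%:R = 0.

(** The function D(t), without the constant factor that cancels in the correlation. *)
Definition needlet_cov (t : R) : R :=
  \sum_(l < L0) b j l%:R ^+ 2 * pw l * (l%:R + lam) * (gegenbauer lam l).[t].

Lemma needlet_kernelE (x y : T) :
  needlet_kernel b j x y = needlet_kernel_sum (fun l => b j l%:R) L0 x y.
Proof.
apply/cvg_lim => //; apply: cvg_near_cst; near=> m.
have mL : (L0 <= m)%N by near: m; exact: nbhs_infty_ge.
rewrite /series /= /needlet_kernel_sum -(big_mkord xpredT (fun l => b j l%:R * zonal d l (dotp x y))).
rewrite (big_cat_nat (n := L0))//= [X in _ + X](_ : _ = 0) ?addr0//.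
rewrite big_nat_cond big1//.
by move=> l /andP[/andP[Ll _] _]; rewrite b0// mul0r.
Unshelve. all: by end_near.
Qed.

Lemma ccovariance_needlet :
  exists2 K : R, 0 <= K & forall x y, sphere d x -> sphere d y ->
    ccovariance P (needlet_coef b f j x) (needlet_coef b f j y) =
    (K * needlet_cov (dotp x y))%:C.
Proof.
have [N [Y [a hs]]] := hpw.
have e0 := eta_gt0 (R := R) hd; have a0 := area_gt0 (R := R) d.
exists ((area d / omega d) ^+ 2 / (area d * lam)).
  by rewrite divr_ge0 ?sqr_ge0// ltW// mulr_gt0.
move=> x y Sx Sy.
have cE z : needlet_coef b f j z = needlet_coef_sum f (fun l => b j l%:R) L0 z.
  apply/funext => w; rewrite /needlet_coef /needlet_coef_sum.
  by congr cintegral; apply/funext => u; rewrite needlet_kernelE.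
rewrite !cE (ccovariance_needlet_coef hd hf hs _ _ Sx Sy); apply: (congr1 (real_complex R)).
rewrite /needlet_cov mulr_sumr; apply: eq_bigr => l _; rewrite /reproducing_const.
move: ((gegenbauer lam l).[dotp x y]) (omega d : R)  => G o.
move: (area d : R) lam (l%:R : R) a0 e0 => A e k a0 e0.
by rewrite exprMn [(_ / (k + e))^-1]invf_div; move: (A / o) => s; field; rewrite !gt_eqF.
Qed.

(** All points share one variance because <x, x> = 1. If it is 0, the quotient is 0 by the
    convention on division, and M >= 0 suffices. The order on [R[i]] requires equal imaginary parts;
    here both sides are real. *)
Lemma ccorrelation_needlet_le (x y : T) (M : R) : sphere d x -> sphere d y ->
  0 <= M -> 0 <= needlet_cov 1 -> needlet_cov (dotp x y) <= M * needlet_cov 1 ->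
  ccorrelation P (needlet_coef b f j x) (needlet_coef b f j y) <= M%:C.
Proof.
move=> Sx Sy M0 D0 DM; have [K K0 cov] := ccovariance_needlet.
rewrite /ccorrelation /cvariance.
move: (needlet_coef b f j) cov => B cov.
rewrite (cov _ _ Sx Sy) (cov _ _ Sx Sx) (cov _ _ Sy Sy).
rewrite (sphereE Sx) (sphereE Sy).
move: (needlet_cov (dotp x y)) (needlet_cov 1) D0 DM => Dxy D1 D0 DM.
rewrite /= -expr2 sqrtr_sqr ger0_norm ?mulr_ge0//.
rewrite -(fmorph_div (real_complex R)) /= lecE /= eqxx /=.
have [->|KD] := eqVneq (K * D1) 0; first by rewrite invr0 mulr0.
rewrite ler_pdivrMr; last by rewrite lt_neqAle eq_sym KD mulr_ge0.
by rewrite mulrCA ler_wpM2l.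
Qed.

End NeedletCorrelation.

(** * Finite differences and Gegenbauer sums *)

Section DerivativeTowers.
Context {R : realType}.
Implicit Types (F : nat -> R -> R) (c : nat -> R).

(** A function with its successive derivatives on ]0, +oo[: a common form for the one-sided
    derivatives of b_j, the [derive1n] of g and the explicit derivatives of powers. *)
Definition derivative_tower F :=
  forall n (u : R), 0 < u -> is_derive u 1 (F n) (F n.+1 u).

Definition fdiff c (l : nat) : R := c l.+1 - c l.

Let rdiff (h : R -> R) (u : R) : R := h (u + 1) - h u.

Let is_derive_rdiff F k n (u : R) : derivative_tower F -> 0 < u ->
  is_derive u 1 (iter k rdiff (F n)) (iter k rdiff (F n.+1) u).
Proof.
move=> tF; elim: k u => [|k IH] u u0 /=; first exact: tF.
rewrite /rdiff; apply: is_deriveB; last exact: IH.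
have h := IH (u + 1) (addr_gt0 u0 ltr01).
have s := @is_derive_shift R^o u 1 1.
by have := @is_derive1_comp R _ (shift 1) u _ 1 h s; rewrite mulr1.
Qed.

(** By the mean value theorem a unit difference is the derivative at an intermediate point;
    differences commute with derivatives, so this can be repeated k times. *)
Let rdiff_le F k n (u : R) B : derivative_tower F -> 0 < u ->
  (forall v, u <= v <= u + k%:R -> `|F (n + k)%N v| <= B) ->
  `|iter k rdiff (F n) u| <= B.
Proof.
move=> tF; elim: k n u B => [|k IH] n u B u0 hB /=.
  by have := hB u; rewrite addn0 addr0 lexx; apply.
have h (v : R) : v \in `]u, (u + 1)[ -> is_derive v 1 (iter k rdiff (F n)) (iter k rdiff (F n.+1) v).
  by rewrite in_itv /= => /andP[uv _]; apply: is_derive_rdiff => //; exact: lt_trans uv.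
have cont : {within `[u, u + 1], continuous (iter k rdiff (F n))}.
  apply: continuous_in_subspaceT => v; rewrite inE /= in_itv /= => /andP[uv _].
  apply: differentiable_continuous; apply/derivable1_diffP.
  by have [] := is_derive_rdiff k n tF (lt_le_trans u0 uv).
have [|v] := MVT _ h cont; first by rewrite ltrDl.
rewrite in_itv /= => /andP[uv vu] e; rewrite [X in `|X|]e.
rewrite addrC addKr mulr1; apply: IH; first exact: lt_trans uv.
move=> x /andP[vx xv]; rewrite addSnnS; apply: hB.
rewrite (le_trans (ltW uv) vx) (le_trans xv)// -natr1 addrA (addrAC u) lerD2r//.
exact: ltW.
Qed.

Lemma tower_fdiff_le F k l B : derivative_tower F -> (0 < l)%N ->
  (forall v, l%:R <= v <= (l + k)%:R -> `|F k v| <= B) ->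
  `|iter k fdiff (fun l => F 0%N l%:R) l| <= B.
Proof.
move=> tF l0 hB.
have -> : iter k fdiff (fun l => F 0%N l%:R) l = iter k rdiff (F 0%N) l%:R.
  elim: k l {l0 hB} => //= k IH l; rewrite /fdiff /rdiff !IH.
  by rewrite -natr1.
apply: rdiff_le => //; first by rewrite ltr0n.
by move=> v; rewrite add0n -natrD; exact: hB.
Qed.

Definition falling (e : R) n : R := \prod_(i < n) (e - i%:R).

Lemma tower_powR (e s : R) : 0 <= s ->
  derivative_tower (fun n u => falling e n * (u + s) `^ (e - n%:R)).
Proof.
move=> s0 n u u0; have us : 0 < u + s by rewrite ltr_wpDr.
have h := is_derive1_powR (e - n%:R) us.
have sh := @is_derive_shift R^o u 1 s.
have := is_deriveZ (falling e n) (@is_derive1_comp R _ (shift s) u _ 1 h sh).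
rewrite mulr1 /falling big_ord_recr /= -mulrA.
by rewrite -natr1 opprD addrA.
Qed.

End DerivativeTowers.

Section DifferenceClasses.
Context {R : realType}.
Implicit Types (c h V U : nat -> R).

Lemma iter_fdiffD c h k l :
  iter k fdiff (fun l => c l + h l) l = iter k fdiff c l + iter k fdiff h l.
Proof. by elim: k l => //= k IH l; rewrite /fdiff !IH opprD addrACA. Qed.

Lemma iter_fdiffN c k l : iter k fdiff (fun l => - c l) l = - iter k fdiff c l.
Proof. by elim: k l => //= k IH l; rewrite /fdiff !IH opprD. Qed.

Lemma iter_fdiff_shift c k l :
  iter k fdiff (fun l => c l.+1) l = iter k fdiff c l.+1.
Proof. by elim: k l => //= k IH l; rewrite /fdiff !IH. Qed.

Lemma eq_iter_fdiff c h k l : c =1 h -> iter k fdiff c l = iter k fdiff h l.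
Proof. by move=> /funext ->. Qed.

(** A discrete analogue of a symbol class: V is the size profile and 1 / mu the gain per difference.
    The starting index a keeps away from 0, where l^(-alpha) is singular. *)
Definition diff_class (a K : nat) (mu A : R) V c :=
  forall k l, (k <= K)%N -> (a <= l)%N -> `|iter k fdiff c l| <= A * mu ^- k * V l.

Definition nonincr V := forall l, V l.+1 <= V l.

Lemma diff_class_le a K K' mu A V c : (K' <= K)%N ->
  diff_class a K mu A V c -> diff_class a K' mu A V c.
Proof. by move=> KK h k l kK; apply: h; exact: leq_trans KK. Qed.

Lemma diff_classD a K mu A B V c h : diff_class a K mu A V c ->
  diff_class a K mu B V h -> diff_class a K mu (A + B) V (fun l => c l + h l).
Proof.
move=> hc hh k l kK al; rewrite iter_fdiffD (le_trans (ler_normD _ _))//.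
by rewrite !mulrDl lerD// ?hc ?hh.
Qed.

Lemma diff_classN a K mu A V c : diff_class a K mu A V c ->
  diff_class a K mu A V (fun l => - c l).
Proof. by move=> hc k l kK al; rewrite iter_fdiffN normrN hc. Qed.

Lemma diff_class_fdiff a K mu A V c : diff_class a K.+1 mu A V c ->
  diff_class a K mu (A / mu) V (fdiff c).
Proof.
move=> hc k l kK al; rewrite -iterSr (le_trans (hc k.+1 l _ _))//.
by rewrite exprS invfM mulrA.
Qed.

Lemma diff_class_shift a K mu A V c : 0 < mu -> 0 <= A -> nonincr V ->
  diff_class a K mu A V c -> diff_class a K mu A V (fun l => c l.+1).
Proof.
move=> mu0 A0 nV hc k l kK al; rewrite iter_fdiff_shift.
rewrite (le_trans (hc k l.+1 kK (leqW al)))// ler_wpM2l//.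
by rewrite mulr_ge0// invr_ge0 exprn_ge0// ltW.
Qed.

(** Discrete Leibniz rule: the difference of c h at l is (c(l+1) - c(l)) h(l+1) + c(l) (h(l+1) -
    h(l)). The shifted factor h(l+1) is the reason for [nonincr U], and the doubling of terms at
    each order gives 2^K. *)
Lemma diff_classM a K mu A B V U c h : 0 < mu -> 0 <= A -> 0 <= B -> nonincr U ->
  diff_class a K mu A V c -> diff_class a K mu B U h ->
  diff_class a K mu (2 ^+ K * A * B) (fun l => V l * U l) (fun l => c l * h l).
Proof.
move=> mu0 + + nU; elim: K A B c h => [|K IH] A B c h A0 B0 hc hh k l.
  rewrite leqn0 => /eqP -> al /=; have := hc 0%N l (leqnn _) al.
  have := hh 0%N l (leqnn _) al; rewrite /= expr0 invr1 !mulr1 mul1r normrM => h1 h2.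
  by rewrite mulrACA ler_pM.
case: k => [|k]; rewrite ?ltnS => kK al.
  have := hc 0%N l isT al; have := hh 0%N l isT al.
  rewrite /= expr0 invr1 !mulr1 normrM => h1 h2.
  apply: (@le_trans _ _ (A * V l * (B * U l))); first exact: ler_pM.
  have p0 : 0 <= A * V l * (B * U l) by rewrite mulr_ge0// (le_trans _ h1, le_trans _ h2).
  rewrite [leRHS](_ : _ = 2 ^+ K.+1 * (A * V l * (B * U l))); last by ring.
  by rewrite ler_peMl// exprn_ege1// ler1n.
have A0' : 0 <= A / mu by rewrite divr_ge0// ltW.
have B0' : 0 <= B / mu by rewrite divr_ge0// ltW.
have h1 := IH _ _ _ _ A0' B0 (diff_class_fdiff hc)
  (diff_class_shift mu0 B0 nU (diff_class_le (leqnSn K) hh)).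
have h2 := IH _ _ _ _ A0 B0' (diff_class_le (leqnSn K) hc) (diff_class_fdiff hh).
have := diff_classD h1 h2 kK al.
rewrite iterSr; rewrite (@eq_iter_fdiff _ (fdiff (fun l => c l * h l))); last first.
  by move=> i; rewrite /fdiff mulrBl mulrBr addrA subrK.
move=> /le_trans; apply; rewrite le_eqVlt; apply/orP; left; apply/eqP.
rewrite !exprS; field; by rewrite ?expf_neq0 ?gt_eqF.
Qed.

End DifferenceClasses.

Section ZonalLaplacian.
Context {R : realType}.
Variable lam : R.
Hypothesis lam0 : 0 < lam.
Implicit Types (c V : nat -> R).

(* Conjugate of 2(1 - t) under c |-> sum_l c_l (l + lam) G_l(t). *)
Definition zlap c (l : nat) : R :=
  2 * c l - c l.-1 - c l.+1 - lam / (l%:R + lam) * (c l.+1 - c l.-1).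

Lemma zlap0 c L l : (forall l, (L <= l)%N -> c l = 0) -> (L.+1 <= l)%N -> zlap c l = 0.
Proof.
move=> c0 Ll; rewrite /zlap !c0 ?(leq_trans (leqnSn _) Ll)//; first by ring.
- by rewrite (leq_trans (leqnSn L))// leqW.
- by case: l Ll.
Qed.

(** From 2 t (l + lam) G_l = (l + 1) G_(l+1) + (l + 2 lam - 1) G_(l-1), summation by parts gives
    [part], whose boundary terms vanish beyond the support. In [zlap] the coefficient of c_(l-1) is
    -l / (l + lam), which is 0 at l = 0, so the convention [0.-1 = 0] is harmless. *)
Lemma zlap_sum c L t : (forall l, (L <= l)%N -> c l = 0) ->
  \sum_(l < L.+1) zlap c l * (l%:R + lam) * (gegenbauer lam l).[t] =
  2 * (1 - t) * \sum_(l < L) c l * (l%:R + lam) * (gegenbauer lam l).[t].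
Proof.
move=> c0; pose G l := (gegenbauer lam l).[t].
have part M : \sum_(l < M.+1) zlap c l * (l%:R + lam) * G l =
   2 * (1 - t) * (\sum_(l < M.+1) c l * (l%:R + lam) * G l) +
   M.+1%:R * c M * G M.+1 - (M%:R + 2 * lam) * c M.+1 * G M.
  elim: M => [|M IH].
    rewrite !big_ord_recl !big_ord0 /= /zlap /G /= !add0r hornerC hornerZ hornerX.
    by field; rewrite gt_eqF.
  rewrite big_ord_recr [in RHS]big_ord_recr /= IH /G.
  have e := gegenbauer_rec lam M t.
  have e0 : (M.+1%:R + lam) != 0 by rewrite gt_eqF// ltr_wpDl.
  have {}e : M.+2%:R * c M.+1 * (gegenbauer lam M.+2).[t] = c M.+1 *
     (2 * (M.+1%:R + lam) * t * (gegenbauer lam M.+1).[t] -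
     (M%:R + 2 * lam) * (gegenbauer lam M).[t]) by rewrite -e; ring.
  move: e e0; rewrite /zlap [M.+1.-1]/=.
  move: (gegenbauer _ M.+2).[t] (gegenbauer _ M.+1).[t] (gegenbauer _ M).[t] => g2 g1 g0.
  move: (c M) (c M.+1) (c M.+2) (\sum_(_ < _) _) => c0' c1 c2 s e e0.
  by rewrite e -[M.+1%:R]natr1; field; rewrite natr1.
rewrite part c0// c0 ?leqnSn// mulr0 mul0r !mulr0 mul0r subr0 addr0.
by rewrite big_ord_recr /= c0// !mul0r addr0.
Qed.

Lemma iter_zlap_sum c L n t : (forall l, (L <= l)%N -> c l = 0) ->
  \sum_(l < L + n) iter n zlap c l * (l%:R + lam) * (gegenbauer lam l).[t] =
  (2 * (1 - t)) ^+ n * \sum_(l < L) c l * (l%:R + lam) * (gegenbauer lam l).[t].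
Proof.
move=> c0; suff [_ //] : (forall l, (L + n <= l)%N -> iter n zlap c l = 0) /\
  \sum_(l < L + n) iter n zlap c l * (l%:R + lam) * (gegenbauer lam l).[t] =
  (2 * (1 - t)) ^+ n * \sum_(l < L) c l * (l%:R + lam) * (gegenbauer lam l).[t].
elim: n => [|n [IH1 IH2]]; first by rewrite addn0 mul1r.
rewrite addnS; split; first by move=> l; exact: zlap0.
by rewrite (zlap_sum _ IH1) IH2 mulrA -exprS.
Qed.

(** At l + 1, [zlap c] is minus the second difference of c at l, minus lam / (l + 1 + lam) times a
    sum of two first differences. The former gains mu^(-2); in the latter one factor 1 / mu comes
    from the difference and one from lam / (l + lam). Two orders of difference and one index are
    spent. *)
Lemma zlap_class a K mu A B V c : 0 < mu -> 0 <= A -> 0 <= B -> nonincr V ->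
  diff_class a K mu (B / mu) (fun=> 1) (fun l => lam / (l%:R + lam)) ->
  diff_class a K.+2 mu A V c ->
  diff_class a.+1 K mu ((1 + 2 ^+ K.+1 * B) * A * mu ^- 2) (fun l => V l.-1) (zlap c).
Proof.
move=> mu0 A0 B0 nV hB hc.
have A0' : 0 <= A / mu by rewrite divr_ge0// ltW.
have B0' : 0 <= B / mu by rewrite divr_ge0// ltW.
have h1 := diff_classN (diff_class_fdiff (diff_class_fdiff hc)).
have h2 := diff_class_fdiff hc.
have h3 := diff_classD (diff_class_shift mu0 A0' nV h2) h2.
have hB' : diff_class a K mu (B / mu) (fun=> 1) (fun l => lam / (l.+1%:R + lam)).
  exact: (@diff_class_shift _ _ _ _ _ _ _ mu0 B0' _ hB).
have AA : 0 <= A / mu + A / mu by rewrite addr_ge0.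
have n1 : nonincr (fun=> 1 : R) by move=> l.
have h4 := diff_classN (diff_classM mu0 AA B0' n1 (diff_class_le (leqnSn K) h3) hB').
have h5 : diff_class a K mu (A / mu / mu + 2 ^+ K * (A / mu + A / mu) * (B / mu)) V (fun l => zlap c l.+1).
  move=> k l kK al; have := diff_classD h1 (V := V) (B := 2 ^+ K * (A / mu + A / mu) * (B / mu)) (h := fun l =>
    - ((fdiff c l.+1 + fdiff c l) * (lam / (l.+1%:R + lam)))) _ kK al.
  rewrite (@eq_iter_fdiff _ _ (fun l => zlap c l.+1)); last first.
    by move=> i; rewrite /zlap /fdiff /=; ring.
  by apply => k' l' kK' al'; have := h4 k' l' kK' al'; rewrite mulr1.
move=> k [//|l] kK; rewrite ltnS => al.
rewrite -iter_fdiff_shift /= (le_trans (h5 k l kK al))// le_eqVlt; apply/orP; left; apply/eqP.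
by rewrite exprS expr2; field; rewrite ?expf_neq0 gt_eqF.
Qed.

Lemma iter_zlap_le a N mu A B V c : 0 < mu -> 0 <= A -> 0 <= B -> nonincr V ->
  diff_class a (2 * N) mu (B / mu) (fun=> 1) (fun l => lam / (l%:R + lam)) ->
  diff_class a (2 * N) mu A V c ->
  forall l, (a + N <= l)%N -> `|iter N zlap c l| <=
    (1 + 2 ^+ (2 * N) * B) ^+ N * A * mu ^- (2 * N) * V (l - N)%N.
Proof.
move=> mu0 A0 B0 nV hB hc; pose X := 1 + 2 ^+ (2 * N) * B.
have X0 : 0 <= X by rewrite addr_ge0// mulr_ge0// exprn_ge0.
suff h i : (i <= N)%N -> diff_class (a + i) (2 * (N - i)) mu (X ^+ i * A * mu ^- (2 * i))
    (fun l => V (l - i)%N) (iter i zlap c).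
  move=> l al; have := h N (leqnn _) 0%N l; rewrite subnn muln0 => /(_ isT al).
  by rewrite expr0 invr1 mulr1.
elim: i => [_|i IH iN].
  move=> k l kK al; rewrite !subn0 in kK *; rewrite addn0 in al.
  by rewrite muln0 !expr0 mul1r invr1 mulr1; exact: hc.
have hi := IH (ltnW iN).
have C0 : 0 <= X ^+ i * A * mu ^- (2 * i).
  by rewrite mulr_ge0// ?mulr_ge0 ?invr_ge0 ?exprn_ge0// ltW.
have nVi : nonincr (fun l => V (l - i)%N).
  by move=> l; case: (leqP i l) => il; [rewrite subSn|rewrite (eqP il) (eqP (ltnW il))].
have e : (2 * (N - i) = (2 * (N - i.+1)).+2)%N by lia.
rewrite e in hi.
have hBi : diff_class (a + i) (2 * (N - i.+1)) mu (B / mu) (fun=> 1) (fun l => lam / (l%:R + lam)).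
  by move=> k l kK al; apply: hB; [lia|lia].
have := zlap_class mu0 C0 B0 nVi hBi hi.
rewrite addnS => h k l kK al; apply: (le_trans (h k l kK al)).
rewrite [V (l.-1 - i)%N](_ : _ = V (l - i.+1)%N); last by congr V; lia.
have V0 : 0 <= (X ^+ i * A * mu ^- (2 * i)) * mu ^- k * V (l - i.+1)%N.
  have al' : (a + i <= l.-1)%N by lia.
  have := hi k l.-1 (leq_trans kK (leqW (leqnSn _))) al'.
  rewrite [V (l.-1 - i)%N](_ : _ = V (l - i.+1)%N); last by congr V; lia.
  exact: le_trans (normr_ge0 _).
rewrite [leLHS](_ : _ = mu ^- 2 * ((1 + 2 ^+ (2 * (N - i.+1)).+1 * B) *
   ((X ^+ i * A * mu ^- (2 * i)) * mu ^- k * V (l - i.+1)%N))); last by ring.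
rewrite [leRHS](_ : _ = mu ^- 2 * (X * ((X ^+ i * A * mu ^- (2 * i)) * mu ^- k * V (l - i.+1)%N))); last first.
  by rewrite mulnS exprD invfM exprS; ring.
rewrite ler_wpM2l ?invr_ge0 ?exprn_ge0 ?(ltW mu0)// ler_wpM2r// lerD2l ler_wpM2r//.
by rewrite ler_weXn2l ?ler1n//; lia.
Qed.

End ZonalLaplacian.

Section GegenbauerAtOne.
Context {R : realType} (d : nat).
Hypothesis hd : (2 <= d)%N.
Local Notation lam := (@eta R d).
Local Notation G1 l := ((gegenbauer lam l).[1]).

Definition zonal_weight l : R := (l%:R + lam) * G1 l.
Local Notation w := zonal_weight.

Let lam2 : 2 * lam = d.-1%:R.
Proof. by rewrite eta2 -subn1 natrB// (leq_trans _ hd). Qed.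

(** Thus G_l(1) is the binomial coefficient of l + d - 2 over l; only the ratio of consecutive
    values is used. *)
Lemma gegenbauerS1 l : l.+1%:R * G1 l.+1 = (l + d.-1)%:R * G1 l.
Proof.
elim: l => [|l IH].
  by rewrite /= hornerZ hornerX hornerC mul1r !mulr1 add0n lam2.
have := gegenbauer_rec lam l 1; rewrite mulr1 lam2 -natrD -IH => ->.
rewrite mulrDr lam2 -mulrBl; congr (_ * _).
by rewrite natrD; ring.
Qed.

Lemma gegenbauer1_gt0 l : 0 < G1 l.
Proof.
elim: l => [|l IH]; first by rewrite /= hornerC.
have : 0 < l.+1%:R * G1 l.+1 by rewrite gegenbauerS1 mulr_gt0// ltr0n; lia.
by rewrite pmulr_rgt0 ?ltr0n.
Qed.

Lemma zonal_weight_gt0 l : 0 < w l.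
Proof.
by rewrite mulr_gt0 ?gegenbauer1_gt0// ltr_wpDl// (eta_gt0 hd).
Qed.

Lemma zonal_weight_le l l' : (l <= l')%N -> w l <= w l'.
Proof.
move=> ll; rewrite ler_pM ?(ltW (gegenbauer1_gt0 _))//.
- by rewrite addr_ge0// ltW// (eta_gt0 hd).
- by rewrite lerD2r ler_nat.
elim: l' ll => [|l' IH]; first by rewrite leqn0 => /eqP ->.
rewrite leq_eqVlt => /orP[/eqP -> //|]; rewrite ltnS => /IH /le_trans; apply.
rewrite -(@ler_pM2l _ l'.+1%:R) ?ltr0n// gegenbauerS1 ler_wpM2r ?(ltW (gegenbauer1_gt0 _))//.
by rewrite ler_nat; lia.
Qed.

(** Bernoulli's inequality for (1 + 1/l)^(e+1), cleared of denominators. *)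
Let bernoulli_nat (l e : nat) : ((l + e.+1) * l ^ e <= l.+1 ^ e.+1)%N.
Proof.
elim: e => [|e IH]; first by rewrite expn0 expn1 muln1 addn1.
rewrite [leqRHS]expnS; apply: (@leq_trans (l.+1 * ((l + e.+1) * l ^ e))).
  rewrite expnS; move: (l ^ e)%N => X; nia.
by rewrite leq_mul2l IH orbT.
Qed.

(** G_l(1) / l^(d-2) is nonincreasing, by Bernoulli's inequality against the ratio (l + d - 1) / (l
    + 1); the factor l + lam accounts for the last power of p. *)
Lemma zonal_weight_doubling p l l' : (0 < l)%N -> (l <= l')%N -> (l' <= p * l)%N ->
  w l' <= p%:R ^+ d.-1 * w l.
Proof.
move=> l0 ll lp.
have [e ed] : exists e, d.-1 = e.+1 by exists d.-2; lia.
have grow : G1 l' * l%:R ^+ e <= G1 l * l'%:R ^+ e.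
  elim: l' ll {lp} => [|l' IH]; first by rewrite leqn0 => /eqP ->.
  rewrite leq_eqVlt => /orP[/eqP -> //|]; rewrite ltnS => ll; have := IH ll.
  have l'0 : 0 < l'%:R :> R by rewrite ltr0n (leq_trans l0).
  move=> h; rewrite -(@ler_pM2l _ (l'.+1%:R * l'%:R ^+ e)); last first.
    by rewrite mulr_gt0 ?exprn_gt0// ltr0n.
  rewrite (_ : _ * (G1 l'.+1 * _) = (l' + d.-1)%:R * l'%:R ^+ e * (G1 l' * l%:R ^+ e)); last first.
    by rewrite mulrACA [l'.+1%:R * _]mulrC -[RHS]mulrA; have := gegenbauerS1 l'; move: (G1 l'.+1) => X eq1;
       rewrite [X * _]mulrC eq1; ring.
  apply: (@le_trans _ _ ((l' + d.-1)%:R * l'%:R ^+ e * (G1 l * l'%:R ^+ e))).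
    by rewrite ler_wpM2l// mulr_ge0// exprn_ge0.
  rewrite [leLHS](_ : _ = (G1 l * l'%:R ^+ e) * ((l' + d.-1) * l' ^ e)%:R); last first.
    by rewrite natrM natrX; ring.
  rewrite [leRHS](_ : _ = (G1 l * l'%:R ^+ e) * (l'.+1 ^ d.-1)%:R); last first.
    by rewrite natrX ed exprS; ring.
  rewrite ler_wpM2l//; first by rewrite mulr_ge0 ?exprn_ge0// ltW// gegenbauer1_gt0.
  rewrite ler_nat; rewrite ed.
  exact: bernoulli_nat.
have lp' : l'%:R <= p%:R * l%:R :> R by rewrite -natrM ler_nat.
have ld : 0 < l%:R ^+ e :> R by rewrite exprn_gt0// ltr0n.
rewrite -(ler_pM2r ld) /zonal_weight.
have p1 : 1 <= p%:R :> R by rewrite ler1n; nia.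
have hl : l'%:R + lam <= p%:R * (l%:R + lam).
  by rewrite mulrDr lerD// ler_peMl// ltW// (eta_gt0 hd).
apply: (@le_trans _ _ ((p%:R * (l%:R + lam)) * (G1 l * (p%:R * l%:R) ^+ e))).
  rewrite -[leLHS]mulrA ler_pM//.
  - by rewrite addr_ge0// ltW// (eta_gt0 hd).
  - by rewrite mulr_ge0 ?exprn_ge0// ltW// gegenbauer1_gt0.
  rewrite (le_trans grow)// ler_wpM2l ?(ltW (gegenbauer1_gt0 _))//.
  by rewrite lerXn2r ?nnegrE ?mulr_ge0.
by rewrite ed exprMn exprS le_eqVlt; apply/orP; left; apply/eqP; ring.
Qed.

End GegenbauerAtOne.

Section WeightedSums.
Context {R : realType}.

(** Each r < M is the quotient of exactly p indices, so a sum over a block controls one over a range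
    p times as long. *)
Lemma sum_divn (f : nat -> R) p M : (0 < p)%N ->
  \sum_(i < M * p) f (i %/ p)%N = p%:R * \sum_(r < M) f r.
Proof.
move=> p0; elim: M => [|M IH]; first by rewrite mul0n !big_ord0 mulr0.
rewrite mulSnr big_split_ord /= IH big_ord_recr /= mulrDr; congr (_ + _).
rewrite (eq_bigr (fun=> f M)); last first.
  by move=> i _; rewrite divnMDl// divn_small ?addn0.
by rewrite sumr_const card_ord mulr_natl.
Qed.

(* An index s + i is compared with s + i / p (rather than s + i %% M: M may be
   much larger than s), and an index s - 1 - i again with s + i / p. *)
Lemma weighted_sum_le (w : nat -> R) (alpha S0 W : R) (s M p lo hi : nat) :
  (forall l, 0 <= w l) -> (forall l l', (l <= l')%N -> w l <= w l') ->
  (forall l l', (0 < l)%N -> (l <= l')%N -> (l' <= p * l)%N -> w l' <= W * w l) ->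
  0 <= alpha -> 0 <= W -> (0 < p)%N -> 1 <= S0 -> S0 <= s%:R <= S0 + 1 ->
  (hi <= s + M * p)%N -> (s <= lo + M * p)%N -> s%:R - lo%:R <= 2 * S0 ->
  \sum_(lo <= l < hi) Num.max l%:R S0 `^ (- alpha) * w l <=
  p%:R * (W + 4 `^ alpha) * \sum_(r < M) (s + r)%:R `^ (- alpha) * w (s + r)%N.
Proof.
move=> w0 wle wdbl a0 W0 p0 S1 /andP[Ss sS] hhi hlo hlo2.
have S00 : 0 < S0 by exact: lt_le_trans S1.
have s0 : (0 < s)%N by rewrite -(ltr0n R) (lt_le_trans S00).
pose F l := Num.max l%:R S0 `^ (- alpha) * w l.
have F0 l : 0 <= F l by rewrite mulr_ge0// powR_ge0.
pose f r := (s + r)%:R `^ (- alpha) * w (s + r)%N.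
have f0 r : 0 <= f r by rewrite mulr_ge0// powR_ge0.
have powle (x y : R) : 0 < x -> x <= y -> y `^ (- alpha) <= x `^ (- alpha).
  move=> x0 xy; rewrite !powRN lef_pV2 ?posrE ?powR_gt0//; last exact: lt_le_trans xy.
  by rewrite ge0_ler_powR// nnegrE (le_trans (ltW x0)).
have shiftE : \sum_(i < M * p) F (s + i)%N = \sum_(s <= i < s + M * p) F i.
  rewrite -(big_mkord xpredT (fun i => F (s + i)%N)).
  rewrite -[X in _ = \sum_(X <= _ < _) _]add0n big_addn addKn.
  by apply: eq_bigr => i _; rewrite addnC.
have up : \sum_(i < M * p) F (s + i)%N <= p%:R * W * \sum_(r < M) f r.
  rewrite mulrAC -sum_divn// mulr_suml; apply: ler_sum => i _; rewrite mulrC.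
  have ir : (i %/ p <= i)%N by exact: leq_div.
  have hi2 : (s + i <= p * (s + i %/ p))%N.
    by have := divn_eq i p; have := ltn_pmod i p0; nia.
  rewrite /F /f max_l; last by rewrite natrD (le_trans Ss)// lerDl.
  rewrite mulrCA ler_pM ?powR_ge0//.
    by apply: powle; rewrite ?ltr0n ?addn_gt0 ?s0// ler_nat leq_add2l.
  by apply: wdbl; rewrite ?addn_gt0 ?s0// leq_add2l.
have down : \sum_(i < s - lo) F (s.-1 - i)%N <= p%:R * 4 `^ alpha * \sum_(r < M) f r.
  rewrite mulrAC -sum_divn// mulr_suml.
  have le : (s - lo <= M * p)%N by rewrite leq_subLR.
  rewrite [leRHS](_ : _ = \sum_(i < s - lo) f (i %/ p)%N * 4 `^ alpha +
     \sum_(s - lo <= i < M * p) f (i %/ p)%N * 4 `^ alpha); last first.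
    rewrite -!(big_mkord xpredT (fun i => f (i %/ p)%N * 4 `^ alpha)).
    by rewrite (big_cat_nat (n := (s - lo)%N)).
  rewrite ler_wpDr ?sumr_ge0// => [i _|]; first by rewrite mulr_ge0// powR_ge0.
  apply: ler_sum => i _; have ir : (i %/ p <= i)%N by exact: leq_div.
  rewrite /F /f mulrAC ler_pM ?powR_ge0//; last first.
    by apply: wle; rewrite (leq_trans (leq_subr _ _))// (leq_trans (leq_pred _))// leq_addr.
  apply: (@le_trans _ _ (S0 `^ (- alpha))).
    by apply: powle => //; rewrite le_max lexx orbT.
  have h4 : (s + i %/ p)%:R <= 4 * S0.
    have iS : (i : nat)%:R <= 2 * S0.
      apply: le_trans hlo2; rewrite -natrB; last by have := ltn_ord i; lia.
      by rewrite ler_nat ltnW.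
    have : (i %/ p)%:R <= 2 * S0 by apply: le_trans iS; rewrite ler_nat.
    by rewrite natrD; lra.
  have -> : S0 `^ (- alpha) = 4 `^ alpha * (4 * S0) `^ (- alpha).
    by rewrite powRM// ?(ltW S00)// mulrA -powRD ?subrr ?powRr0 ?mul1r// pnatr_eq0 implybT.
  rewrite mulrC ler_wpM2r ?powR_ge0//; apply: powle => //.
  by rewrite ltr0n addn_gt0 s0.
case: (leqP lo s) => los; last first.
  apply: (@le_trans _ _ (\sum_(i < M * p) F (s + i)%N)).
    have [hl|hl] := leqP hi lo; first by rewrite big_geq// sumr_ge0.
    rewrite shiftE.
    rewrite (big_cat_nat (ltnW los) (leq_trans (ltnW hl) hhi)) /=.
    rewrite (big_cat_nat (ltnW hl) hhi) /=.
    by rewrite ler_wpDl ?sumr_ge0// lerDl sumr_ge0.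
  apply: (le_trans up); rewrite ler_wpM2r ?sumr_ge0// ler_wpM2l// lerDl powR_ge0//.
apply: (@le_trans _ _ (\sum_(lo <= l < s + M * p) F l)).
  have [hl|hl] := leqP lo hi; last by rewrite big_geq ?sumr_ge0// ltnW.
  by rewrite [leRHS](big_cat_nat (n := hi))//= lerDl sumr_ge0.
rewrite (big_cat_nat los (leq_addr (M * p) s)) /=.
rewrite addrC mulrDr mulrDl lerD//.
  by apply: le_trans up; rewrite shiftE.
apply: le_trans down; rewrite -(big_mkord xpredT (fun i => F (s.-1 - i)%N)).
rewrite -{1}[lo]add0n big_addn big_nat_rev /= add0n.
rewrite le_eqVlt; apply/orP; left; apply/eqP.
rewrite big_nat_cond [RHS]big_nat_cond; apply: eq_bigr => i /andP[/andP[_ hi1] _].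
by congr F; lia.
Qed.

End WeightedSums.

(** * Weight functions and decay of the correlation *)

Section Weights.
Context {R : realType}.
Implicit Types (f : R -> R).
Local Notation D := [set` (`[0, +oo[ : interval R)].

(** Near an interior point the domain fills a neighbourhood, so the derivative within it is the
    ordinary one; Caratheodory's criterion makes the passage. *)
Lemma derive_withinP f (u : R) : 0 < u -> derivable_within D f u ->
  is_derive u 1 f (derive_within D f u).
Proof.
move=> u0 hc; set a := derive_within D f u.
apply/is_derive1_caratheodory; exists (fun z => if z == u then a else diff_quotient f u z).
rewrite eqxx; split=> //.
  move=> z; case: eqVneq => [->|zu]; first by rewrite !subrr mulr0.
  by rewrite /diff_quotient divfK// subr_eq0.
apply/continuous_withinNx; rewrite eqxx.
have h : diff_quotient f u y @[y --> within (D `\ u) (nbhs u)] --> a := hc.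
apply: cvg_trans h => A hA.
have {}hA : \forall y \near u, (D `\ u) y -> A (diff_quotient f u y) := hA.
change (\forall z \near u, z != u -> A (if z == u then a else diff_quotient f u z)).
have n0 : \forall y \near u, 0 < y by exact: lt_nbhsr.
near=> y => yu; have y0 : 0 < y by near: y.
rewrite (negbTE yu); apply: (near hA y) => //; split; last exact/eqP.
by rewrite /= in_itv /= andbT ltW.
Unshelve. all: by end_near.
Qed.

Lemma smooth_tower f : smooth_on D f ->
  derivative_tower (fun n => derive_within_n D n f).
Proof.
move=> sf n u u0; apply: derive_withinP => //; apply: sf.
by rewrite /= in_itv /= andbT ltW.
Qed.

Lemma tower_vanish (F : nat -> R -> R) (c : R) : derivative_tower F ->
  (forall u, 0 < u < c -> F 0%N u = 0) -> forall n u, 0 < u < c -> F n u = 0.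
Proof.
move=> tF F0; elim=> // n IH u /andP[u0 uc].
have h := tF n u u0.
have e : \forall z \near u, cst 0 z = F n z.
  near=> z; rewrite IH//; apply/andP; split.
    by near: z; exact: lt_nbhsr.
  by near: z; exact: lt_nbhsl.
have [_ d0] := near_eq_is_derive e (is_derive_cst (0 : R) u (1 : R)).
by have [_ <-] := h.
Unshelve. all: by end_near.
Qed.

(* Vanishing on ]0, 1[ turns a bound on the derivative of order k + n into one
   on the derivative of order k that is small for small u. *)
Lemma tower_flat_le (F : nat -> R -> R) (K : nat -> R) (delta : R) : derivative_tower F ->
  (forall n u, 0 < u < 1 -> F n u = 0) ->
  (forall n u, 0 < u -> `|F n u| <= K n * delta ^- n) ->
  forall n k u, 0 < u -> `|F k u| <= K (k + n)%N * delta ^- (k + n) * u ^+ n.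
Proof.
move=> tF F0 hK; elim=> [|n IH] k u u0; first by rewrite addn0 mulr1 hK.
have K0 : 0 <= K (k + n.+1)%N * delta ^- (k + n.+1) by exact: le_trans (hK _ _ u0).
have [u1|u1] := ltP u 1; first by rewrite F0 ?u0// normr0 mulr_ge0// exprn_ge0// ltW.
have hu : 2^-1 < u by apply: lt_le_trans u1; rewrite invf_lt1 ?ltr1n.
have h2 : 0 < (2^-1 : R) < 1 by rewrite invr_gt0 ltr0n invf_lt1 ?ltr1n.
have h (v : R) : v \in `]2^-1, u[ -> is_derive v 1 (F k) (F k.+1 v).
  by rewrite in_itv /= => /andP[v0 _]; apply: tF; apply: lt_trans v0; rewrite invr_gt0.
have cont : {within `[2^-1, u], continuous (F k)}.
  apply: continuous_in_subspaceT => v; rewrite inE /= in_itv /= => /andP[v0 _].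
  apply: differentiable_continuous; apply/derivable1_diffP.
  by have [] := tF k v (lt_le_trans (proj1 (andP h2)) v0).
have [v + e] := MVT hu h cont; rewrite in_itv /= => /andP[v1 v2].
have v0 : 0 < v by apply: lt_trans v1; rewrite invr_gt0.
move: e; rewrite (F0 k _ h2) subr0 => ->; rewrite normrM exprSr mulrA -addSnnS.
apply: ler_pM => //.
  apply: (le_trans (IH k.+1 v v0)); rewrite addSnnS ler_wpM2l//.
  by apply: lerXn2r; rewrite ?nnegrE ltW.
by rewrite ger0_norm ?subr_ge0 ?(ltW hu)// gerBl invr_ge0.
Qed.

Variables (S : nat -> R) (b : nat -> R -> R).
Hypotheses (hS : scale_sequence S) (hb : weight_functions S b).

Lemma scale_ge1 j : 1 <= S j.
Proof.
elim: j => [|j IH]; first by rewrite (scale_0 hS).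
by rewrite (le_trans IH)// ltW// (scale_increasing hS).
Qed.

Lemma scale_le i j : (i <= j)%N -> S i <= S j.
Proof.
elim: j => [|j IH]; first by rewrite leqn0 => /eqP ->.
rewrite leq_eqVlt => /orP[/eqP -> //|]; rewrite ltnS => /IH /le_trans; apply.
exact: ltW (scale_increasing hS j).
Qed.

Lemma weight_eq0 j u : (0 < j)%N -> 0 <= u -> u <= S j.-1 \/ S j.+1 <= u -> b j u = 0.
Proof.
move=> j0 u0 h; apply/eqP; apply: contrapT => /negP bu.
have : closure [set u | 0 <= u /\ b j u != 0] u by apply: subset_closure.
move/(weight_support hb j0); rewrite /= in_itv /= => /andP[h1 h2].
case: h => h.
  by move: bu; rewrite (_ : u = S j.-1) ?(weight_left hb j0) ?eqxx//; apply/le_anti/andP.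
by move: bu; rewrite (_ : u = S j.+1) ?(weight_right hb j) ?eqxx//; apply/le_anti/andP.
Qed.

(** For j = 0 there is no S_(j-1), and the location of the support is unknown; its compactness
    provides the threshold U of [weight_right_ge]. *)
Lemma weight0_eq0 : exists U : R, forall u, U <= u -> 0 <= u -> b 0%N u = 0.
Proof.
have [M [Mr hM]] := @compact_bounded _ R^o _ (@weight_compact _ _ _ hb 0%N).
exists (M + 2) => u Mu u0; apply/eqP; apply: contrapT => /negP bu.
have : closure [set u | 0 <= u /\ b 0%N u != 0] u by apply: subset_closure.
have M1 : M < M + 1 by rewrite ltrDl.
by move/(hM _ M1) => /=; rewrite ger0_norm//; lra.
Qed.

(* On [S_j, S_(j+1)] only b_j and b_(j+1) are non-zero, and b_(j+1) grows at
   rate at most K / (S_(j+1) - S_j). *)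
Lemma weight_right_ge : exists U c : R, [/\ 0 < c, c <= 1 & forall j u, (0 < j)%N -> U <= S j ->
  S j <= u <= S j + c * (S j.+1 - S j) -> 3 / 4 <= b j u ^+ 2].
Proof.
have [U hU] := weight0_eq0; have [K0 hK0] := weight_derive hb 1%N.
pose K := Num.max K0 1.
have K1 : 1 <= K by rewrite le_max lexx orbT.
have hK j u : (0 < j)%N -> 0 <= u -> `|derive_within_n D 1 (b j) u| <= K / (S j - S j.-1).
  move=> j0 u0; apply: (le_trans (hK0 j u j0 u0)); rewrite expr1 ler_wpM2r ?le_max ?lexx//.
  rewrite invr_ge0 subr_ge0; case: j {u0} j0 => // j _; exact: ltW (scale_increasing hS j).
have Kp : 0 < K by exact: lt_le_trans K1.
exists U, (2 * K)^-1; split; first by rewrite invr_gt0 mulr_gt0.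
  by rewrite invf_le1 ?mulr_gt0//; lra.
move=> j u j0 US /andP[Su uS].
have dS : 0 < S j.+1 - S j by rewrite subr_gt0 (scale_increasing hS).
have S0 : 0 < S j by exact: lt_le_trans (scale_ge1 j).
have u0 : 0 < u by exact: lt_le_trans Su.
have uS1 : u <= S j.+1.
  apply: (le_trans uS); rewrite -lerBrDl ler_piMl ?(ltW dS)//.
  by rewrite invf_le1 ?mulr_gt0//; lra.
have b1 : `|b j.+1 u| <= 2^-1.
  have h (v : R) : v \in `]S j, u[ -> is_derive v 1 (b j.+1) (derive_within_n D 1 (b j.+1) v).
    rewrite in_itv /= => /andP[v0 _]; apply: (smooth_tower (@weight_smooth _ _ _ hb j.+1) 0%N).
    exact: lt_trans v0.
  have cont : {within `[S j, u], continuous (b j.+1)}.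
    apply: continuous_in_subspaceT => v; rewrite inE /= in_itv /= => /andP[v0 _].
    apply: differentiable_continuous; apply/derivable1_diffP.
    by have [] := smooth_tower (@weight_smooth _ _ _ hb j.+1) 0%N (lt_le_trans S0 v0).
  have [v + e] := MVT_segment Su h cont; rewrite in_itv /= => /andP[v1 v2].
  move: e; rewrite (@weight_left _ _ _ hb j.+1)// subr0 => ->.
  rewrite normrM [`|u - _|]ger0_norm ?subr_ge0//.
  apply: (@le_trans _ _ (K / (S j.+1 - S j) * ((2 * K)^-1 * (S j.+1 - S j)))).
    apply: ler_pM => //; first by rewrite subr_ge0.
      by apply: hK => //; exact: le_trans (ltW S0) v1.
    by rewrite lerBlDl.
  by rewrite le_eqVlt; apply/orP; left; apply/eqP; field; rewrite !gt_eqF.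
have un := weight_unity hb (le_trans (scale_ge1 j) Su).
have h : series (fun j => b j u ^+ 2) @ \oo --> b j u ^+ 2 + b j.+1 u ^+ 2.
  apply: cvg_near_cst; near=> n.
  have jn : (j.+2 <= n)%N by near: n; exact: nbhs_infty_ge.
  rewrite /series /= (big_cat_nat (n := j.+2))//= [X in _ + X](_ : _ = 0) ?addr0.
    rewrite !big_nat_recr//= [X in X + _ + _](_ : _ = 0) ?add0r//.
    rewrite big_nat_cond big1// => i /andP[/andP[_ ij] _].
    case: i ij => [_|i ij].
      by rewrite hU ?expr0n// ?(ltW u0)// (le_trans US).
    rewrite weight_eq0 ?expr0n// ?(ltW u0)//; right.
    by rewrite (le_trans _ Su)// scale_le.
  rewrite big_nat_cond big1// => -[//|i] /andP[/andP[ij _] _].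
  by rewrite weight_eq0 ?expr0n ?(ltW u0)//; left; rewrite (le_trans uS1)// scale_le.
have e : b j u ^+ 2 + b j.+1 u ^+ 2 = 1.
  by rewrite -(cvg_lim (@Rhausdorff R) h) (cvg_lim (@Rhausdorff R) un).
have b2 : b j.+1 u ^+ 2 <= 2^-1 ^+ 2.
  by rewrite -[leLHS]real_normK ?num_real//; apply: lerXn2r; rewrite ?nnegrE ?invr_ge0.
have q : 2^-1 ^+ 2 = 4^-1 :> R by rewrite expr2 -invfM -natrM.
by lra.
Unshelve. all: by end_near.
Qed.

(** If S_j - S_(j-1) < S_j / 2 or l >= S_j, then l / S_j >= 1/4 on the range considered, and the
    plain derivative bound suffices. Otherwise S_j - S_(j-1) is comparable to S_j, and
    [tower_flat_le] converts n further derivatives into (l / S_j)^n. *)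
Lemma weight_diff_class n K : exists2 B : R, 0 <= B & forall j a mu, (0 < j)%N ->
  0 < mu <= S j - S j.-1 -> (0 < a)%N -> S j.-1 / 2 <= a%:R ->
  diff_class a K mu B (fun l => Num.min 1 (l%:R / S j) ^+ n) (fun l => b j l%:R).
Proof.
have [A hA] := choice (weight_derive hb).
(* The first term serves the plain bound, with 4^n from l / S_j >= 1/4; the second the flat bound,
   with (l + k) / (S_j - S_(j-1)) <= 2 (k + 1) l / S_j. *)
pose Ak k := `|A k| * 4 ^+ n + `|A (k + n)%N| * (2 * k.+1%:R) ^+ n.
have Ak0 k : 0 <= Ak k by rewrite addr_ge0// mulr_ge0// exprn_ge0// mulr_ge0.
exists (\sum_(k < K.+1) Ak k) => [|j a mu j0 /andP[mu0 muD] a0 aS k l kK al].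
  exact: sumr_ge0.
set D' := S j - S j.-1 in muD *.
have D0 : 0 < D' by exact: lt_le_trans muD.
have Sj0 : 0 < S j by exact: lt_le_trans (scale_ge1 j).
pose F k := derive_within_n D k (b j).
have tF : derivative_tower F := smooth_tower (@weight_smooth _ _ _ hb j).
have F1 k' u : 0 < u -> `|F k' u| <= `|A k'| * D' ^- k'.
  move=> u0; apply: (le_trans (hA k' j u j0 (ltW u0))).
  by rewrite ler_wpM2r ?ler_norm// invr_ge0 exprn_ge0// ltW.
have F0 k' u : 0 < u < 1 -> F k' u = 0.
  apply: tower_vanish => // v /andP[v0 v1]; apply: weight_eq0 => //; first exact: ltW.
  by left; rewrite (le_trans (ltW v1))// scale_ge1.
have l0 : (0 < l)%N by exact: leq_trans al.
have lp : 0 < l%:R :> R by rewrite ltr0n.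
have h1 : `|iter k fdiff (fun l => b j l%:R) l| <= `|A k| * D' ^- k.
  apply: (tower_fdiff_le tF l0) => v /andP[lv _]; apply: F1; exact: lt_le_trans lv.
have h2 : `|iter k fdiff (fun l => b j l%:R) l| <=
    `|A (k + n)%N| * D' ^- (k + n) * (l + k)%:R ^+ n.
  apply: (tower_fdiff_le tF l0) => v /andP[lv vl].
  have v0 : 0 < v by exact: lt_le_trans lv.
  apply: (le_trans (tower_flat_le tF F0 F1 n k v0)).
  rewrite ler_wpM2l ?mulr_ge0 ?invr_ge0 ?exprn_ge0 ?(ltW D0)//.
  by apply: lerXn2r; rewrite ?nnegrE// ltW.
set m := Num.min 1 (l%:R / S j).
have m0 : 0 <= m by rewrite le_min ler01 divr_ge0// ltW.
have hk : `|iter k fdiff (fun l => b j l%:R) l| <= Ak k * D' ^- k * m ^+ n.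
  have Dk : 0 <= D' ^- k by rewrite invr_ge0 exprn_ge0// ltW.
  have q0 : 0 <= `|A (k + n)%N| * (2 * k.+1%:R) ^+ n * (D' ^- k * m ^+ n).
    by rewrite !mulr_ge0// exprn_ge0// mulr_ge0.
  have case1 : 1 <= 4 * m -> `|iter k fdiff (fun l => b j l%:R) l| <= Ak k * D' ^- k * m ^+ n.
    move=> m4; apply: (le_trans h1); rewrite -mulrA /Ak mulrDl ler_wpDr//.
    rewrite -mulrA ler_wpM2l// mulrCA ler_peMr// -exprMn exprn_ege1//.
  have [DS|DS] := leP (S j / 2) D'; last first.
    apply: case1; rewrite /m minr_pMr// le_min; apply/andP; split; first lra.
    rewrite mulrA ler_pdivlMr// mul1r.
    have : a%:R <= l%:R :> R by rewrite ler_nat.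
    by move: DS aS; rewrite /D'; lra.
  have [x1|x1] := leP 1 (l%:R / S j).
    by apply: case1; rewrite /m min_l// mulr1 ler1n.
  apply: (le_trans h2); rewrite -[leRHS]mulrA /Ak mulrDl ler_wpDl ?mulr_ge0 ?exprn_ge0//.
  have -> : m = l%:R / S j by rewrite /m min_r// ltW.
  rewrite [leLHS](_ : _ = `|A (k + n)%N| * (D' ^- k * ((l + k)%:R / D') ^+ n)); last first.
    by rewrite exprD exprMn exprVn invfM -!mulrA; congr (_ * (_ * _)); rewrite mulrC.
  rewrite [leRHS](_ : _ = `|A (k + n)%N| * (D' ^- k * (2 * k.+1%:R * (l%:R / S j)) ^+ n)); last first.
    by rewrite -mulrA [X in _ * X]mulrCA -exprMn.
  rewrite ler_wpM2l// ler_wpM2l//; apply: lerXn2r; rewrite ?nnegrE.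
  - by rewrite mulr_ge0// invr_ge0 ltW.
  - by rewrite !mulr_ge0// invr_ge0 ltW.
  rewrite ler_pdivrMr//.
  have lk : (l + k)%:R <= k.+1%:R * l%:R :> R by rewrite -natrM ler_nat mulSn leq_add2l leq_pmulr.
  apply: (le_trans lk).
  rewrite (_ : 2 * _ * _ * _ = (k.+1%:R * l%:R) * (D' / (S j / 2))); last by field; rewrite gt_eqF.
  by rewrite ler_peMr ?mulr_ge0// ler_pdivlMr ?mul1r// divr_gt0.
apply: (le_trans hk); rewrite ler_wpM2r ?exprn_ge0//.
rewrite -ltnS in kK.
rewrite ler_pM ?invr_ge0 ?exprn_ge0 ?(ltW D0)//.
  by rewrite (bigD1 (Ordinal kK))//= lerDl sumr_ge0.
rewrite lef_pV2 ?posrE ?exprn_gt0//; apply: lerXn2r; rewrite ?nnegrE// ltW//.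
Qed.

End Weights.

Section PowerClasses.
Context {R : realType}.

Lemma le_powRN (x y e : R) : 0 < x -> x <= y -> 0 <= e -> y `^ (- e) <= x `^ (- e).
Proof.
move=> x0 xy e0; rewrite !powRN lef_pV2 ?posrE ?powR_gt0//; last exact: lt_le_trans xy.
by rewrite ge0_ler_powR// nnegrE (le_trans (ltW x0)).
Qed.

(** Used with e = alpha, s = 0 for the spectrum and with e = 1, s = lam for the factor in [zlap].
    Each derivative gains 1 / (l + s), which is at most 1 / mu. *)
Lemma powR_diff_class K (e s : R) : 0 <= e -> 0 <= s -> exists2 B : R, 0 <= B &
  forall a mu, (0 < a)%N -> 0 < mu <= a%:R ->
  diff_class a K mu B (fun l => (l%:R + s) `^ (- e)) (fun l => (l%:R + s) `^ (- e)).
Proof.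
move=> e0 s0; exists (\sum_(k < K.+1) `|falling (- e) k|); first exact: sumr_ge0.
move=> a mu a0 /andP[mu0 mua] k l kK al.
have l0 : (0 < l)%N by exact: leq_trans al.
have lp : 0 < l%:R :> R by rewrite ltr0n.
have mul : mu <= l%:R by rewrite (le_trans mua)// ler_nat.
have -> : iter k fdiff (fun l => (l%:R + s) `^ (- e)) l =
    iter k fdiff (fun l => falling (- e) 0 * (l%:R + s) `^ (- e - 0%:R)) l.
  by apply: eq_iter_fdiff => i; rewrite /falling big_ord0 mul1r subr0.
apply: (tower_fdiff_le (F := fun n u => falling (- e) n * (u + s) `^ (- e - n%:R)) _ l0).
  exact: tower_powR.
move=> v /andP[lv _]; rewrite normrM [`|_ `^ _|]ger0_norm ?powR_ge0// -mulrA.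
rewrite -ltnS in kK; apply: ler_pM => //; first exact: powR_ge0.
  by rewrite (bigD1 (Ordinal kK))//= lerDl sumr_ge0.
have ls : 0 < l%:R + s by rewrite ltr_wpDr.
have vs : l%:R + s <= v + s by rewrite lerD2r.
rewrite -opprD; apply: (@le_trans _ _ ((l%:R + s) `^ (- (e + k%:R)))).
  by apply: le_powRN => //; rewrite addr_ge0.
rewrite opprD powRD; last by rewrite (gt_eqF ls) implybT.
rewrite mulrC ler_wpM2r ?powR_ge0// powRN powR_mulrn ?(ltW ls)//.
rewrite lef_pV2 ?posrE ?exprn_gt0//; apply: lerXn2r; rewrite ?nnegrE ?(ltW mu0) ?(ltW ls)//.
by rewrite (le_trans mul)// lerDl.
Qed.

(** For u >= a and mu <= a^(1 - beta), the decay u^(-(1 - beta) k) is at most mu^(-k). Only orders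
    up to K occur, so a single threshold U serves them all. *)
Lemma growth_diff_class K (beta : R) (g : R -> R) :
  (forall n u, 0 < u -> derivable (derive1n n g) u 1) -> beta < 1 ->
  (forall r : nat, exists M : R, \forall u \near +oo,
     `|derive1n r g u| <= M * u `^ (- ((1 - beta) * r%:R))) ->
  exists2 B : R, 0 <= B & exists U : R, forall a mu, (0 < a)%N -> U <= a%:R ->
  0 < mu -> mu <= a%:R `^ (1 - beta) ->
  diff_class a K mu B (fun=> 1) (fun l => g l%:R).
Proof.
move=> gs b1 hg; have [M hM] := choice hg.
have {hM}[U hU] : exists U : R, forall k, (k <= K)%N -> forall u, U <= u ->
    `|derive1n k g u| <= M k * u `^ (- ((1 - beta) * k%:R)).
  elim: K => [|K [U hU]].
    have [U [_ hU]] := hM 0%N; exists (U + 1) => k; rewrite leqn0 => /eqP -> u uU.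
    by apply: hU; apply: lt_le_trans uU; rewrite ltrDl.
  have [U' [_ hU']] := hM K.+1; exists (Num.max U (U' + 1)) => k.
  rewrite leq_eqVlt => /orP[/eqP ->|kK] u; rewrite ge_max => /andP[u1 u2]; last exact: hU.
  by apply: hU'; apply: lt_le_trans u2; rewrite ltrDl.
exists (\sum_(k < K.+1) `|M k|); first exact: sumr_ge0.
exists U => a mu a0 Ua mu0 mua k l kK al.
have l0 : (0 < l)%N by exact: leq_trans al.
have lp : 0 < l%:R :> R by rewrite ltr0n.
have tg : derivative_tower (fun n => derive1n n g).
  move=> n u u0; apply: DeriveDef; first exact: gs.
  by rewrite derive1nS -derive1E.
rewrite mulr1; apply: (tower_fdiff_le tg l0) => v /andP[lv _].
have alR : a%:R <= l%:R :> R by rewrite ler_nat.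
apply: (le_trans (hU k kK v _)); first by rewrite (le_trans Ua)// (le_trans alR).
have kS := kK; rewrite -ltnS in kS.
apply: (@le_trans _ _ (`|M k| * v `^ (- ((1 - beta) * k%:R)))).
  by rewrite ler_wpM2r ?powR_ge0// ler_norm.
apply: ler_pM => //; first exact: powR_ge0.
  by rewrite (bigD1 (Ordinal kS))//= lerDl sumr_ge0.
rewrite powRN powRrM powR_mulrn ?powR_ge0//.
have v0 : 0 < v by exact: lt_le_trans lv.
rewrite lef_pV2 ?posrE ?exprn_gt0 ?powR_gt0//; apply: lerXn2r; rewrite ?nnegrE ?powR_ge0 ?(ltW mu0)//.
apply: (le_trans mua); rewrite ge0_ler_powR ?nnegrE ?(ltW v0) ?ler0n//; first by rewrite subr_ge0 ltW.
exact: le_trans alR _.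
Qed.

End PowerClasses.

Section Cosine.
Context {R : realType}.

(** Where cos x >= 1/2 the mean value theorem gives sin x >= x / 2. Elsewhere sin^2 x >= 3/4, while
    x < 2 makes the left-hand side at most 1/4. *)
Lemma sin_sqr_ge (x : R) : 0 < x -> x <= pi / 2 -> x ^+ 2 / 16 <= sin x ^+ 2.
Proof.
move=> x0 xp; have x2 : x < 2 by exact: (le_lt_trans xp (pihalf_lt2 R)).
have p0 : 0 < pi :> R := pi_gt0 R.
have [c1|c1] := leP (2^-1) (cos x); last first.
  have c0 : 0 <= cos x by rewrite cos_ge0_pihalf// xp andbT; apply: le_trans (ltW x0); lra.
  have xx : x ^+ 2 <= 2 ^+ 2 by apply: lerXn2r; rewrite ?nnegrE ltW.
  have cc : cos x ^+ 2 <= (2^-1) ^+ 2 by apply: lerXn2r; rewrite ?nnegrE ?invr_ge0// ltW.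
  have q : 2^-1 ^+ 2 = 4^-1 :> R by rewrite expr2 -invfM -natrM.
  by rewrite sin2cos2; lra.
have h (v : R) : v \in `]0, x[ -> is_derive v 1 sin (cos v) by move=> _; exact: is_derive_sin.
have cont : {within `[0, x], continuous (@sin R)}.
  by apply: continuous_subspaceT; exact: continuous_sin.
have [v + e] := MVT x0 h cont; rewrite in_itv /= => /andP[v0 vx].
have cv : cos x <= cos v.
  rewrite ltW// ltr_cos// in_itv /=; apply/andP; split; lra.
move: e; rewrite sin0 !subr0 => ->; rewrite exprMn mulrC ler_wpM2r ?sqr_ge0//.
have : (2^-1) ^+ 2 <= cos v ^+ 2.
  by apply: lerXn2r; rewrite ?nnegrE ?invr_ge0// (le_trans _ cv)// (le_trans _ c1)// invr_ge0.
have q : 2^-1 ^+ 2 = 4^-1 :> R by rewrite expr2 -invfM -natrM.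
lra.
Qed.

Lemma sub_cos_ge (x : R) : 0 < x -> x <= pi -> x ^+ 2 / 16 <= 2 * (1 - cos x).
Proof.
move=> x0 xp; have h2 : x / 2 <= pi / 2 by rewrite ler_pM2r ?invr_gt0.
have := sin_sqr_ge (divr_gt0 x0 (ltr0n _ 2)) h2.
have e : cos x = 2 * cos (x / 2) ^+ 2 - 1.
  by rewrite [in LHS](_ : x = (x / 2) *+ 2) ?cos_mulr2n ?mulr_natl// -mulr_natr divfK.
by rewrite e sin2cos2 expr_div_n (_ : 2 ^+ 2 = 4 :> R) ?expr2 -?natrM//; lra.
Qed.

End Cosine.

(** * Decay of D(cos theta) relative to D(1) *)

Section NeedletDecay.
Context {R : realType} (d : nat).
Hypothesis hd : (2 <= d)%N.
Variables (S : nat -> R) (b : nat -> R -> R).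
Hypotheses (hS : scale_sequence S) (hb : weight_functions S b).
Variables (alpha beta g1 g2 : R) (g : R -> R).
Hypotheses (halpha : 2 < alpha) (hg1 : 0 < g1).
Hypothesis g_smooth : forall n u, 0 < u -> derivable (derive1n n g) u 1.
Hypothesis g_bounds : forall u, 0 < u -> g1 <= g u <= g2.
Hypothesis hbeta : 0 <= beta < 1.
Hypothesis g_derive : forall r : nat, exists M : R, \forall u \near +oo,
  `|derive1n r g u| <= M * u `^ (- ((1 - beta) * r%:R)).
Variable N : nat.
Local Notation lam := (@eta R d).
Local Notation w := (@zonal_weight R d).

Let Delta j := S j - S j.-1.
Let m j := Num.min (S j.-1 `^ (1 - beta)) (Delta j).
(** The size of C_l, frozen at its value for S_j when l < S_j: there the flatness of b_j makes up
    for the growth of l^(-alpha). *)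
Let V j (l : nat) : R := Num.max l%:R (S j) `^ (- alpha).
(** Starting about S_(j-1) / 2, well below the support, leaves space for the indices lost to N
    applications of [zlap] once m is large. *)
Let a j := (Num.truncn (S j.-1 / 2)).+1.
Let L j := (Num.truncn (S j.+1)).+1.

Definition power_spectrum_of (C : nat -> R) :=
  forall l, (0 < l)%N -> C l = l%:R `^ (- alpha) * g l%:R.

Let c (C : nat -> R) j l := b j l%:R ^+ 2 * C l.

Let S1 j : 1 <= S j. Proof. exact: scale_ge1. Qed.
Let S0 j : 0 < S j. Proof. exact: lt_le_trans (S1 j). Qed.
Let alpha0 : 0 <= alpha. Proof. by rewrite (le_trans _ (ltW halpha)). Qed.

Let m_leS j : m j <= S j.-1.
Proof.
have b1 : 1 - beta <= 1 by case/andP: hbeta => b0 _; rewrite gerBl.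
rewrite (@le_trans _ _ (S j.-1 `^ (1 - beta))) ?ge_min ?lexx// -[leRHS](powRr1 (ltW (S0 j.-1))).
exact: ler_powR (S1 _) _ _ b1.
Qed.

Let m_leD j : m j <= Delta j. Proof. by rewrite ge_min lexx orbT. Qed.

Let a_ge j : S j.-1 / 2 <= (a j)%:R.
Proof. by rewrite ltW// truncnS_gt. Qed.

Let a_le j : (a j)%:R <= S j.-1 / 2 + 1.
Proof.
have := truncn_itv (x := S j.-1 / 2); rewrite divr_ge0 ?(ltW (S0 _))// => /(_ isT) /andP[h _].
by rewrite /a -natr1 lerD2r.
Qed.

Let V_nonincr j : nonincr (V j).
Proof.
move=> l; apply: le_powRN => //; first by rewrite lt_max S0 orbT.
by rewrite ge_max !le_max lexx orbT andbT ler_nat leqnSn.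
Qed.

Lemma diff_class_dom (x K : nat) (mu A A' : R) W U (h : nat -> R) : 0 < mu ->
  (forall l, (x <= l)%N -> A * W l <= A' * U l) ->
  diff_class x K mu A W h -> diff_class x K mu A' U h.
Proof.
move=> mu0 VU hc k l kK al; rewrite (le_trans (hc k l kK al))//.
rewrite mulrAC [leRHS]mulrAC ler_wpM2r ?VU//.
by rewrite invr_ge0 exprn_ge0// ltW.
Qed.

Lemma diff_classZ (x K : nat) (mu A k : R) W (h : nat -> R) : 0 <= k ->
  diff_class x K mu A W h -> diff_class x K mu (k * A) W (fun l => k * h l).
Proof.
move=> k0 hc i l iK xl.
have -> : iter i fdiff (fun l => k * h l) l = k * iter i fdiff h l.
  by elim: i {iK} l {xl} => //= i IH l; rewrite /fdiff !IH -mulrBr.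
by rewrite normrM ger0_norm// -!mulrA ler_wpM2l// mulrA hc.
Qed.

(** A product of b_j, b_j, l^(-alpha) and g, each in a difference class. The step is m / 2 because
    the classes start near S_(j-1) / 2, and (S_(j-1) / 2)^(1 - beta) >= S_(j-1)^(1 - beta) / 2. *)
Lemma coef_diff_class : exists2 A : R, 0 <= A & exists U : R, forall C j,
  power_spectrum_of C -> (0 < j)%N -> U <= m j -> 0 < m j ->
  diff_class (a j) (2 * N) (m j / 2) A (V j) (c C j).
Proof.
(* With n >= alpha, (l / S_j)^n l^(-alpha) <= S_j^(-alpha) for l <= S_j. *)
pose n := (Num.truncn alpha).+1.
have [Bb Bb0 hBb] := weight_diff_class hS hb n (2 * N).
have [B1 B10 hB1] := weight_diff_class hS hb 0 (2 * N).
have [Ba Ba0 hBa] := powR_diff_class (2 * N) alpha0 (lexx 0).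
have [Bg Bg0 [Ug hBg]] := growth_diff_class (2 * N) g_smooth (proj2 (andP hbeta)) g_derive.
exists (2 ^+ (2 * N) * (2 ^+ (2 * N) * Bb * B1) * (2 ^+ (2 * N) * Ba * Bg)).
  by rewrite !mulr_ge0 ?exprn_ge0.
exists (2 * Ug) => C j hC j0 Um m0.
have mu0 : 0 < m j / 2 by rewrite divr_gt0.
have mS := m_leS j; have aj := a_ge j.
have mua : m j / 2 <= (a j)%:R by rewrite (le_trans _ aj)// ler_pM2r ?invr_gt0.
have muD : 0 < m j / 2 <= Delta j.
  by rewrite mu0 (le_trans _ (m_leD j))// ler_pdivrMr// ler_peMr ?ler1n// ltW.
have c1 := hBb j (a j) _ j0 muD isT aj.
(* One factor b_j carries the flatness; the other enters with exponent 0. *)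
have c2 := hB1 j (a j) _ j0 muD isT aj.
have {}c2 : diff_class (a j) (2 * N) (m j / 2) B1 (fun=> 1) (fun l => b j l%:R).
  by apply: diff_class_dom mu0 _ c2 => l _; rewrite expr0.
have c3 : diff_class (a j) (2 * N) (m j / 2) Ba (fun l => Num.max l%:R 1 `^ (- alpha))
    (fun l => l%:R `^ (- alpha)).
  have muaj : 0 < m j / 2 <= (a j)%:R by rewrite mu0.
  have := hBa (a j) _ isT muaj; move=> h k l kK al; have := h k l kK al.
  rewrite (@eq_iter_fdiff _ _ (fun l => l%:R `^ (- alpha))); last by move=> i; rewrite addr0.
  rewrite addr0 max_l//; rewrite ler1n; exact: leq_trans al.
have c4 : diff_class (a j) (2 * N) (m j / 2) Bg (fun=> 1) (fun l => g l%:R).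
  apply: hBg => //.
    apply: le_trans aj; rewrite ler_pdivlMr// mulrC (le_trans Um)//.
  apply: (@le_trans _ _ ((S j.-1 / 2) `^ (1 - beta))); last first.
    rewrite ge0_ler_powR ?nnegrE//; first by rewrite subr_ge0 ltW//; case/andP: hbeta.
    by rewrite divr_ge0// ltW.
  rewrite powRM ?invr_ge0// ?(ltW (S0 _))//; apply: ler_pM => //; try exact: ltW.
    by rewrite ge_min lexx.
  have h2 : (2 : R) `^ (1 - beta) <= 2.
    rewrite -[leRHS](powRr1 (ltW (ltr0n R 2))); apply: ler_powR; first by rewrite ler1n.
    by case/andP: hbeta => b0 _; rewrite gerBl.
  rewrite -powR_inv1// -powRrM mulrC powRrM powR_inv1 ?powR_ge0//.
  by rewrite powR_inv1 ?powR_ge0// lef_pV2 ?posrE ?powR_gt0.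
have n1 : nonincr (fun=> 1 : R) by move=> l.
have n2 : nonincr (fun l : nat => Num.max l%:R (1 : R) `^ (- alpha) * 1).
  move=> l; rewrite !mulr1; apply: le_powRN => //.
  by rewrite ge_max !le_max lexx orbT andbT ler_nat leqnSn.
have p1 := diff_classM mu0 Bb0 B10 n1 c1 c2.
have p2 := diff_classM mu0 Ba0 Bg0 n1 c3 c4.
have p3 := diff_classM mu0 (mulr_ge0 (mulr_ge0 (exprn_ge0 _ (ler0n _ 2)) Bb0) B10)
  (mulr_ge0 (mulr_ge0 (exprn_ge0 _ (ler0n _ 2)) Ba0) Bg0) n2 p1 p2.
(* The power law holds from l = 1 on; at l = 0 both sides vanish since b_j(0) = 0. *)
have e : c C j =1 (fun l => b j l%:R * b j l%:R * (l%:R `^ (- alpha) * g l%:R)).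
  move=> [|l]; rewrite /c; last by rewrite hC.
  have -> : b j 0%:R = 0 by apply: (weight_eq0 hb j0 (lexx 0)); left; exact: ltW (S0 _).
  by rewrite expr0n !mul0r.
rewrite (funext e); apply: diff_class_dom mu0 _ p3 => l al.
have l0 : (0 < l)%N by exact: leq_trans al.
have lp : 0 < l%:R :> R by rewrite ltr0n.
rewrite ler_wpM2l ?mulr_ge0 ?exprn_ge0// !mulr1 max_l ?ler1n// /V.
have [Sl|lS] := leP (S j) l%:R.
  rewrite ler_piMl ?powR_ge0//; apply: exprn_ile1; last by rewrite ge_min lexx.
  by rewrite le_min ler01 divr_ge0// ltW.
have x1 : l%:R / S j <= 1 by rewrite ler_pdivrMr// mul1r ltW.
have x0 : 0 < l%:R / S j by rewrite divr_gt0.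
rewrite min_r// -powR_mulrn ?(ltW x0)//.
have na : alpha <= n%:R by rewrite ltW// truncnS_gt.
apply: (@le_trans _ _ ((l%:R / S j) `^ alpha * l%:R `^ (- alpha))).
  by rewrite ler_wpM2r ?powR_ge0//; apply: ger_powR; rewrite ?x0.
rewrite powRM ?invr_ge0 ?(ltW lp) ?(ltW (S0 j))// mulrAC -powRD; last first.
  by rewrite (gt_eqF lp) implybT.
by rewrite subrr powRr0 mul1r -powR_inv1 ?(ltW (S0 j))// -powRrM mulN1r.
Qed.

(** [zlap] reaches one index to each side, so every application shortens the range of zeros by
    one. *)
Lemma iter_zlap_low (h : nat -> R) l0 n : (forall l, (l < l0)%N -> h l = 0) ->
  forall l, (l + n < l0)%N -> iter n (zlap lam) h l = 0.
Proof.
move=> h0; elim: n => [|n IH] l; first by rewrite addn0; exact: h0.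
rewrite addnS => ll; rewrite /= /zlap !IH; first by ring.
all: by lia.
Qed.

(** [iter_zlap_le] yields the profile at l - N; as N <= m <= S_j, moving to l costs only 2^alpha.
    The factor 2^(2N) converts the step m / 2 into m. *)
Lemma zlap_coef_le : exists2 A : R, 0 <= A & exists U : R, forall C j,
  power_spectrum_of C -> (0 < j)%N -> U <= m j -> 0 < m j ->
  forall l, (a j + N <= l)%N ->
  `|iter N (zlap lam) (c C j) l| <= A * m j ^- (2 * N) * V j l.
Proof.
have [A A0 [U hA]] := coef_diff_class.
have [Br Br0 hBr] := powR_diff_class (2 * N) ler01 (ltW (@eta_gt0 R d hd)).
have lam0 := @eta_gt0 R d hd.
have X0 : 0 <= 1 + 2 ^+ (2 * N) * (lam * Br).
  apply: addr_ge0 => //; apply: mulr_ge0; first exact: exprn_ge0.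
  by apply: mulr_ge0 => //; exact: ltW.
exists ((1 + 2 ^+ (2 * N) * (lam * Br)) ^+ N * A * 2 ^+ (2 * N) * 2 `^ alpha).
  apply: mulr_ge0; last exact: powR_ge0.
  apply: mulr_ge0; last exact: exprn_ge0.
  by apply: mulr_ge0 => //; exact: exprn_ge0.
exists (Num.max U N%:R) => C j hC j0; rewrite ge_max => /andP[Um Nm] m0 l al.
have mu0 : 0 < m j / 2 by rewrite divr_gt0.
have muaj : 0 < m j / 2 <= (a j)%:R.
  by rewrite mu0 (le_trans _ (a_ge j))// ler_pM2r ?invr_gt0.
have hB := diff_classZ (ltW lam0) (hBr (a j) _ isT muaj).
have {}hB : diff_class (a j) (2 * N) (m j / 2) (lam * Br / (m j / 2)) (fun=> 1) (fun l => lam / (l%:R + lam)).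
  have e : (fun l => lam / (l%:R + lam)) =1 (fun l : nat => lam * (l%:R + lam) `^ (-1)).
    by move=> i; rewrite powR_inv1// addr_ge0// ltW.
  rewrite (funext e); apply: (diff_class_dom mu0 _ hB) => i ai.
  rewrite mulr1 ler_wpM2l//; first by apply: mulr_ge0 => //; exact: ltW.
  have il : (a j)%:R <= i%:R :> R by rewrite ler_nat.
  have ip : m j / 2 <= i%:R + lam.
    by case/andP: muaj => _ h; rewrite (le_trans h)// (le_trans il)// lerDl ltW.
  have ip0 : 0 < i%:R + lam := lt_le_trans mu0 ip.
  by rewrite (powR_inv1 (ltW ip0)) lef_pV2 ?posrE.
have := iter_zlap_le lam0 mu0 A0 (mulr_ge0 (ltW lam0) Br0) (V_nonincr j) hB (hA C j hC j0 Um m0) al.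
move=> /le_trans; apply.
have VN : V j (l - N) <= 2 `^ alpha * V j l.
  have x0 : 0 < Num.max l%:R (S j) by rewrite lt_max S0 orbT.
  have y0 : 0 < Num.max (l - N)%:R (S j) by rewrite lt_max S0 orbT.
  have NS : N%:R <= S j.
    by rewrite (le_trans Nm)// (le_trans (m_leS j))// (scale_le hS)// leq_pred.
  have xy : Num.max l%:R (S j) <= 2 * Num.max (l - N)%:R (S j).
    have y1 : S j <= Num.max (l - N)%:R (S j) by rewrite le_max lexx orbT.
    have y2 : (l - N)%:R <= Num.max (l - N)%:R (S j) by rewrite le_max lexx.
    rewrite ge_max; apply/andP; split; last lra.
    have : l%:R <= (l - N)%:R + N%:R :> R by rewrite -natrD ler_nat addnC -leq_subLR.
    lra.
  have -> : V j (l - N) = 2 `^ alpha * (2 * Num.max (l - N)%:R (S j)) `^ (- alpha).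
    rewrite powRM ?(ltW y0)// mulrA -powRD ?subrr ?powRr0 ?mul1r//.
    by rewrite pnatr_eq0 implybT.
  rewrite ler_wpM2l ?powR_ge0//; exact: le_powRN.
rewrite [leRHS](_ : _ = (1 + 2 ^+ (2 * N) * (lam * Br)) ^+ N * A * (m j / 2) ^- (2 * N) * (2 `^ alpha * V j l)).
  rewrite ler_wpM2l//; apply: mulr_ge0; first by apply: mulr_ge0 => //; exact: exprn_ge0.
  by rewrite invr_ge0 exprn_ge0// ltW.
by rewrite expr_div_n invf_div; ring.
Qed.

Lemma coef_ge0 C j l : power_spectrum_of C -> (0 < j)%N -> 0 <= c C j l.
Proof.
move=> hC j0; rewrite /c; case: l => [|l].
  have -> : b j 0%:R = 0 by apply: (weight_eq0 hb j0 (lexx 0)); left; exact: ltW (S0 _).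
  by rewrite expr0n mul0r.
rewrite mulr_ge0 ?sqr_ge0// hC// mulr_ge0 ?powR_ge0//.
by have := g_bounds (ltr0Sn R l) => /andP[h _]; rewrite (le_trans _ h)// ltW.
Qed.

(** D(1) is bounded below through the indices in [s, s + M[, just right of S_j, where b_j^2 >= 3/4,
    and [weighted_sum_le] compares the whole range with that block. Convexity of the scales gives
    S_j - S_(j-1) <= S_(j+1) - S_j, so the block also controls the part left of S_j. *)
Lemma block_sum_le : exists2 A : R, 0 <= A & exists U : R, forall C j,
  power_spectrum_of C -> (0 < j)%N -> U <= m j -> 0 < m j ->
  \sum_((Num.truncn (S j.-1)).+1 - N <= l < L j + N) V j l * w l <=
  A * needlet_cov d C b j (L j) 1.
Proof.
have [Uw [k [k0 k1 hw]]] := weight_right_ge hS hb.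
(* M is at least k (S_(j+1) - S_j) / 2, so M p >= 2 (S_(j+1) - S_j), which covers either side of the
   support together with N extra indices. *)
pose p := (Num.truncn (4 / k)).+1.
have pk : 4 / k <= p%:R by rewrite ltW// truncnS_gt.
pose W : R := p%:R ^+ d.-1.
exists (p%:R * (W + 4 `^ alpha) * (3 / 4 * g1)^-1).
  by rewrite !mulr_ge0 ?addr_ge0 ?exprn_ge0 ?powR_ge0// invr_ge0 !mulr_ge0 ?invr_ge0// ltW.
(* N + 2 accommodates roundings and the N extra indices; 2 / k ensures k (S_(j+1) - S_j) >= 2, so
   that rounding costs at most half of it. *)
exists (Num.max Uw (N%:R + 2 + 2 / k)) => C j hC j0.
rewrite ge_max => /andP[Uwm Nm] m0.
have mS := m_leS j; have mD := m_leD j.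
have Sj1 : S j.-1 <= S j by rewrite (scale_le hS)// leq_pred.
have k2 : 0 < 2 / k by rewrite divr_gt0.
have N0 : 0 <= N%:R :> R by [].
set D1 := S j.+1 - S j.
have DD : Delta j <= D1 by exact: scale_convex.
have Dk : 2 <= k * D1.
  by rewrite -ler_pdivrMl// mulrC; move: Nm mD DD; rewrite /Delta; lra.
pose M := Num.truncn (k * D1).
have kD0 : 0 <= k * D1 by lra.
have [M1 M2] : M%:R <= k * D1 /\ k * D1 < M%:R + 1.
  by have := truncn_itv kD0; rewrite -natr1 => /andP[].
pose s := (Num.truncn (S j)).+1.
have s1 : S j < s%:R by exact: truncnS_gt.
have s2 : s%:R <= S j + 1.
  by have := truncn_itv (ltW (S0 j)); rewrite /s -natr1 lerD2r => /andP[].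
have Mp : 2 * D1 <= (M * p)%:R.
  rewrite natrM; apply: (@le_trans _ _ (k * D1 / 2 * (4 / k))).
    by rewrite le_eqVlt; apply/orP; left; apply/eqP; field; rewrite gt_eqF.
  by apply: ler_pM => //; [lra|rewrite divr_ge0// ltW|lra].
have [t1 t2] : (Num.truncn (S j.-1))%:R <= S j.-1 /\ S j.-1 < (Num.truncn (S j.-1)).+1%:R.
  by have := truncn_itv (ltW (S0 j.-1)) => /andP[].
have [L1 L2] : (L j)%:R <= S j.+1 + 1 /\ S j.+1 < (L j)%:R.
  have := truncn_itv (ltW (S0 j.+1)) => /andP[h1 h2]; split => //.
  by rewrite /L -natr1 lerD2r.
have w0 l : 0 <= w l by rewrite ltW// zonal_weight_gt0.
set lo := ((Num.truncn (S j.-1)).+1 - N)%N.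
have lo1 : S j.-1 - N%:R <= lo%:R.
  have : (Num.truncn (S j.-1)).+1%:R <= lo%:R + N%:R :> R by rewrite -natrD ler_nat addnC -leq_subLR.
  lra.
have ND : N%:R + 2 <= Delta j by move: Nm mD; rewrite /Delta; lra.
apply: (@le_trans _ _ (p%:R * (W + 4 `^ alpha) * \sum_(r < M) (s + r)%:R `^ (- alpha) * w (s + r)%N)).
  apply: weighted_sum_le => //.
  - by move=> l l'; exact: zonal_weight_le.
  - by move=> l l'; exact: zonal_weight_doubling.
  - by rewrite exprn_ge0.
  - by rewrite (ltW s1).
  - rewrite -(ler_nat R) !natrD; move: L1 s1 Mp ND DD; rewrite /Delta /D1; lra.
  - rewrite -(ler_nat R) natrD; move: s2 lo1 Mp ND DD; rewrite /Delta /D1; lra.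
  - have := S1 j.-1; move: s2 lo1 ND; rewrite /Delta; lra.
rewrite -[leRHS]mulrA ler_wpM2l//.
  by rewrite mulr_ge0// addr_ge0 ?powR_ge0// exprn_ge0.
rewrite ler_pdivlMl; last by rewrite mulr_gt0.
have sML : (s + M <= L j)%N.
  rewrite -ltnS -(ltr_nat R) natrD.
  have kD : k * D1 <= D1 by rewrite ler_piMl// (le_trans _ DD)// /Delta; lra.
  by rewrite -[ltRHS]natr1; move: (le_trans M1 kD) s2 L2; rewrite /D1; lra.
pose F l := b j l%:R ^+ 2 * C l * w l.
have F0 l : 0 <= F l by rewrite mulr_ge0// coef_ge0.
have -> : needlet_cov d C b j (L j) 1 = \sum_(0 <= l < L j) F l.
  by rewrite big_mkord; apply: eq_bigr => l _; rewrite /F /zonal_weight !mulrA.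
rewrite (big_cat_nat (n := s))//=; last by rewrite (leq_trans _ sML)// leq_addr.
rewrite (big_cat_nat (m := s) (n := (s + M)%N))//= ?leq_addr//.
rewrite ler_wpDl ?sumr_ge0// ler_wpDr ?sumr_ge0//.
rewrite -[X in \sum_(X <= _ < _) _]add0n big_addn addKn big_mkord mulr_sumr.
apply: ler_sum => r _; rewrite addnC mulrA /F ler_wpM2r//.
have sr : (0 < r + s)%N by rewrite addn_gt0 orbT.
rewrite hC// -[leLHS]mulrA; apply: ler_pM => //.
    by rewrite mulr_ge0 ?powR_ge0// ltW.
  apply: hw => //; first by rewrite (le_trans Uwm)// (le_trans mS).
  have rM : (r%:R + 1 <= M%:R :> R) by rewrite natr1 ler_nat.
  rewrite natrD; apply/andP; split; first by rewrite (le_trans (ltW s1))// lerDr.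
  by move: rM M1 s2; rewrite /D1; lra.
rewrite mulrC ler_wpM2l ?powR_ge0//.
by have := g_bounds (u := (r + s)%:R); rewrite ltr0n => /(_ sr) /andP[].
Qed.

Lemma weight_scale_eq0 j l : (0 < j)%N -> (L j <= l)%N -> b j l%:R = 0.
Proof.
move=> j0 Ll; apply: (weight_eq0 hb j0) => //; right.
by rewrite ltW// (lt_le_trans (truncnS_gt _))// ler_nat.
Qed.

Let bound j theta := Num.max (1 / (S j.-1 `^ (1 - beta) * theta) ^+ (2 * N))
  (1 / ((S j - S j.-1) * theta) ^+ (2 * N)).

(** If m theta < B, then D(cos theta) <= D(1) is enough because B^(2N) / (m theta)^(2N) >= 1.
    Otherwise theta <= 4 forces m >= B / 4, which meets every threshold on m. The two summands of CN
    serve these two cases. *)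
Lemma needlet_cov_decay : exists2 CN : R, 0 < CN & forall C j theta,
  power_spectrum_of C -> (0 < j)%N -> 0 < theta <= pi ->
  (forall l, `|(gegenbauer lam l).[cos theta]| <= (gegenbauer lam l).[1]) ->
  0 <= needlet_cov d C b j (L j) 1 /\
  needlet_cov d C b j (L j) (cos theta) <=
    CN * bound j theta * needlet_cov d C b j (L j) 1.
Proof.
have [A1 A10 [U1 h1]] := zlap_coef_le; have [A2 A20 [U2 h2]] := block_sum_le.
(* B / 4 exceeds both thresholds U1 and U2; its part 4 N + 4 places [a j] + N below the first index
   that can contribute. *)
pose B := 4 * (`|U1| + `|U2| + 4 * N%:R + 4).
have B0 : 0 < B by rewrite mulr_gt0// ltr_wpDl// !addr_ge0// mulr_ge0.
exists (B ^+ (2 * N) + 16 ^+ N * A1 * A2).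
  by rewrite ltr_wpDr ?exprn_gt0// !mulr_ge0// exprn_ge0.
move=> C j theta hC j0 /andP[t0 tpi] hG.
have c0 l : 0 <= c C j l by exact: coef_ge0.
have w0 l : 0 <= w l by rewrite ltW// zonal_weight_gt0.
have lam0 := @eta_gt0 R d hd.
have covE t : needlet_cov d C b j (L j) t =
    \sum_(l < L j) c C j l * (l%:R + lam) * (gegenbauer lam l).[t] by [].
have D1E : needlet_cov d C b j (L j) 1 = \sum_(l < L j) c C j l * w l.
  by rewrite covE; apply: eq_bigr => l _; rewrite mulrA.
have D0 : 0 <= needlet_cov d C b j (L j) 1.
  by rewrite D1E sumr_ge0// => l _; rewrite mulr_ge0.
split=> //.
have m0 : 0 < m j.
  rewrite lt_min powR_gt0//= subr_gt0; move: j0; case: (j) => // i _.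
  exact: (scale_increasing hS).
have mt0 : 0 < m j * theta by rewrite mulr_gt0.
have mb : 1 / (m j * theta) ^+ (2 * N) <= bound j theta.
  by rewrite /bound le_max /m /Num.min; case: ifP; rewrite lexx ?orbT.
have mb0 : 0 < 1 / (m j * theta) ^+ (2 * N) by rewrite divr_gt0// exprn_gt0.
have bound0 : 0 <= bound j theta by rewrite (le_trans (ltW mb0)).
have D1 : needlet_cov d C b j (L j) (cos theta) <= needlet_cov d C b j (L j) 1.
  rewrite !covE; apply: ler_sum => l _; rewrite ler_wpM2l//.
    by rewrite mulr_ge0// addr_ge0// ltW.
  by rewrite (le_trans (ler_norm _)).
have [mB|mB] := ltP (m j * theta) B.
  apply: (le_trans D1); rewrite ler_peMl// mulrDl.
  apply: (@le_trans _ _ (B ^+ (2 * N) * bound j theta)); last first.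
    by rewrite lerDl !mulr_ge0// exprn_ge0.
  apply: (@le_trans _ _ (B ^+ (2 * N) * (1 / (m j * theta) ^+ (2 * N)))); last first.
    by rewrite ler_wpM2l// exprn_ge0// ltW.
  rewrite mulrA mulr1 ler_pdivlMr ?exprn_gt0// mul1r.
  by apply: lerXn2r; rewrite ?nnegrE ltW.
have m4 : `|U1| + `|U2| + 4 * N%:R + 4 <= m j.
  have p4 : theta <= 4 by rewrite (le_trans tpi)//; have := pihalf_lt2 R; lra.
  rewrite -(@ler_pM2r _ 4)// mulrC -/B (le_trans mB)// ler_wpM2l// ltW//.
have N0 : 0 <= N%:R :> R by [].
have [q1 q2] : U1 <= m j /\ U2 <= m j.
  have := ler_norm U1; have := ler_norm U2; have := normr_ge0 U1; have := normr_ge0 U2.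
  by split; lra.
have {}h1 := h1 C j hC j0 q1 m0; have {}h2 := h2 C j hC j0 q2 m0.
set D := needlet_cov d C b j (L j) (cos theta) in D1 *.
have key : (theta ^+ 2 / 16) ^+ N * `|D| <= A1 * m j ^- (2 * N) * (A2 * needlet_cov d C b j (L j) 1).
  have cz l : (L j <= l)%N -> c C j l = 0.
    by move=> Ll; rewrite /c weight_scale_eq0// expr0n mul0r.
  have tc := sub_cos_ge t0 tpi.
  have tc0 : 0 <= theta ^+ 2 / 16 by rewrite divr_ge0// sqr_ge0.
  apply: (@le_trans _ _ ((2 * (1 - cos theta)) ^+ N * `|D|)).
    by rewrite ler_wpM2r//; apply: lerXn2r; rewrite ?nnegrE// (le_trans tc0).
  rewrite -[X in X * _]ger0_norm; last by rewrite exprn_ge0// (le_trans tc0).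
  rewrite -normrM /D covE -(iter_zlap_sum lam0 _ _ cz).
  apply: (le_trans (ler_norm_sum _ _ _)).
  (* Below [lo] the iterates vanish by [iter_zlap_low]; from [lo] on, which is at least [a j] + N,
     the estimate [h1] applies. *)
  set lo := ((Num.truncn (S j.-1)).+1 - N)%N in h2.
  apply: (@le_trans _ _ (\sum_(l < L j + N) `|iter N (zlap lam) (c C j) l| * w l)).
    apply: ler_sum => l _; rewrite !normrM -mulrA ler_wpM2l//.
    have ll0 : 0 <= (l : nat)%:R + lam by rewrite addr_ge0// ltW.
    by rewrite (ger0_norm ll0) /zonal_weight ler_wpM2l.
  apply: (@le_trans _ _ (A1 * m j ^- (2 * N) * \sum_(lo <= l < L j + N) V j l * w l)); last first.
    by rewrite ler_wpM2l// mulr_ge0// invr_ge0 exprn_ge0// ltW.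
  have [t1 t2] : (Num.truncn (S j.-1))%:R <= S j.-1 /\ S j.-1 < (Num.truncn (S j.-1)).+1%:R.
    by have := truncn_itv (ltW (S0 j.-1)) => /andP[].
  have mS := m_leS j.
  have alo : (a j + N <= lo)%N.
    have : (a j + N + N <= (Num.truncn (S j.-1)).+1)%N.
      by rewrite -(ler_nat R) !natrD; have := a_le j; have := normr_ge0 U1; have := normr_ge0 U2; lra.
    by move=> h; rewrite /lo -(leq_add2r N) subnK// (leq_trans (leq_addl _ _) h).
  have loL : (lo <= L j + N)%N.
    rewrite (leq_trans (leq_subr _ _))// (leq_trans _ (leq_addr _ _))//.
    by rewrite ltnS; apply: le_truncn; rewrite (scale_le hS)// (leq_trans (leq_pred _)).
  rewrite -(big_mkord xpredT (fun l => `|iter N (zlap lam) (c C j) l| * w l)).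
  rewrite (big_cat_nat (n := lo))//= [X in X + _](_ : _ = 0) ?add0r; last first.
    rewrite big_nat_cond big1// => l /andP[/andP[_ llo] _].
    rewrite (iter_zlap_low (l0 := (Num.truncn (S j.-1)).+1)) ?normr0 ?mul0r//.
      move=> i iS; rewrite /c (weight_eq0 hb j0) ?expr0n ?mul0r//; left.
      by rewrite (le_trans _ t1)// ler_nat -ltnS.
    by move: llo; rewrite /lo ltn_subRL addnC.
  rewrite mulr_sumr; apply: ler_sum_nat => l /andP[lol _].
  rewrite mulrA ler_wpM2r// h1//; exact: leq_trans alo lol.
apply: (le_trans (ler_norm _)).
have th0 : 0 < (theta ^+ 2 / 16) ^+ N by rewrite exprn_gt0// divr_gt0// exprn_gt0.
rewrite -(ler_pM2l th0) (le_trans key)//.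
apply: (@le_trans _ _ ((theta ^+ 2 / 16) ^+ N * (16 ^+ N * A1 * A2 * (1 / (m j * theta) ^+ (2 * N)) *
    needlet_cov d C b j (L j) 1))).
  rewrite le_eqVlt; apply/orP; left; apply/eqP.
  rewrite expr_div_n -exprM exprMn; move: (needlet_cov _ _ _ _ _ _) => X.
  by field; rewrite ?expf_neq0 ?gt_eqF.
rewrite ler_wpM2l ?(ltW th0)// ler_wpM2r//; apply: ler_pM => //.
- by rewrite !mulr_ge0// exprn_ge0.
- exact: ltW.
- by rewrite lerDr exprn_ge0// ltW.
Qed.

End NeedletDecay.

Theorem theorem1p4 (R : realType) (d : nat) (hd : (2 <= d)%N)
  (S : nat -> R) (hS : scale_sequence S)
  (b : nat -> R -> R) (hb : weight_functions S b)
  (alpha beta g1 g2 : R) (halpha : 2 < alpha)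
  (g : R -> R)
  (g_smooth : forall n u, 0 < u -> derivable (derive1n n g) u 1)
  (hg1 : 0 < g1) (hg12 : g1 <= g2)
  (g_bounds : forall u, 0 < u -> g1 <= g u <= g2)
  (hbeta : 0 <= beta < 1)
  (g_derive : forall r : nat, exists M : R, \forall u \near +oo,
     `|derive1n r g u| <= M * u `^ (- ((1 - beta) * r%:R)))
  (N : nat) :
  exists2 CN : R, 0 < CN &
    forall (dO : measure_display) (Omega : measurableType dO)
      (P : probability Omega R) (f : Omega -> d.+1.-tuple R -> R[i])
      (C : nat -> R),
    isotropic_field P f ->
    angular_power_spectrum P f C ->
    (forall l : nat, (0 < l)%N -> C l = l%:R `^ (- alpha) * g l%:R) ->
    \forall j \near \oo, forall x y : d.+1.-tuple R,
      sphere d x -> sphere d y -> 0 < acos (dotp x y) ->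
      ccorrelation P (needlet_coef b f j x) (needlet_coef b f j y) <=
      (CN * Num.max
        (1 / ((S j.-1 `^ (1 - beta)) * acos (dotp x y)) ^+ (2 * N))
        (1 / ((S j - S j.-1) * acos (dotp x y)) ^+ (2 * N)))%:C.
Proof.
have [CN CN0 hCN] := needlet_cov_decay hd hS hb halpha hg1 g_smooth g_bounds hbeta g_derive N.
exists CN => // dO Omega P f C hf hC Cg; near=> j => x y Sx Sy th0.
(* Positivity is all that is asked of j, small values of m being absorbed into CN. *)
have j0 : (0 < j)%N by near: j; exact: nbhs_infty_gt.
have [N' [Y [a hs]]] := hC; have hY := spectral_basis hs.
(* Cauchy-Schwarz for unit vectors, read off the Gegenbauer bound in degree one, where G_1(t) = 2
   lam t. *)
have t1 : -1 <= dotp x y <= 1.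
  have := gegenbauer_le1 hd hY 1 Sx Sy; have e0 : 0 < 2 * @eta R d := mulr_gt0 (ltr0n R 2) (@eta_gt0 R d hd).
  rewrite /= !hornerZ !hornerX mulr1 normrM (gtr0_norm e0).
  by rewrite (ger_pMr _ e0) ler_norml.
have tK : cos (acos (dotp x y)) = dotp x y by rewrite acosK// in_itv.
have hth : 0 < acos (dotp x y) <= pi by rewrite th0 acos_lepi.
have hG l : `|(gegenbauer (@eta R d) l).[cos (acos (dotp x y))]| <= (gegenbauer (@eta R d) l).[1].
  by rewrite tK; exact: (gegenbauer_le1 hd hY l Sx Sy).
have [D0 D1] := hCN C j _ Cg j0 hth hG.
rewrite tK in D1.
apply: (ccorrelation_needlet_le hd hf hC _ Sx Sy _ D0 D1).
  by move=> l; exact: weight_scale_eq0 hb _ _ j0.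
rewrite mulr_ge0 ?(ltW CN0)// le_max divr_ge0// exprn_ge0// mulr_ge0 ?powR_ge0// ltW//.
Unshelve. all: by end_near.
Qed.
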